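(* $(M_{\infty,\boxplus}(\mathbb R),\boxplus,\boxdot,\delta_0,\nu_{\infty,1,1})$ is a commutative semi-ring, with additive neutral element the Dirac measure $\delta_0$ and with the free Poisson distribution $\nu_{\infty,1,1}$ as multiplicative unit.
   Context: $M_c(\mathbb R)$ is the set of compactly supported Borel probability measures on $\mathbb R$. For $\mu\in M_c(\mathbb R)$ with moments $m_n(\mu)$, the free cumulants $\kappa_n(\mu)$, $n\ge1$, are determined by $m_n(\mu)=\sum_{\pi\in\operatorname{NC}(n)}\prod_{V\in\pi}\kappa_{|V|}(\mu)$ ($\operatorname{NC}(n)$ the non-crossing partitions of $\{1,\dots,n\}$), and $R_\mu(z)=\sum_{n\ge0}\kappa_{n+1}(\mu)z^n$ is the $R$-transform. The additive free convolution $\mu\boxplus\nu\in M_c(\mathbb R)$ is the distribution of the sum of two freely independent self-adjoint random variables with distributions $\mu$ and $\nu$; it is characterised by $R_{\mu\boxplus\nu}=R_\mu+R_\nu$. $M_{\infty,\boxplus}(\mathbb R)\subset M_c(\mathbb R)$ is the set of $\boxplus$-infinitely divisible measures: those $\mu$ such that for every $n\ge1$ there is $\mu_n\in M_c(\mathbb R)$ with $\mu=\mu_n^{\boxplus n}$. The operation $\boxdot$ is defined by $\mu\boxdot\nu:=R^{-1}(R_\mu\cdot_H R_\nu)$, where $\cdot_H$ is the Hadamard (coefficient-wise) product of power series and $R^{-1}$ is the inverse of the injective map $\mu\mapsto R_\mu$; i.e. $\mu\boxdot\nu$ is the measure with $\kappa_n(\mu\boxdot\nu)=\kappa_n(\mu)\kappa_n(\nu)$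 for all $n\ge1$ (that such a measure exists in $M_{\infty,\boxplus}(\mathbb R)$ for $\mu,\nu\in M_{\infty,\boxplus}(\mathbb R)$ is part of the assertion). $\nu_{\infty,1,1}$ is the free Poisson distribution with rate $1$ and jump size $1$, i.e. the measure with $R(z)=\frac1{1-z}$, all free cumulants equal to $1$. *)

(* Defs.v *)
From HB Require Import structures.
From mathcomp Require Import all_boot all_order all_algebra.
From mathcomp Require Import complex.
From mathcomp Require Import all_classical all_reals all_analysis giry.

Set Implicit Arguments.
Unset Strict Implicit.
Unset Printing Implicit Defensive.

Import Order.TTheory GRing.Theory Num.Theory.
Import numFieldNormedType.Exports.

Local Open Scope classical_set_scope.
Local Open Scope complex_scope.
Local Open Scope ring_scope.

Section Measures.
Variable R : realType.

Definition compactly_supported (mu : probability (measurableTypeR R) R) :=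
  exists2 K : set R, compact K & mu (~` K) = 0%E.

(* A library measure also takes (meaningless) values on non-measurable sets,
   so Leibniz equality is too fine: elements of Mc are to be compared with
   measure_eq (notation ≡μ), i.e. equality on all Borel sets. *)
Record Mc := MkMc {
  Mc_measure :> probability (measurableTypeR R) R;
  Mc_compact : compactly_supported Mc_measure }.

Definition moment (mu : Mc) (n : nat) : R := \int[mu]_x (x ^+ n).

End Measures.

Section NonCrossing.
Local Open Scope nat_scope.

Definition noncrossing n (P : {set {set 'I_n}}) : bool :=
  [forall V in P, forall W in P,
   forall a in V, forall b in W, forall c in V, forall d in W,
     [&& a < b, b < c & c < d] ==> (V == W)].

Definition NC n : {set {set {set 'I_n}}} :=
  [set P | finset.partition P [set: 'I_n] & noncrossing P].

End NonCrossing.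

Section Cumulants.
Variables (R : realType) (m : nat -> R).

(* The moment-cumulant formula solved for the term of the one-block partition;
   free_cumulants n = [:: kappa_1; ...; kappa_n]. See moment_cumulant. *)
Fixpoint free_cumulants (n : nat) : seq R :=
  if n is n'.+1 then
    let ks := free_cumulants n' in
    rcons ks (m n - \sum_(P in NC n | P != [set [set: 'I_n]]%SET)
                       \prod_(V in P) ks`_(#|V|.-1))
  else [::].

(* kappa_n, for n >= 1 *)
Definition free_cumulant_of (n : nat) : R := (free_cumulants n)`_n.-1.

Lemma size_free_cumulants n : size (free_cumulants n) = n.
Proof. by elim: n => //= n IHn; rewrite size_rcons IHn. Qed.

Lemma nth_free_cumulants n k : (0 < k <= n)%N ->
  (free_cumulants n)`_k.-1 = free_cumulant_of k.
Proof.
elim: n => [|n IHn] /andP[k0]; first by rewrite leqNgt k0.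
rewrite leq_eqVlt => /orP[/eqP -> //|]; rewrite ltnS => kn.
by rewrite /= nth_rcons size_free_cumulants prednK// kn IHn// k0.
Qed.

Lemma moment_cumulant n : (0 < n)%N ->
  m n = \sum_(P in NC n) \prod_(V in P) free_cumulant_of #|V|.
Proof.
case: n => // n _.
have fullNC : [set [set: 'I_n.+1]]%SET \in NC n.+1.
  rewrite inE; apply/andP; split.
    rewrite /finset.partition finset.cover1 eqxx finset.trivIset1 finset.in_set1.
    by rewrite eqtype.eq_sym -card_gt0 finset.cardsT card_ord.
  apply/forall_inP => V /set1P ->; apply/forall_inP => W /set1P ->.
  by do 4![apply/forall_inP => ? _]; rewrite eqxx implybT.
rewrite (bigD1 [set [set: 'I_n.+1]]%SET) //= big_set1 finset.cardsT card_ord.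
rewrite [free_cumulant_of _]/free_cumulant_of /=.
rewrite nth_rcons size_free_cumulants ltnn eqxx.
rewrite -addrA -[LHS]addr0; congr (_ + _); apply/esym/eqP.
rewrite addrC subr_eq0; apply/eqP.
apply: eq_bigr => P /andP[]; rewrite finset.in_set.
move=> /andP[/and3P[_ tivP P0] _] Pn1.
apply: eq_bigr => V VP; apply/esym/nth_free_cumulants.
have -> /= : (0 < #|V|)%N.
  by rewrite card_gt0; apply: contraNneq P0 => <-.
rewrite -ltnS -[X in (_ < X)%N](card_ord n.+1) -finset.cardsT.
apply: proper_card; rewrite properT; apply: contraNneq Pn1 => VT.
apply/eqP/setP => W; rewrite finset.in_set1 -VT; apply/idP/eqP => [WP|->//].
have /set0Pn[x xW] : W != finset.set0 by apply: contraNneq P0 => <-.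
rewrite -(def_pblock tivP WP xW).
by rewrite (def_pblock tivP VP _) // VT finset.in_setT.
Qed.

End Cumulants.

Section FreeConvolution.
Variable R : realType.

Definition free_cumulant (mu : Mc R) (n : nat) : R :=
  free_cumulant_of (moment mu) n.

(* The formal power series \sum_n kappa_(n+1) z^n, as its coefficients. *)
Definition Rtransform (mu : Mc R) : nat -> R :=
  fun n => free_cumulant mu n.+1.

Record star_probability_space := StarProbabilitySpace {
  carrier :> algType R[i];
  star : carrier -> carrier;
  state : {scalar carrier};
  starK : involutive star;
  starD : forall x y, star (x + y) = star x + star y;
  starZ : forall (c : R[i]) x, star (c *: x) = c^* *: star x;
  starM : forall x y, star (x * y) = star y * star x;
  state1 : state 1 = 1;
  state_ge0 : forall x, 0 <= state (star x * x) }.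

Definition selfadjoint (S : star_probability_space) (a : S) := star a = a.

(* Freeness of the unital subalgebras C[a] and C[b] (for self-adjoint a and b,
   these are the unital star-subalgebras generated by a and by b): an
   alternating product of centred elements p_1(a), p_2(b), p_3(a), ... is
   centred. The boolean tells which of the two subalgebras a factor is from. *)
Definition free_independent (S : star_probability_space) (a b : S) :=
  let elt (u : bool * {poly R[i]}) := horner_alg (if u.1 then a else b) u.2 in
  forall s : seq (bool * {poly R[i]}), s != [::] ->
    sorted (fun u v => u.1 != v.1) s ->
    (forall u, u \in s -> state S (elt u) = 0) ->
    state S (\prod_(u <- s) elt u) = 0.

(* A compactly supported measure is determined by its moments. *)
Definition has_law (S : star_probability_space) (a : S) (mu : Mc R) :=
  forall n, state S (a ^+ n) = (moment mu n)%:C.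

(* boxplus mu nu rho : "rho is the free additive convolution of mu and nu" *)
Definition boxplus (mu nu rho : Mc R) : Prop :=
  exists (S : star_probability_space) (a b : S),
    (selfadjoint a /\ selfadjoint b) /\
    [/\ free_independent a b, has_law a mu, has_law b nu
      & has_law (a + b) rho].

(* boxpower mu n rho : "rho is the n-fold free convolution of mu", n >= 1 *)
Inductive boxpower (mu : Mc R) : nat -> Mc R -> Prop :=
| boxpower1 : boxpower mu 1 mu
| boxpowerS n sigma rho :
    boxpower mu n sigma -> boxplus sigma mu rho -> boxpower mu n.+1 rho.

Definition infinitely_divisible (mu : Mc R) :=
  forall n, (0 < n)%N -> exists mu_n : Mc R, boxpower mu_n n mu.

Record Minf := MkMinf {
  Minf_measure :> Mc R;
  Minf_divisible : infinitely_divisible Minf_measure }.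

Definition Minf_eq (mu nu : Minf) : Prop := mu ≡μ nu.

(* The R-transform of rho is the Hadamard product of those of mu and nu. *)
Definition boxdot (mu nu rho : Mc R) : Prop :=
  Rtransform rho = Rtransform mu \* Rtransform nu.

(* R(z) = 1 / (1 - z) = \sum_n z^n *)
Definition free_poisson (rho : Mc R) : Prop := Rtransform rho = fun=> 1.

End FreeConvolution.

(* Commutative semiring laws, up to an equivalence relation. *)
Record comm_semiring (T : Type) (eqv : T -> T -> Prop)
    (add mul : T -> T -> T) (zero one : T) : Prop := CommSemiring {
  csr_refl : forall x, eqv x x;
  csr_sym : forall x y, eqv x y -> eqv y x;
  csr_trans : forall x y z, eqv x y -> eqv y z -> eqv x z;
  csr_add_eqv : forall x x' y y',
    eqv x x' -> eqv y y' -> eqv (add x y) (add x' y');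
  csr_mul_eqv : forall x x' y y',
    eqv x x' -> eqv y y' -> eqv (mul x y) (mul x' y');
  csr_addA : forall x y z, eqv (add x (add y z)) (add (add x y) z);
  csr_addC : forall x y, eqv (add x y) (add y x);
  csr_add0 : forall x, eqv (add zero x) x;
  csr_mulA : forall x y z, eqv (mul x (mul y z)) (mul (mul x y) z);
  csr_mulC : forall x y, eqv (mul x y) (mul y x);
  csr_mul1 : forall x, eqv (mul one x) x;
  csr_mulDl : forall x y z,
    eqv (mul (add x y) z) (add (mul x z) (mul y z));
  csr_mul0 : forall x, eqv (mul zero x) zero }.

(* Main.v *)
Require Import Defs.
From HB Require Import structures.
From mathcomp Require Import all_boot all_order all_algebra.
From mathcomp Require Import complex.
From mathcomp Require Import all_classical all_reals all_analysis giry.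
From mathcomp Require Import measurable_realfun.
From mathcomp Require Import -(notations) monalg.
From mathcomp Require Import zify ring lra.

Set Implicit Arguments.
Unset Strict Implicit.
Unset Printing Implicit Defensive.

Import Order.TTheory GRing.Theory Num.Theory.
Import numFieldNormedType.Exports.

Local Open Scope ring_scope.

(** Everything is read off from the free cumulants. A compactly supported measure
    is determined by its moments (moment_inj), hence by its free cumulants
    (cumulant_inj), so the semi-ring laws are those of sequences of real numbers
    under termwise addition and multiplication, provided that the sequences of
    free cumulants of infinitely divisible measures are stable under both
    operations and contain the constants 0 and 1. This holds because of the
    following description: (kappa_n) for n > 0 is the sequence of free cumulants
    of an infinitely divisible compactly supported measure if and only if it
    grows at most geometrically and the kernel (i, j) |-> kappa_(i+j+2) is
    positive semi-definite (levy_cumulants). Stability under sums is clear,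
    and stability under products is the Schur product theorem (psd_schur).

    In one direction (infinitely_divisible_levy), if mu is the N-th power of nu
    for the free convolution, the moment-cumulant formula gives
    N m_n(nu) = kappa_n(mu) + O(1/N), so the kernel of mu is a limit of positive
    ones.

    In the other direction the measure and its roots are constructed. A Fock
    space is built on stacks of open blocks, with one operator per colour that
    opens, prolongs or closes a block. Its vacuum moments are sums over
    non-crossing partitions, so its free cumulants are the given numbers
    (fock_moment_system); its inner product is positive when the cumulant kernels
    are, again by the Schur product theorem (psd_gram); and operators of distinct
    colours are free (fock_free). A single colour gives a positive sequence of
    moments, which comes from a measure by the solution of the moment problem on
    an interval (moment_problem). Two colours realise the free convolution of two
    measures (boxplus_of_cumulants).

    The Fock space also shows that free cumulants are additive for the free
    convolution (boxplus_cumulant): freeness determines the moments of a sum from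
    the moments of the terms (free_determines_sum), so these can be computed in
    the model.

    The moment problem and the uniqueness of the measure are treated by
    elementary means. A functional that is positive on squares and on squares
    times X and 1 - X is nonnegative on the polynomials that are nonnegative on
    [0, 1] (positive01_ge0); it has a distribution function, defined through
    polynomial majorants of indicator functions of half-lines, which determines
    it (poly_cdf_inj). *)

(** * Sums over non-crossing partitions *)

Section NoncrossingSums.
Import boot.fintype boot.bigop boot.finset.
Local Open Scope set_scope.
Local Open Scope ring_scope.
Variables (K : comNzRingType) (N : nat).
Implicit Types (A C V W : {set 'I_N}) (P Q : {set {set 'I_N}}).

Definition nc_partitions A : {set {set {set 'I_N}}} :=
  [set P | partition P A & noncrossing P].

Definition nc_sum (g : {set 'I_N} -> K) A :=
  \sum_(P in nc_partitions A) \prod_(V in P) g V.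

(** The form in which non-crossing partitions are handled below: pointwise
    conditions, with the chain of inequalities cut in two for easier use. *)
Lemma nc_partitionsP A P : reflect
  [/\ forall V, V \in P -> V \subset A,
      forall V, V \in P -> exists x, x \in V,
      forall x, x \in A -> exists2 V, V \in P & x \in V,
      forall V W x, V \in P -> W \in P -> x \in V -> x \in W -> V = W
    & forall V W a b c d, V \in P -> W \in P -> a \in V -> b \in W ->
        c \in V -> d \in W -> (a < b < c)%N -> (c < d)%N -> V = W]
  (P \in nc_partitions A).
Proof.
rewrite inE; apply: (iffP andP) => [[/and3P[/eqP cA tP P0] /forall_inP nP]|].
  split=> [V VP|V VP|x|V W x VP WP xV xW|V W a b c d VP WP aV bW cV dW].
  - by rewrite -cA; apply: bigcup_sup.
  - by apply/set0Pn; apply: contraNneq P0 => <-.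
  - by rewrite -cA => /bigcupP[V VP xV]; exists V.
  - by rewrite -(def_pblock tP VP xV) -(def_pblock tP WP xW).
  - move=> /andP[ab bc] cd.
    move/forall_inP: (nP V VP) => /(_ W WP) /forall_inP/(_ a aV).
    move=> /forall_inP/(_ b bW)/forall_inP/(_ c cV)/forall_inP/(_ d dW).
    by rewrite ab bc cd /= => /eqP.
move=> [sub ne cov triv nc]; split.
  apply/and3P; split.
  - rewrite eqEsubset; apply/andP; split.
      by apply/bigcupsP => V /sub.
    by apply/subsetP => x /cov[V VP xV]; apply/bigcupP; exists V.
  - apply/trivIsetP => V W VP WP; apply: contraR.
    move=> /pred0Pn[x /andP[/= xV xW]]; apply/eqP.
    exact: (triv _ _ x).
  - by apply/negP => /ne[x]; rewrite inE.
apply/forall_inP => V VP; apply/forall_inP => W WP.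
apply/forall_inP => a aV; apply/forall_inP => b bW.
apply/forall_inP => c cV; apply/forall_inP => d dW.
apply/implyP => /and3P[ab bc cd].
by apply/eqP; apply: (nc V W a b c d); rewrite ?ab.
Qed.

Lemma eq_nc_sum g1 g2 A : (forall V, V \subset A -> g1 V = g2 V) ->
  nc_sum g1 A = nc_sum g2 A.
Proof.
move=> e; apply: eq_bigr => P /nc_partitionsP[sub _ _ _ _].
by apply: eq_bigr => V /sub; exact: e.
Qed.

Definition splits A C P := [forall V in P, (V \subset A) || (V \subset C)].

(** No element of C lies between two elements of A, so that a block inside A
    and a block inside C never cross: the partitions without a block meeting
    both sets are exactly the unions of a partition of A and one of C. *)
Lemma nc_sum_split g A C : [disjoint A & C] ->
  (forall x y z : 'I_N, x \in A -> z \in A -> (x < y < z)%N -> y \notin C) ->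
  \sum_(P in nc_partitions (A :|: C) | splits A C P) \prod_(V in P) g V =
  nc_sum g A * nc_sum g C.
Proof.
move=> dAC conv; rewrite /nc_sum big_distrlr /= pair_big /=.
have nAC x : x \in A -> x \in C -> False.
  by move=> xA xC; move/pred0P: dAC => /(_ x) /=; rewrite xA xC.
pose h (p : {set {set 'I_N}} * {set {set 'I_N}}) := p.1 :|: p.2.
pose h' P := ([set V in P | V \subset A], [set V in P | V \subset C]).
rewrite (reindex_onto h h'); last first.
  move=> P /andP[_ /forall_inP sp]; apply/setP => V; rewrite !inE -andb_orr.
  by case VP: (V \in P) => //=; rewrite sp.
apply: eq_big => [[P Q]|[P Q]].
  rewrite /h /h' /=; apply/idP/idP; last first.
    move=> /andP[/nc_partitionsP[sP nP cP tP ncP] /nc_partitionsP[sQ nQ cQ tQ ncQ]].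
    have dis V W x : V \in P -> W \in Q -> x \in V -> x \in W -> False.
      by move=> /sP/subsetP sV /sQ/subsetP sW /sV xA /sW; apply: nAC.
    apply/andP; split; [apply/andP; split|].
    - apply/nc_partitionsP; split.
      + move=> V; rewrite inE => /orP[/sP VA|/sQ VC].
          by rewrite subsetU ?VA.
        by rewrite subsetU ?VC ?orbT.
      + by move=> V; rewrite inE => /orP[/nP|/nQ].
      + move=> x; rewrite inE => /orP[/cP|/cQ] [V VP xV]; exists V => //.
          by rewrite inE VP.
        by rewrite inE VP orbT.
      + move=> V W x; rewrite !inE => /orP[VP|VQ] /orP[WP|WQ] xV xW.
        * exact: (tP _ _ x).
        * by case: (dis V W x).
        * by case: (dis W V x).
        * exact: (tQ _ _ x).
      + move=> V W a b c d; rewrite !inE => /orP[VP|VQ] /orP[WP|WQ] aV bW cV dW abc cd.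
        * exact: (ncP _ _ a b c d).
        * move/subsetP: (sP _ VP) => sV; move/subsetP: (sQ _ WQ) => sW.
          by move: (conv a b c (sV _ aV) (sV _ cV) abc); rewrite sW.
        * move/subsetP: (sQ _ VQ) => sV; move/subsetP: (sP _ WP) => sW.
          have bcd : (b < c < d)%N by move/andP: abc => [_ ->].
          by move: (conv b c d (sW _ bW) (sW _ dW) bcd); rewrite sV.
        * exact: (ncQ _ _ a b c d).
    - apply/forall_inP => V; rewrite inE => /orP[/sP ->//|/sQ ->].
      by rewrite orbT.
    - apply/eqP; congr pair; apply/setP => V; rewrite !inE.
        case VP: (V \in P) => /=; first by rewrite sP.
        case VQ: (V \in Q) => //=; apply/negP => /subsetP sV.
        have [x xV] := nQ _ VQ; apply: (nAC x); first exact: sV.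
        by move/subsetP: (sQ _ VQ); apply.
      case VQ: (V \in Q) => /=; first by rewrite orbT sQ.
      rewrite orbF; case VP: (V \in P) => //=; apply/negP => /subsetP sV.
      have [x xV] := nP _ VP; apply: (nAC x); last exact: sV.
      by move/subsetP: (sP _ VP); apply.
  move=> /andP[/andP[/nc_partitionsP[s n c t nc] /forall_inP sp] /eqP[eP eQ]].
  have inP V : V \in P -> (V \in P :|: Q) && (V \subset A).
    by rewrite -{1}eP inE.
  have inQ V : V \in Q -> (V \in P :|: Q) && (V \subset C).
    by rewrite -{1}eQ inE.
  apply/andP; split; apply/nc_partitionsP; split.
  - by move=> V /inP /andP[].
  - by move=> V /inP /andP[/n].
  - move=> x xA; have [|V VPQ xV] := c x; first by rewrite inE xA.
    exists V => //; rewrite -eP inE VPQ; case/orP: (sp _ VPQ) => // /subsetP sV.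
    by case: (nAC x xA (sV _ xV)).
  - by move=> V W x /inP/andP[VP _] /inP/andP[WP _]; apply: t.
  - by move=> V W a b e d /inP/andP[VP _] /inP/andP[WP _]; apply: nc.
  - by move=> V /inQ /andP[].
  - by move=> V /inQ /andP[/n].
  - move=> x xC; have [|V VPQ xV] := c x; first by rewrite inE xC orbT.
    exists V => //; rewrite -eQ inE VPQ; case/orP: (sp _ VPQ) => // /subsetP sV.
    by case: (nAC x (sV _ xV) xC).
  - by move=> V W x /inQ/andP[VP _] /inQ/andP[WP _]; apply: t.
  - by move=> V W a b e d /inQ/andP[VP _] /inQ/andP[WP _]; apply: nc.
rewrite /h /h' /= => /andP[/andP[/nc_partitionsP[s n c t nc] _] /eqP[eP eQ]].
rewrite -bigU //=; last first.
  apply/pred0P => V /=; apply/negP => /andP[VP VQ].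
  have : V \in [set V in P :|: Q | V \subset A] by rewrite eP.
  have : V \in [set V in P :|: Q | V \subset C] by rewrite eQ.
  rewrite in_set => /andP[VPQ /subsetP VC].
  rewrite in_set => /andP[_ /subsetP VA]; have [x xV] := n V VPQ.
  exact: (nAC x (VA _ xV) (VC _ xV)).
by apply: eq_bigl => V; rewrite inE.
Qed.

(** When x precedes C and j is the first element of C, removing x from the block
    that it shares with j is a bijection: since no element separates x from j,
    putting x back cannot create a crossing. *)
Lemma nc_sum_remove g (x j : 'I_N) C : j \in C ->
  (forall y, y \in C -> (x < y)%N) -> (forall y, y \in C -> (j <= y)%N) ->
  \sum_(P in nc_partitions (x |: C) | [exists V in P, (x \in V) && (j \in V)])
     \prod_(V in P) g V =
  nc_sum (fun V => g (if j \in V then x |: V else V)) C.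
Proof.
move=> jC xC jmin; rewrite /nc_sum.
have xnC : x \notin C by apply/negP => /xC; rewrite ltnn.
have neqC y : y \in C -> (y == x) = false.
  by move=> /xC xy; apply: gtn_eqF.
pose e V := if j \in V then x |: V else V.
pose h P := [set e V | V in P].
pose h' P := [set V :\ x | V in P].
have eK V : V \subset C -> e V :\ x = V.
  move=> /subsetP VC; have xV : x \notin V by apply: contra xnC; exact: VC.
  rewrite /e; case: ifP => _; first by rewrite setU1K.
  by apply/setP => y; rewrite !inE; case: eqP => // ->; rewrite (negPf xV).
have xe V : V \subset C -> (x \in e V) = (j \in V).
  move=> /subsetP VC; rewrite /e; case: ifP => [_|jV]; first by rewrite !inE eqxx.
  by apply/negP => /VC; apply/negP.
have ye V y : y \in C -> (y \in e V) = (y \in V).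
  rewrite /e; case: ifP => // _ yC; rewrite !inE; case: eqP => // yx.
  by move: xnC; rewrite -yx yC.
have ee V : e (V :\ x) = (if j \in V then x |: V else V :\ x).
  rewrite /e !inE neqC //=; case: ifP => // _.
  by apply/setP => y; rewrite !inE; case: eqP.
rewrite (reindex_onto h h'); last first.
  move=> P /andP[/nc_partitionsP[s n c t nc] /exists_inP[V VP /andP[xV jV]]].
  rewrite /h /h' -imset_comp; rewrite -[RHS]imset_id.
  apply: eq_in_imset => W WP /=; rewrite ee; case: ifP => jW.
    rewrite -(t _ _ j VP WP jV jW).
    by apply/setP => y; rewrite !inE; case: eqP => // ->.
  apply/setP => y; rewrite !inE; case: eqP => //= ->.
  by apply/esym/negP => xW; move: jW; rewrite -(t _ _ x VP WP xV xW) jV.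
apply: eq_big => [P|P].
  apply/idP/idP.
  - move=> /andP[/andP[/nc_partitionsP[s n c t nc]]].
    move=> /exists_inP[V VP /andP[xV jV]] /eqP h'P.
    have inP W : W \in P -> exists2 U, U \in h P & W = U :\ x.
      by rewrite -{1}h'P => /imsetP.
    have nUx U : U \in h P -> exists2 y, y \in U & y != x.
      move=> UP; have [y yU] := n _ UP; case: (eqVneq y x) => [yx|]; last by exists y.
      exists j; last by rewrite neqC.
      by rewrite (t U V x UP VP) // -yx.
    apply/nc_partitionsP; split.
    + move=> W /inP[U UP ->]; apply/subsetP => y; rewrite !inE => /andP[yx yU].
      by move/subsetP: (s _ UP) => /(_ _ yU); rewrite !inE (negPf yx).
    + move=> W /inP[U UP ->]; have [y yU yx] := nUx _ UP.
      by exists y; rewrite !inE yx.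
    + move=> y yC; have [|U UP yU] := c y; first by rewrite !inE yC orbT.
      exists (U :\ x); first by rewrite -h'P; apply: imset_f.
      by rewrite !inE yU andbT neqC.
    + move=> W1 W2 y /inP[U1 U1P ->] /inP[U2 U2P ->].
      rewrite !inE => /andP[_ y1] /andP[_ y2].
      by rewrite (t U1 U2 y).
    + move=> W1 W2 a b u d /inP[U1 U1P ->] /inP[U2 U2P ->].
      rewrite !inE => /andP[_ a1] /andP[_ b1] /andP[_ u1] /andP[_ d1] o1 o2.
      by rewrite (nc U1 U2 a b u d).
  - move=> /nc_partitionsP[s n c t nc].
    have [V0 V0P jV0] := c _ jC.
    have inh W : W \in h P -> exists2 U, U \in P & W = e U by move=> /imsetP.
    have yhC W y : W \in h P -> y \in W -> y != x -> y \in C.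
      move=> /inh[U UP ->]; rewrite /e; case: ifP => _; last first.
        by move=> yU _; apply: (subsetP (s _ UP)).
      rewrite !inE => /orP[->//|yU _]; exact: (subsetP (s _ UP)).
    rewrite -andbA; apply/and3P; split.
    + apply/nc_partitionsP; split.
      * move=> W WP; apply/subsetP => y yW; rewrite !inE.
        by case: (eqVneq y x) => //= yx; apply: (yhC W).
      * move=> W /inh[U UP ->]; have [y yU] := n _ UP; exists y.
        by rewrite ye //; apply: (subsetP (s _ UP)).
      * move=> y; rewrite !inE => /orP[/eqP->|yC].
          by exists (e V0); [apply: imset_f|rewrite xe // s].
        have [V VP yV] := c _ yC.
        by exists (e V); [apply: imset_f|rewrite ye].
      * move=> W1 W2 y /inh[U1 U1P ->] /inh[U2 U2P ->].
        case: (eqVneq y x) => [->|yx].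
          by rewrite !xe ?s // => j1 j2; rewrite (t U1 U2 j).
        move=> y1; have yC: y \in C by apply: (yhC (e U1)) => //; apply: imset_f.
        by move: y1; rewrite !ye // => y1 y2; rewrite (t U1 U2 y).
      * move=> W1 W2 a b u d W1P W2P a1 b1 u1 d1 /andP[ab bu] ud.
        have xle y W : W \in h P -> y \in W -> (x <= y)%N.
          move=> WP yW; case: (eqVneq y x) => [->//|yx].
          by rewrite ltnW // xC //; apply: (yhC W).
        have nx (y z : 'I_N) W : W \in h P -> z \in W -> (z < y)%N -> y != x.
          move=> WP zW zy; rewrite neq_ltn; apply/orP; right.
          by apply: leq_ltn_trans zy; apply: (xle _ W).
        have bC : b \in C by apply: (yhC W2) => //; apply: (nx _ a W1).
        have uC : u \in C by apply: (yhC W1) => //; apply: (nx _ b W2).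
        have dC : d \in C by apply: (yhC W2) => //; apply: (nx _ u W1).
        move: W1P W2P a1 b1 u1 d1 => /inh[U1 U1P ->] /inh[U2 U2P ->].
        rewrite !(ye _ b) // !(ye _ u) // !(ye _ d) // => a1 b1 u1 d1; congr e.
        case: (eqVneq a x) => [ax|ax]; last first.
          have aC : a \in C by apply: (yhC _ _ _ a1 ax); apply: imset_f.
          move: a1; rewrite ye // => a1.
          by apply: (nc U1 U2 a b u d); rewrite ?ab ?bu.
        move: a1; rewrite ax xe ?s // => jU1.
        case: (eqVneq b j) => [bj|bj]; first by apply: (t U1 U2 b) => //; rewrite bj.
        apply: (nc U1 U2 j b u d) => //; rewrite bu andbT ltn_neqAle jmin // andbT.
        by rewrite eq_sym.
    + apply/exists_inP; exists (e V0); first exact: imset_f.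
      by rewrite xe ?s // ye // jV0.
    + apply/eqP; rewrite /h' /h -imset_comp -[RHS]imset_id.
      by apply: eq_in_imset => U UP /=; rewrite eK // s.
move=> /andP[_ /eqP h'P].
rewrite /h big_imset //= => U W UP WP /(congr1 (fun V => V :\ x)).
have inP U' : U' \in P -> x \notin U'.
  rewrite -h'P => /imsetP[U2 _ ->]; by rewrite !inE eqxx.
have eK' U' : U' \in P -> e U' :\ x = U'.
  move=> /inP xU'; rewrite /e; case: ifP => _; first by rewrite setU1K.
  by apply/setP => y; rewrite !inE; case: eqP => // ->; rewrite (negPf xU').
by rewrite !eK'.
Qed.

Definition itv a b : {set 'I_N} := [set y : 'I_N | (a <= y < b)%N].

Variable k : nat -> K.

Definition block_weight V := k #|V|.

(** The block of x is weighted as if it had s - 1 further elements lying before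
    the set that is being partitioned. This is what remains of a longer block
    whose first s - 1 elements have been removed, the s-th one being x. *)
Definition open_weight (x : 'I_N) s V :=
  if x \in V then k (#|V|.-1 + s) else k #|V|.

(** The successor of x in its block, for x the first element of the partitioned
    set; it is the pivot of the recursion nc_sum_first. *)
Definition next_in_block (x : 'I_N) P (j : 'I_N) :=
  [exists V in P, [&& x \in V, j \in V, (x < j)%N &
     [forall y in V, (x < y)%N ==> (j <= y)%N]]].

Lemma nc_sum1 g (x : 'I_N) : nc_sum g [set x] = g [set x].
Proof.
rewrite /nc_sum (big_pred1 [set [set x]]) ?big_set1 // => P /=.
apply/idP/eqP => [/nc_partitionsP[s n c t _]|->].
  apply/setP => V; rewrite inE; apply/idP/eqP => [VP|->].
    apply/eqP; rewrite eqEsubset s //= sub1set; have [y yV] := n _ VP.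
    by move/subsetP: (s _ VP) => /(_ _ yV); rewrite inE => /eqP <-.
  have [|W WP xW] := c x; first by rewrite inE.
  suff -> : [set x] = W by [].
  by apply/esym/eqP; rewrite eqEsubset s // sub1set xW.
apply/nc_partitionsP; split=> [V|V|y|V W y|V W a b c d].
- by rewrite inE => /eqP ->.
- by rewrite inE => /eqP ->; exists x; rewrite inE.
- by move=> yx; exists [set x]; rewrite ?set11.
- by rewrite !inE => /eqP -> /eqP ->.
- by rewrite !inE => /eqP -> /eqP ->.
Qed.

Lemma next_in_block_total (x : 'I_N) b P : (x < b)%N ->
  P \in nc_partitions (itv x b) ->
  [set x] \in P \/ exists j, next_in_block x P j.
Proof.
move=> xb /nc_partitionsP[s n c t nc].
have [|V VP xV] := c x; first by rewrite inE leqnn xb.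
case: (pickP [pred y in V | y != x]) => [y /andP[/= yV yx]|none]; last first.
  left; suff -> : [set x] = V by [].
  apply/setP => y; rewrite inE; move: (none y) => /=.
  by case: (eqVneq y x) => [->|_]; [rewrite xV|case: (y \in V)].
have gtx z : z \in V -> z != x -> (x < z)%N.
  move=> zV zx; move/subsetP: (s _ VP) => /(_ _ zV).
  rewrite inE => /andP[xz _]; rewrite ltn_neqAle xz andbT.
  by apply: contraNneq zx => /val_inj ->.
right; case: (@arg_minnP _ y [pred z in V | (x < z)%N] (@nat_of_ord N)).
  by rewrite /= yV gtx.
move=> j /= /andP[jV xj] jmin; exists j; apply/exists_inP; exists V => //.
rewrite xV jV xj; apply/forall_inP => z zV; apply/implyP => xz.
by apply: jmin; rewrite zV.
Qed.

Lemma next_in_block_inj (x : 'I_N) b P i j : P \in nc_partitions (itv x b) ->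
  next_in_block x P i -> next_in_block x P j -> i = j.
Proof.
move=> /nc_partitionsP[_ _ _ t _].
move=> /exists_inP[V VP /and4P[xV iV xi /forall_inP imin]].
move=> /exists_inP[W WP /and4P[xW jW xj /forall_inP jmin]].
have e := t V W x VP WP xV xW; move: iV imin; rewrite e => iV imin.
apply/val_inj/eqP; rewrite /= eqn_leq.
by rewrite (implyP (imin _ jW) xj) (implyP (jmin _ iV) xi).
Qed.

(** A block meeting both ]x, j[ and its complement would cross the block of x,
    in which x and j are consecutive. *)
Lemma next_in_block_splits (x j : 'I_N) b P : (x < j < b)%N ->
  (P \in nc_partitions (itv x b)) && next_in_block x P j =
  [&& P \in nc_partitions (itv x.+1 j :|: (x |: itv j b)),
     splits (itv x.+1 j) (x |: itv j b) P
     & [exists V in P, (x \in V) && (j \in V)]].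
Proof.
move=> /andP[xj jb].
have -> : itv x.+1 j :|: (x |: itv j b) = itv x b.
  apply/setP => y; rewrite !inE -val_eqE /=; lia.
case Pnc: (P \in _) => //=.
move/nc_partitionsP: Pnc => [s n c t nc].
apply/idP/andP => [/exists_inP[V VP /and4P[xV jV _ /forall_inP jmin]]|].
  split; last by apply/exists_inP; exists V; rewrite ?xV ?jV.
  apply/forall_inP => W WP.
  case: (eqVneq W V) => [->|WV].
    apply/orP; right; apply/subsetP => y yV; rewrite !inE.
    have := subsetP (s _ VP) _ yV; have := implyP (jmin _ yV).
    by rewrite inE -val_eqE /=; lia.
  have xyW y : y \in W -> (x < y)%N.
    move=> yW; have := subsetP (s _ WP) _ yW; rewrite inE => /andP[xy _].
    rewrite ltn_neqAle xy andbT; apply: contraNneq WV => /val_inj exy.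
    by apply/eqP; apply: (t _ _ x); rewrite // exy.
  case: (pickP [pred y in W | (y < j)%N]) => [y /andP[/= yW yj]|none].
    apply/orP; left; apply/subsetP => z zW; rewrite inE xyW //= ltnNge.
    apply: contra WV; rewrite leq_eqVlt => /orP[/eqP/val_inj jz|jz].
      by apply/eqP; apply: (t _ _ j); rewrite // jz.
    by rewrite eq_sym; apply/eqP/(nc V W x y j z); rewrite ?xyW ?yj.
  apply/orP; right; apply/subsetP => z zW; rewrite !inE.
  have := none z; have := subsetP (s _ WP) _ zW; rewrite /= zW inE /=; lia.
move=> [/forall_inP sp /exists_inP[V VP /andP[xV jV]]].
apply/exists_inP; exists V => //; rewrite xV jV xj.
apply/forall_inP => y yV; apply/implyP => xy.
case/orP: (sp _ VP) => /subsetP sV.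
  by have := sV _ xV; rewrite inE ltnn.
by have := sV _ yV; rewrite !inE -val_eqE /=; lia.
Qed.

Lemma singleton_splits (x : 'I_N) b P : (x < b)%N ->
  (P \in nc_partitions (itv x b)) && ([set x] \in P) =
  (P \in nc_partitions ([set x] :|: itv x.+1 b))
    && splits [set x] (itv x.+1 b) P.
Proof.
move=> xb; have -> : [set x] :|: itv x.+1 b = itv x b.
  by apply/setP => y; rewrite !inE -val_eqE /=; lia.
case Pnc: (P \in _) => //=.
move/nc_partitionsP: Pnc => [s n c t nc].
apply/idP/forall_inP => [xP W WP|sp].
  case: (eqVneq W [set x]) => [->|Wx]; first by rewrite subxx.
  apply/orP; right; apply/subsetP => y yW.
  have := subsetP (s _ WP) _ yW; rewrite !inE => /andP[xy ->]; rewrite andbT.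
  rewrite ltn_neqAle xy andbT; apply: contraNneq Wx => /val_inj exy.
  by apply/eqP; apply: (t _ _ x); rewrite ?inE // exy.
have [|V VP xV] := c x; first by rewrite inE leqnn xb.
suff -> : [set x] = V by [].
case/orP: (sp _ VP) => [sV|/subsetP/(_ _ xV)]; last by rewrite inE ltnn.
by apply/eqP; rewrite eqEsubset sV sub1set xV.
Qed.

Lemma singleton_no_next (x j : 'I_N) b P : P \in nc_partitions (itv x b) ->
  [set x] \in P -> next_in_block x P j -> False.
Proof.
move=> /nc_partitionsP[s n c t nc] xP /exists_inP[V VP /and4P[xV jV xj _]].
move: jV; rewrite (t V [set x] x) ?inE // => /eqP jx.
by rewrite jx ltnn in xj.
Qed.

(** Either x is alone in its block, or the successor j of x in that block cuts the
    partition into an arbitrary partition of ]x, j[ and one of [j, b[ whose first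
    block has one more hidden element. *)
Lemma nc_sum_first (x : 'I_N) s b : (x < b)%N ->
  nc_sum (open_weight x s) (itv x b) =
  k s * nc_sum block_weight (itv x.+1 b) +
  \sum_(j : 'I_N | (x < j < b)%N)
     nc_sum block_weight (itv x.+1 j) * nc_sum (open_weight j s.+1) (itv j b).
Proof.
move=> xb.
(* The default x encodes that x is alone in its block. *)
pose nx P := odflt x [pick j | next_in_block x P j].
have nxx P : P \in nc_partitions (itv x b) -> (nx P == x) = ([set x] \in P).
  move=> Pnc; rewrite /nx; case: pickP => [j nj|none] /=.
    rewrite (introF idP (fun xP => singleton_no_next Pnc xP nj)).
    by case/exists_inP: nj => V VP /and4P[_ _ xj _]; apply: gtn_eqF.
  rewrite eqxx; case: (next_in_block_total xb Pnc) => [->//|[j]].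
  by rewrite none.
have nxj P j : P \in nc_partitions (itv x b) -> j != x ->
    (nx P == j) = next_in_block x P j.
  move=> Pnc jx; rewrite /nx; case: pickP => [i ni|->] /=; last first.
    by rewrite eq_sym (negPf jx).
  apply/eqP/idP => [<-//|]; exact: (next_in_block_inj Pnc).
rewrite /nc_sum (partition_big nx predT) //= (bigD1 x) //=; congr (_ + _).
  rewrite (eq_bigl (fun P => (P \in nc_partitions ([set x] :|: itv x.+1 b))
      && splits [set x] (itv x.+1 b) P)); last first.
    move=> P; rewrite -singleton_splits //.
    by case Pnc: (P \in _) => //=; rewrite nxx.
  rewrite nc_sum_split; first last.
  - move=> y1 y2 y3; rewrite !inE => /eqP -> /eqP -> /andP[h1 h2].
    by have := ltn_trans h1 h2; rewrite ltnn.
  - by rewrite disjoints1 inE ltnn.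
  rewrite nc_sum1 /open_weight inE eqxx cards1; congr (_ * _).
  apply: eq_nc_sum => V /subsetP sV; case: ifP => // /sV.
  by rewrite inE ltnn.
rewrite (bigID (fun j : 'I_N => (x < j < b)%N)) /= [X in _ + X]big1 ?addr0.
  apply: eq_big => j.
    by case: (eqVneq j x) => [->|]; rewrite ?ltnn.
  move=> /andP[jx xjb]; have /andP[xj jb] := xjb.
  (* The constraint that x and j are in the same block, as a weight. *)
  pose g V := if (x \in V) && (j \notin V) then 0 else open_weight x s V.
  transitivity (nc_sum g (itv x.+1 j) * nc_sum g (x |: itv j b)).
    rewrite -nc_sum_split; first last.
    - by move=> y1 y2 y3; rewrite !inE -val_eqE /=; lia.
    - apply/pred0P => y; rewrite /= !inE -val_eqE /=; lia.
    rewrite [RHS](bigID (fun P => [exists V in P, (x \in V) && (j \in V)])) /=.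
    rewrite [X in _ + X]big1 ?addr0; last first.
      move=> P /andP[/andP[/nc_partitionsP[_ _ c _ _] _]].
      move=> /existsPn nE; have [|V VP xV] := c x; first by rewrite !inE eqxx orbT.
      rewrite (bigD1 V) //= /g xV; move: (nE V); rewrite VP xV /= => ->.
      by rewrite mul0r.
    rewrite (eq_bigl (fun P => (P \in nc_partitions (itv x b)) &&
              next_in_block x P j)); last first.
      by move=> P; case Pnc: (P \in _) => //=; rewrite nxj.
    apply: eq_big => P; first by rewrite -andbA next_in_block_splits.
    move=> /andP[/nc_partitionsP[_ _ _ t _]].
    move=> /exists_inP[V VP /and4P[xV jV _ _]].
    apply: eq_bigr => W WP; rewrite /g; case xW: (x \in W) => //=.
    by rewrite (t W V x) // jV.
  congr (_ * _).
    apply: eq_nc_sum => V /subsetP sV.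
    rewrite /g /open_weight /block_weight; case xV: (x \in V) => //=.
    by have := sV _ xV; rewrite inE ltnn.
  transitivity (\sum_(P in nc_partitions (x |: itv j b) |
      [exists V in P, (x \in V) && (j \in V)]) \prod_(V in P) open_weight x s V).
    rewrite /nc_sum [LHS](bigID (fun P => [exists V in P, (x \in V) && (j \in V)])) /=.
    rewrite [X in _ + X]big1 ?addr0; last first.
      move=> P /andP[/nc_partitionsP[_ _ c _ _]].
      move=> /existsPn nE; have [|V VP xV] := c x; first by rewrite !inE eqxx.
      rewrite (bigD1 V) //= /g xV; move: (nE V); rewrite VP xV /= => ->.
      by rewrite mul0r.
    apply: eq_bigr => P /andP[/nc_partitionsP[_ _ _ t _]].
    move=> /exists_inP[V VP /andP[xV jV]].
    apply: eq_bigr => W WP; rewrite /g; case xW: (x \in W) => //=.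
    by rewrite (t W V x) // jV.
  rewrite nc_sum_remove; first last.
  - by move=> y; rewrite inE => /andP[].
  - by move=> y; rewrite inE; lia.
  - by rewrite inE leqnn.
  apply: eq_nc_sum => V /subsetP sV; rewrite /open_weight.
  have xV : x \notin V by apply/negP => /sV; rewrite inE; lia.
  case jV: (j \in V); last by rewrite (negPf xV).
  rewrite !inE eqxx cardsU1 xV; congr k.
  have : (0 < #|V|)%N by rewrite card_gt0; apply/set0Pn; exists j.
  by move: #|V| => [//|m] _ /=; lia.
move=> j /andP[jx njb]; apply: big1 => P /andP[Pnc]; rewrite nxj //.
move=> /exists_inP[V VP /and4P[_ jV xj _]]; case/negP: njb; rewrite xj /=.
by move/nc_partitionsP: Pnc => [s' _ _ _ _]; have := subsetP (s' _ VP) _ jV;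
  rewrite inE => /andP[].
Qed.

End NoncrossingSums.

(** * The moment-cumulant recursion *)

Section MomentSystem.
Variable K : comNzRingType.
Implicit Types (m k : nat -> K) (T : nat -> nat -> K).

(** The recursion nc_sum_first for intervals, whose sums depend on lengths only:
    m n is the sum over the non-crossing partitions of n points, and T n s the sum
    over those of n + 1 points in which the first block counts s - 1 additional
    elements. Both the combinatorial sums and the Fock space moments satisfy it,
    and it determines m from k and k from m, so it serves as the common ground on
    which they are compared. *)
Definition moment_system m k T :=
  [/\ m 0%N = 1, forall n, m n.+1 = T n 1%N &
      forall n s, (0 < s)%N ->
        T n s = k s * m n + \sum_(i < n) m i * T (n - i.+1)%N s.+1].

Lemma moment_system_determines_moments m m' k k' T T' :
  (forall s, (0 < s)%N -> k s = k' s) ->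
  moment_system m k T -> moment_system m' k' T' -> m =1 m'.
Proof.
move=> kk' [m0 mS TE] [m'0 m'S TE'].
suff H n : m n = m' n /\ forall s, (0 < s)%N -> T n s = T' n s.
  by move=> n; case: (H n).
elim/ltn_ind: n => n IH.
have mn : m n = m' n.
  case: n IH => [|n] IH; first by rewrite m0 m'0.
  by rewrite mS m'S; case: (IH n) => // _ ->.
split=> // s s0; rewrite TE // TE' // mn kk' //; congr (_ + _).
apply: eq_bigr => i _; have [-> _] := IH i (ltn_ord i).
by have [|_ ->] := IH (n - i.+1)%N; first by have := ltn_ord i; lia.
Qed.

(** The recursion solved for the term i = 0 of its sum: it computes T at s + 1
    from T at s, that is, cumulants from moments. *)
Lemma moment_system_peel m k T n s : moment_system m k T -> (0 < s)%N ->
  T n s.+1 = T n.+1 s - T 0%N s * m n.+1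
             - \sum_(i < n) m i.+1 * T (n - i.+1)%N s.+1.
Proof.
move=> [m0 mS TE] s0; have -> : T 0%N s = k s.
  by rewrite TE // big_ord0 addr0 m0 mulr1.
rewrite (TE n.+1) // big_ord_recl m0 mul1r subn1 /=.
rewrite (eq_bigr (fun i : 'I_n => m i.+1 * T (n - i.+1)%N s.+1)) => [|i _].
  by ring.
by rewrite /= subSS.
Qed.

Lemma moment_system_determines_cumulants m m' k k' T T' : m =1 m' ->
  moment_system m k T -> moment_system m' k' T' ->
  forall s, (0 < s)%N -> k s = k' s.
Proof.
move=> mm' S S'.
have H s : (0 < s)%N -> forall n, T n s = T' n s.
  elim: s => // -[|s] IH _ n.
    by case: S S' => _ <- _ [_ <- _].
  elim/ltn_ind: n => n IHn.
  rewrite (moment_system_peel _ S) // (moment_system_peel _ S') // !IH // mm'.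
  congr (_ - _ - _); apply: eq_bigr => i _; rewrite mm' IHn //.
  by have := ltn_ord i; lia.
move=> s s0; have k0 : T 0%N s = k s.
  by case: S => m0 _ TE; rewrite TE // big_ord0 addr0 m0 mulr1.
have k0' : T' 0%N s = k' s.
  by case: S' => m0 _ TE; rewrite TE // big_ord0 addr0 m0 mulr1.
by rewrite -k0 -k0' H.
Qed.

End MomentSystem.

Section NoncrossingRecursion.
Variables (K : comNzRingType) (m k : nat -> K) (T : nat -> nat -> K).
Hypothesis S : moment_system m k T.

Lemma nc_sum_itv N n a b : (b - a <= n)%N -> (a <= b <= N)%N ->
  nc_sum (block_weight k) (itv N a b) = m (b - a)%N /\
  (forall (x : 'I_N) s, val x = a -> (a < b)%N -> (0 < s)%N ->
     nc_sum (open_weight k x s) (itv N a b) = T (b - a.+1)%N s).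
Proof.
case: S => m0 mS TE.
elim: n a b => [|n IH] a b ban abN.
  have <- : a = b by lia.
  split; last by move=> x s _; rewrite ltnn.
  have -> : itv N a a = finset.set0.
    by apply/finset.setP => y; rewrite !finset.inE; lia.
  rewrite subnn m0 /nc_sum (big_pred1 finset.set0) ?big_set0 // => P /=.
  apply/idP/eqP => [/nc_partitionsP[s ne _ _ _]|->].
    apply/finset.setP => V; rewrite finset.in_set0; apply/negP => VP.
    have [y yV] := ne _ VP; have /fintype.subsetP/(_ _ yV) := s _ VP.
    by rewrite finset.in_set0.
  by apply/nc_partitionsP; split=> [V|V|V|V W y|V W u v w z];
    rewrite finset.in_set0.
have open (x : 'I_N) s : val x = a -> (a < b)%N -> (0 < s)%N ->
     nc_sum (open_weight k x s) (itv N a b) = T (b - a.+1)%N s.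
  move=> /= xa ab s0; subst a; rewrite nc_sum_first //= TE //; congr (_ * _ + _).
    by apply: (proj1 (IH _ _ _ _)); lia.
  transitivity (\sum_(j < N | (x < j < b)%N) m (j - x.+1)%N * T (b - j.+1)%N s.+1).
    apply: eq_bigr => j /andP[xj jb]; congr (_ * _).
      by apply: (proj1 (IH _ _ _ _)); lia.
    by apply: (proj2 (IH _ _ _ _)) => //; lia.
  rewrite -(big_mkord (fun j => x < j < b)%N
     (fun j => m (j - x.+1)%N * T (b - j.+1)%N s.+1)).
  rewrite (big_cat_nat _ (n := x.+1)) //=.
  rewrite big_nat_cond big1 ?add0r; last by move=> i; lia.
  rewrite (big_cat_nat _ (n := b)) //=; last by lia.
  rewrite [X in _ + X]big_nat_cond [X in _ + X]big1 ?addr0; last by move=> i; lia.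
  rewrite big_nat_cond (eq_bigl (fun i => (x < i < b)%N && true)); last by move=> i; lia.
  rewrite -big_nat_cond -{1}[x.+1]add0n big_addn big_mkord.
  by apply: eq_bigr => i _; congr (m _ * T _ _); lia.
split => //; have [ab|ab] := ltnP a b; last first.
  by apply: (proj1 (IH _ _ _ _)); lia.
have aN : (a < N)%N by lia.
transitivity (nc_sum (open_weight k (Ordinal aN) 1) (itv N a b)).
  apply: eq_bigr => P /nc_partitionsP[_ ne _ _ _].
  apply: eq_bigr => V /ne[x xV]; rewrite /block_weight /open_weight.
  case: ifP => // _; congr k.
  have : (0 < #|V|)%N by rewrite card_gt0; apply/set0Pn; exists x.
  by lia.
by rewrite open // -mS; congr m; lia.
Qed.

Lemma nc_sum_moment n : \sum_(P in NC n) \prod_(V in P) k #|V| = m n.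
Proof.
have [+ _] := @nc_sum_itv n n 0 n (leq_subr _ _) (leqnn _).
rewrite subn0 => <-; rewrite /nc_sum; apply: eq_bigl => P; rewrite !finset.inE.
congr (finset.partition _ _ && _); apply/finset.setP => y.
by rewrite !finset.inE /= ltn_ord.
Qed.

End NoncrossingRecursion.

(** * A Fock space model *)

(** A basis vector of the Fock space records the blocks that are open while the
    points of a non-crossing partition are read one after the other, innermost
    first: (b, i) is an open block of colour b to which i points have been added
    since it was opened. *)
Notation stack := (seq (bool * nat)).

Section FockModel.
Variables (K : comNzRingType) (k : bool -> nat -> K).
Implicit Types (b c : bool) (g : stack -> K) (st u v w : stack).

Definition vac st : K := (st == [::])%:R.

(** The current point either is added to the innermost open block, or closes it;
    the closed block has i + 2 points, its first and last ones included. *)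
Definition pop b g st :=
  if st is (c, i) :: t then
    if c == b then g ((c, i.+1) :: t) + k b i.+2 * g t else 0
  else 0.

(** Linear functionals on the Fock space are represented by their values on
    stacks, and act b is the transpose g |-> g o X_b of the operator X_b that reads
    a point of colour b: the point opens a block, is a block by itself, or
    continues the innermost block. *)
Definition act b g st := g ((b, 0%N) :: st) + k b 1%N * g st + pop b g st.

Lemma eq_pop b g g' : g =1 g' -> pop b g =1 pop b g'.
Proof. by move=> e [|[c i] t] //=; rewrite !e. Qed.

Lemma eq_act b g g' : g =1 g' -> act b g =1 act b g'.
Proof. by move=> e st; rewrite /act !e (eq_pop _ e). Qed.

Lemma pop_sum b (I : Type) (r : seq I) (P : pred I) (f : I -> K)
    (g : I -> stack -> K) st :
  pop b (fun st => \sum_(i <- r | P i) f i * g i st) st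
  = \sum_(i <- r | P i) f i * pop b (g i) st.
Proof.
case: st => [|[c i] t] /=; first by rewrite big1 // => ? _; rewrite mulr0.
case: ifP => _; last by rewrite big1 // => ? _; rewrite mulr0.
rewrite mulr_sumr -big_split /=; apply: eq_bigr => j _; ring.
Qed.

Lemma act_sum b (I : Type) (r : seq I) (P : pred I) (f : I -> K)
    (g : I -> stack -> K) st :
  act b (fun st => \sum_(i <- r | P i) f i * g i st) st
  = \sum_(i <- r | P i) f i * act b (g i) st.
Proof.
rewrite /act pop_sum mulr_sumr -!big_split /=; apply: eq_bigr => j _; ring.
Qed.

Section Operators.
Variable B : pred bool.

Definition pops g st := \sum_(b | B b) pop b g st.
Definition acts g st := \sum_(b | B b) act b g st.

Lemma eq_acts g g' : g =1 g' -> acts g =1 acts g'.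
Proof. by move=> e st; apply: eq_bigr => b _; apply: eq_act. Qed.

Lemma eq_iter_acts n g g' : g =1 g' -> iter n acts g =1 iter n acts g'.
Proof. by move=> e; elim: n => //= n IH; apply: eq_acts. Qed.

Lemma acts_sum (I : Type) (r : seq I) (P : pred I) (f : I -> K)
    (g : I -> stack -> K) st :
  acts (fun st => \sum_(i <- r | P i) f i * g i st) st
  = \sum_(i <- r | P i) f i * acts (g i) st.
Proof.
rewrite /acts; under eq_bigr do rewrite act_sum.
by rewrite exchange_big; apply: eq_bigr => i _; rewrite mulr_sumr.
Qed.

Lemma actsD g g' st : acts (fun v => g v + g' v) st = acts g st + acts g' st.
Proof.
rewrite /acts -big_split /=; apply: eq_bigr => b _; rewrite /act /pop.
by case: st => [|[c i] t]; [|case: ifP => _]; ring.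
Qed.

Lemma acts_cat g v w :
  acts g (v ++ w) = acts (fun v => g (v ++ w)) v + vac v * pops g w.
Proof.
rewrite /acts /pops mulr_sumr -big_split /=; apply: eq_bigr => b _.
by case: v => [|[c i] v]; rewrite /vac /act /= ?mul1r ?mul0r ?addr0.
Qed.

(** First passage decomposition of n steps started at v ++ w: either w is never
    touched, or v is used up after i steps and step i + 1 touches w. *)
Lemma iter_acts_cat n g v w : iter n acts g (v ++ w) =
  iter n acts (fun v => g (v ++ w)) v
  + \sum_(i < n) pops (iter (n - i.+1) acts g) w * iter i acts vac v.
Proof.
elim: n v => [|n IH] v; first by rewrite big_ord0 addr0.
rewrite iterS acts_cat (eq_acts IH) actsD acts_sum -addrA; congr (_ + _).
rewrite big_ord_recl /= subSS subn0 addrC mulrC.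
by congr (_ + _).
Qed.

(** The vacuum moments of the sum of the X_b for b in B. *)
Definition fock_moment n := iter n acts vac [::].
Definition fock_cumulant s := \sum_(b | B b) k b s.
Definition fock_tail n s := fock_cumulant s * fock_moment n
  + \sum_(b | B b) iter n acts vac [:: (b, s.-1)].

(** Decomposing n steps started at a single open block at the time i when the
    block is next touched gives the recursion. In particular the cumulants of a
    sum of X_b of distinct colours are the sums of the cumulants: a block only
    has points of one colour. *)
Lemma fock_moment_system : moment_system fock_moment fock_cumulant fock_tail.
Proof.
split=> [||n [//|s] _]; first by rewrite /fock_moment /= /vac eqxx.
  move=> n; rewrite /fock_moment /fock_tail iterS /fock_cumulant mulr_suml.
  rewrite -big_split /=; apply: eq_bigr => b _.
  by rewrite /act /= addr0 addrC.
rewrite {1}/fock_tail /=; congr (_ + _).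
transitivity (\sum_(b | B b) \sum_(i < n) fock_moment i *
    pops (iter (n - i.+1) acts vac) [:: (b, s)]).
  apply: eq_bigr => b _; rewrite -[[:: _]]cat0s iter_acts_cat.
  have e0 : (fun v => vac (v ++ [:: (b, s)])) =1 (fun=> 0).
    by move=> [|x v].
  rewrite (eq_iter_acts _ e0) (_ : iter n acts (fun=> 0) [::] = 0) ?add0r.
    by apply: eq_bigr => i _; rewrite mulrC.
  have e st : iter n acts (fun=> 0) st = 0.
    elim: n st => //= n IH st; rewrite (eq_acts IH) /acts big1 // => c _.
    by rewrite /act /pop; case: st => [|[d i] t] /=; rewrite !(mulr0, addr0) ?if_same ?addr0.
  exact: e.
rewrite exchange_big /=; apply: eq_bigr => i _; rewrite -mulr_sumr.
congr (_ * _); rewrite /fock_tail /fock_cumulant mulr_suml -big_split /=.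
apply: eq_bigr => b Bb; rewrite /pops (bigD1 b) //= eqxx big1 ?addr0.
  by rewrite addrC.
by move=> c /andP[_ cb]; rewrite eq_sym (negPf cb).
Qed.

End Operators.

(** The inner product of two stacks, for which the X_b are symmetric. *)
Fixpoint gram u v : K :=
  match u, v with
  | [::], [::] => 1
  | (b, i) :: u', (c, j) :: v' => if b == c then k b (i + j + 2)%N * gram u' v' else 0
  | _, _ => 0
  end.

Lemma gramC u v : gram u v = gram v u.
Proof.
elim: u v => [|[b i] u IH] [|[c j] v] //=; rewrite eq_sym IH.
by case: eqP => // ->; rewrite (addnC i).
Qed.

Lemma act_gram b u v : act b (gram u) v = act b (gram^~ v) u.
Proof.
rewrite /act; case: u v => [|[c i] u] [|[d j] v] //=.
- by rewrite (eq_sym d); case: eqP => [->|_]; rewrite ?add0n ?addn2; ring.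
- by rewrite (eq_sym c); case: eqP => [->|_]; rewrite ?addn0 ?addn2; ring.
- rewrite ?add0n ?addn0 !addn2 (eq_sym b d).
  case: (eqVneq c b) => [->|cb]; case: (eqVneq d b) => [->|db].
  + by rewrite ?eqxx addSn addnS; ring.
  + by rewrite ?(eq_sym b d) ?(negPf db); ring.
  + by rewrite ?(negPf cb); ring.
  + by case: eqP => _; ring.
Qed.

(** The functional g o X_b1 o ... o X_bn, for the word x = b1 ... bn. *)
Definition words_act g (x : seq bool) := foldl (fun g b => act b g) g x.

Lemma eq_words_act x g g' : g =1 g' -> words_act g x =1 words_act g' x.
Proof. by elim: x g g' => //= b x IH g g' e; apply/IH/eq_act. Qed.

(** The operator X_b itself, on formal combinations of stacks. *)
Definition act_vec b (p : K * stack) : seq (K * stack) :=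
  (p.1, (b, 0%N) :: p.2) :: (p.1 * k b 1%N, p.2) ::
  if p.2 is (c, i) :: t then
    if c == b then [:: (p.1, (c, i.+1) :: t); (p.1 * k b i.+2, t)] else [::]
  else [::].

Fixpoint vec (x : seq bool) : seq (K * stack) :=
  if x is b :: y then flatten [seq act_vec b p | p <- vec y] else [:: (1, [::])].

Definition pairing (s : seq (K * stack)) g := \sum_(p <- s) p.1 * g p.2.

Lemma pairing_act_vec b p g : pairing (act_vec b p) g = p.1 * act b g p.2.
Proof.
rewrite /pairing /act_vec /act !big_cons /=.
case: p => a [|[c i] t] /=; first by rewrite big_nil; ring.
by case: ifP => _; rewrite ?big_cons ?big_nil /=; ring.
Qed.

Lemma pairing_vec x g : pairing (vec x) g = words_act g x [::].
Proof.
elim: x g => [|b x IH] g; first by rewrite /pairing big_seq1 mul1r.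
rewrite /= -IH /pairing big_flatten big_map; apply: eq_bigr => p _.
exact: pairing_act_vec.
Qed.

(** By the symmetry act_gram, applying the letters of x to the vacuum or their
    transposes in the reverse order to the vacuum functional is the same. *)
Lemma words_act_rev x st :
  words_act vac (rev x) st = pairing (vec x) (gram^~ st).
Proof.
elim: x st => [|b x IH] st.
  by rewrite /pairing /= big_seq1 mul1r; case: st => [|[c i] t].
rewrite rev_cons /words_act foldl_rcons -/(words_act _ _) (eq_act _ IH).
rewrite act_sum pairing_vec /= -pairing_vec; apply: eq_bigr => p _.
by rewrite act_gram.
Qed.

(** The vacuum expectation of rev x ++ y is the inner product of the vectors
    obtained by applying x and y to the vacuum. *)
Lemma fock_gram x y : words_act vac (rev x ++ y) [::] =
  \sum_(p <- vec x) \sum_(q <- vec y) p.1 * q.1 * gram p.2 q.2.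
Proof.
rewrite /words_act foldl_cat -/(words_act _ _) -/(words_act _ _).
rewrite (eq_words_act _ (words_act_rev x)) -pairing_vec /pairing.
rewrite exchange_big; apply: eq_bigr => q _; rewrite mulr_sumr.
by apply: eq_bigr => p _; ring.
Qed.

End FockModel.

(** * Growth bounds *)

Section Growth.
Variable R : realFieldType.

(** With moment_system_peel, an induction on s and then on n bounds T n s by
    (16 r)^s (4 r)^n; the geometric factor 4 r against r makes the convolution
    sum in the recursion at most a third of the bound. *)
Lemma moment_system_cumulant_bound (m k : nat -> R) T r :
  0 < r -> (forall n, `|m n| <= r ^+ n) -> moment_system m k T ->
  forall s, (0 < s)%N -> `|k s| <= (16 * r) ^+ s.
Proof.
move=> r0 mr S; have r0' := ltW r0.
have geo n : 3 * \sum_(i < n) r ^+ i.+1 * (4 * r) ^+ (n - i.+1) <= (4 * r) ^+ n.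
  elim: n => [|n IH]; first by rewrite big_ord0 mulr0 expr0.
  rewrite big_ord_recl /= subSS subn0 expr1.
  under eq_bigr => i _ do rewrite /bump /= add1n subSS exprS -mulrA.
  rewrite -mulr_sumr exprS.
  have := ler_wpM2l r0' IH; lra.
have H s : (0 < s)%N -> forall n, `|T n s| <= (16 * r) ^+ s * (4 * r) ^+ n.
  elim: s => // -[|s] IH _ n.
    case: S => _ mS _; rewrite -mS expr1; apply: le_trans (mr _) _.
    rewrite exprS; apply: ler_pM; rewrite ?exprn_ge0 //; first lra.
    by apply: lerXn2r; rewrite ?nnegrE; lra.
  elim/ltn_ind: n => n IHn.
  rewrite (moment_system_peel _ S) //.
  have A0 : 0 <= (16 * r) ^+ s.+1 by apply: exprn_ge0; lra.
  have t1 := IH isT n.+1.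
  have t2 : `|T 0%N s.+1 * m n.+1| <= (16 * r) ^+ s.+1 * (r * (4 * r) ^+ n).
    rewrite normrM; apply: ler_pM => //.
      by have := IH isT 0%N; rewrite expr0 mulr1.
    apply: le_trans (mr _) _; rewrite exprS; apply: ler_wpM2l => //.
    by apply: lerXn2r; rewrite ?nnegrE; lra.
  have t3 : `|\sum_(i < n) m i.+1 * T (n - i.+1)%N s.+2| <=
      (16 * r) ^+ s.+2 * \sum_(i < n) r ^+ i.+1 * (4 * r) ^+ (n - i.+1).
    apply: le_trans (ler_norm_sum _ _ _) _; rewrite mulr_sumr.
    apply: ler_sum => i _; rewrite normrM mulrCA; apply: ler_pM => //.
    by apply: IHn; have := ltn_ord i; lia.
  have := geo n; move: t3; set G := \sum_(i < n) r ^+ _ * _ => t3 gn.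
  have g1 : (16 * r) ^+ s.+2 * G <= (16 * r) ^+ s.+2 * ((4 * r) ^+ n / 3).
    by apply: ler_wpM2l; [apply: exprn_ge0; lra|lra].
  have {}t3 := le_trans t3 g1.
  apply: le_trans (ler_normB _ _) _.
  apply: le_trans (lerD (ler_normB _ _) (lexx _)) _.
  move: A0 t1 t2 t3; clear g1 gn IH IHn.
  rewrite (exprS _ s.+1) (exprS _ n); set a := (16 * r) ^+ s.+1 => A0 t1 t2 t3.
  have p0 : 0 <= a * (r * (4 * r) ^+ n).
    by rewrite !mulr_ge0 ?exprn_ge0 //; lra.
  lra.
move=> s s0; have -> : k s = T 0%N s.
  by case: S => m0 _ TE; rewrite TE // big_ord0 addr0 m0 mulr1.
by have := H s s0 0%N; rewrite expr0 mulr1.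
Qed.

(** Weighting a cell (b, i) by D^(i+1), each of the four terms of X_b multiplies
    the weight by at most D. *)
Lemma fock_moment_bound (k : bool -> nat -> R) b D : 0 <= D ->
  (forall n, (0 < n)%N -> `|k b n| <= D ^+ n) ->
  forall n, `|iter n (act k b) (@vac R) [::]| <= (4 * D) ^+ n.
Proof.
move=> D0 kD n.
pose wt (st : stack) : R := \prod_(x <- st) D ^+ x.2.+1.
have wt0 st : 0 <= wt st by apply: prodr_ge0 => x _; apply: exprn_ge0.
suff H st : `|iter n (act k b) (@vac R) st| <= (4 * D) ^+ n * wt st.
  by have := H [::]; rewrite /wt big_nil mulr1.
have C0 m : 0 <= (4 * D) ^+ m by apply: exprn_ge0; lra.
elim: n st => [|n IH] st.
  rewrite /= mul1r /vac; case: st => [|x st]; last by rewrite normr0.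
  by rewrite /wt big_nil normr1.
rewrite iterS /act; set g := iter n _ _.
have e1 : `|g ((b, 0%N) :: st)| <= (4 * D) ^+ n * (D * wt st).
  by have := IH ((b, 0%N) :: st); rewrite /wt big_cons expr1.
have e2 : `|k b 1%N * g st| <= (4 * D) ^+ n * (D * wt st).
  rewrite normrM mulrCA; apply: ler_pM => //.
  by have := kD 1%N isT; rewrite expr1.
have e3 : `|pop k b g st| <= (4 * D) ^+ n * (D * wt st) * 2.
  case: st {e1 e2} => [|[c i] t] /=.
    by rewrite normr0 !mulr_ge0.
  case: eqP => [->|_]; last by rewrite normr0 !mulr_ge0.
  apply: le_trans (ler_normD _ _) _; rewrite mulr_natr mulr2n; apply: lerD.
    by have := IH ((b, i.+1) :: t); rewrite /wt !big_cons /= !exprS !mulrA.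
  rewrite normrM /wt big_cons /= -/(wt t) (mulrA D) -exprS mulrCA.
  by apply: ler_pM => //; apply: kD.
apply: le_trans (ler_normD _ _) _.
apply: le_trans (lerD (ler_normD _ _) (lexx _)) _.
rewrite exprS; move: e1 e2 e3; lra.
Qed.

End Growth.

(** * Positive semi-definite kernels *)

Section PositiveKernels.
Variable R : realFieldType.

(** Test vectors are finite sequences of coefficients and points, with possible
    repetitions, so that nothing is assumed on T. *)
Definition psd (T : Type) (G : T -> T -> R) :=
  (forall x y, G x y = G y x) /\
  forall s : seq (R * T),
    0 <= \sum_(p <- s) \sum_(q <- s) p.1 * q.1 * G p.2 q.2.

Lemma psd_weight (T U : Type) (w : T -> R) (f : T -> U) G :
  psd G -> psd (fun x y => w x * w y * G (f x) (f y)).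
Proof.
move=> [sG pG]; split=> [x y|s]; first by rewrite sG mulrAC mulrC mulrA mulrC.
have := pG [seq (p.1 * w p.2, f p.2) | p <- s].
rewrite big_map; congr (0 <= _); apply: eq_bigr => p _.
by rewrite big_map; apply: eq_bigr => q _ /=; ring.
Qed.

Lemma psdD (T : Type) (G H : T -> T -> R) : psd G -> psd H ->
  psd (fun x y => G x y + H x y).
Proof.
move=> [sG pG] [sH pH]; split=> [x y|s]; first by rewrite sG sH.
have := addr_ge0 (pG s) (pH s); rewrite -big_split; congr (0 <= _).
by apply: eq_bigr => p _; rewrite -big_split; apply: eq_bigr => q _ /=; ring.
Qed.

Lemma psd1 (T : Type) : psd (fun _ _ : T => 1).
Proof.
split=> // s; suff -> : \sum_(p <- s) \sum_(q <- s) p.1 * q.1 * 1 =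
  (\sum_(p <- s) p.1) ^+ 2 by exact: sqr_ge0.
rewrite expr2 mulr_suml; apply: eq_bigr => p _; rewrite mulr_sumr.
by apply: eq_bigr => q _; rewrite mulr1.
Qed.

Lemma eq_psd (T : Type) (G H : T -> T -> R) : (forall x y, G x y = H x y) ->
  psd G -> psd H.
Proof.
move=> e [sG pG]; split=> [x y|s]; first by rewrite -!e.
by under eq_bigr do under eq_bigr do rewrite -e.
Qed.

Lemma psd_diag (T : Type) (H : T -> T -> R) t : psd H -> 0 <= H t t.
Proof. by move=> [_ /(_ [:: (1, t)])]; rewrite !big_seq1 !mul1r. Qed.

(** Otherwise the quadratic form on the span of x and t, being affine along t,
    would take negative values; the coefficient of t in the proof makes it -1. *)
Lemma psd_isotropic (T : Type) (H : T -> T -> R) t : psd H -> H t t = 0 ->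
  forall x, H x t = 0.
Proof.
move=> pH tt x; apply/eqP; apply/negP => /negP nz.
have := pH.2 [:: (1, x); (- (H x x + 1) / (2 * H x t), t)].
rewrite !(big_cons, big_nil) /= tt (pH.1 t x) => h.
have : 0 <= H x x + 2 * (- (H x x + 1) / (2 * H x t)) * H x t by lra.
have -> : 2 * (- (H x x + 1) / (2 * H x t)) * H x t = - (H x x + 1).
  by field.
lra.
Qed.

(** The Schur complement of H at t: its quadratic form is the minimum of that of
    H over the coefficient of t. *)
Lemma psd_eliminate (T : Type) (H : T -> T -> R) t : psd H -> H t t != 0 ->
  psd (fun x y => H x y - H x t * H y t / H t t).
Proof.
move=> pH tt; split=> [x y|s]; first by rewrite pH.1 [H x t * _]mulrC.
pose L := \sum_(p <- s) p.1 * H p.2 t.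
have := pH.2 ((- L / H t t, t) :: s).
rewrite !big_cons /=.
under [X in _ + _ + X]eq_bigr do rewrite big_cons /=.
rewrite big_split /=.
have -> : \sum_(q <- s) - L / H t t * q.1 * H t q.2 = - L / H t t * L.
  by rewrite mulr_sumr; apply: eq_bigr => q _; rewrite (pH.1 t); ring.
have -> : \sum_(q <- s) q.1 * (- L / H t t) * H q.2 t = - L / H t t * L.
  by rewrite mulr_sumr; apply: eq_bigr => q _; ring.
have -> : \sum_(p <- s) \sum_(q <- s)
    p.1 * q.1 * (H p.2 q.2 - H p.2 t * H q.2 t / H t t) =
    \sum_(p <- s) \sum_(q <- s) p.1 * q.1 * H p.2 q.2 - L * L / H t t.
  rewrite -mulrA mulr_suml -sumrB; apply: eq_bigr => p _.
  rewrite mulr_suml mulr_sumr -sumrB; apply: eq_bigr => q _; ring.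
set Q := \sum_(p <- s) _.
congr (0 <= _); field; exact: tt.
Qed.

(** Schur product theorem by Gaussian elimination on H: the rank one part removed
    by psd_eliminate contributes a rescaling of G, and the complement vanishes at
    one more of the points of s. The induction is on a list of points outside of
    which H vanishes. *)
Lemma psd_schur (T : eqType) (G H : T -> T -> R) : psd G -> psd H ->
  psd (fun x y => G x y * H x y).
Proof.
move=> pG pH; split=> [x y|s]; first by rewrite pG.1 pH.1.
have : forall p, p \in s -> p.2 \in map snd s \/ forall x, H x p.2 = 0.
  by move=> p ps; left; apply: map_f.
elim: (map snd s) H pH => [|t r IH] H pH Hs.
  rewrite big_seq; apply: sumr_ge0 => p ps; rewrite big_seq.
  apply: sumr_ge0 => q qs.
  by case: (Hs q qs) => // ->; rewrite !mulr0.
case: (eqVneq (H t t) 0) => [tt|tt].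
  apply: IH => // p ps; case: (Hs p ps) => [|]; last by right.
  by rewrite inE => /orP[/eqP ->|]; [right; apply: psd_isotropic|left].
have h0 : 0 < (H t t)^-1 by rewrite invr_gt0 lt_neqAle eq_sym tt psd_diag.
have pH' := psd_eliminate pH tt.
have h1 := mulr_ge0 (ltW h0) ((psd_weight (H^~ t) id pG).2 s).
have h2 : 0 <= \sum_(p <- s) \sum_(q <- s)
    p.1 * q.1 * (G p.2 q.2 * (H p.2 q.2 - H p.2 t * H q.2 t / H t t)).
  apply: (IH _ pH') => p ps; case: (Hs p ps) => [|z]; last first.
    by right=> x; rewrite z (pH.1 p.2) z mulr0 mul0r subr0.
  rewrite inE => /orP[/eqP ->|]; last by left.
  by right=> x; field.
have := addr_ge0 h1 h2; rewrite mulr_sumr -big_split /=; congr (0 <= _).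
apply: eq_bigr => p _; rewrite mulr_sumr -big_split /=; apply: eq_bigr => q _.
by ring.
Qed.

(** Positivity of this kernel says that the cumulants from the second one on are
    the moments of a finite positive measure (the free Levy-Khintchine formula). *)
Definition cumulant_kernel (k : nat -> R) i j := k (i + j + 2)%N.

Section FockPositivity.
Variable k : bool -> nat -> R.
Hypothesis kP : forall b, psd (cumulant_kernel (k b)).

Definition top_kernel (u v : stack) :=
  match u, v with
  | (b, i) :: _, (c, j) :: _ => if b == c then k b (i + j + 2)%N else 0
  | _, _ => 0
  end.

Lemma psd_top : psd top_kernel.
Proof.
pose w b (u : stack) : R := if u is (c, _) :: _ then (c == b)%:R else 0.
pose f (u : stack) := if u is (_, i) :: _ then i else 0%N.
apply: eq_psd (psdD (psd_weight (w true) f (kP true))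
                    (psd_weight (w false) f (kP false))).
by move=> [|[[] i] u] [|[[] j] v] /=; rewrite /cumulant_kernel; ring.
Qed.

(** The inner product is a product along the stacks, so it is positive by the Schur
    product theorem; tgram is the same product truncated at depth n, written as a
    sum of products in which the case of two empty stacks is the rank one kernel
    e u * e v. *)
Lemma psd_gram : psd (gram k).
Proof.
pose e (u : stack) : R := (u == [::])%:R.
pose fix tgram n u v {struct n} : R := e u * e v +
  if n is m.+1 then top_kernel u v * tgram m (behead u) (behead v) else 0.
have pe : psd (fun u v => e u * e v).
  by apply: eq_psd (psd_weight e id (psd1 _)) => u v; rewrite mulr1.
have pt n : psd (tgram n).
  elim: n => [|n IH]; first by apply: eq_psd pe => u v /=; rewrite addr0.
  apply: psdD pe _; apply: (psd_schur psd_top (H := fun u v => _)).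
  apply: eq_psd (psd_weight (fun=> 1) behead IH) => u v; by rewrite !mul1r.
have tE n u v : (size u <= n)%N -> gram k u v = tgram n u v.
  have e0 : e [::] = 1 by rewrite /e eqxx.
  have ec x u' : e (x :: u') = 0 by [].
  elim: n u v => [|n IH] [|[b i] u] [|[c j] v] //= un; rewrite ?e0 ?ec; try ring.
  by case: ifP => _; rewrite ?(IH u v) //; ring.
split=> [|s]; first exact: gramC.
pose n := \max_(p <- s) size p.2.
have := (pt n).2 s; congr (0 <= _).
apply: eq_big_seq => p ps; apply: eq_big_seq => q qs.
by rewrite (tE n) // /n (big_rem p) //= leq_maxl.
Qed.

Lemma psd_fock : psd (fun x y => words_act k (@vac R) (rev x ++ y) [::]).
Proof.
split=> [x y|s].
  rewrite !fock_gram exchange_big; apply: eq_bigr => p _; apply: eq_bigr => q _.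
  by rewrite gramC; ring.
have := psd_gram.2 (flatten [seq [seq (p.1 * q.1, q.2) | q <- vec k p.2] | p <- s]).
rewrite big_flatten big_map; congr (0 <= _); apply: eq_bigr => p _.
rewrite big_map; under eq_bigr do rewrite big_flatten big_map.
rewrite exchange_big; apply: eq_bigr => q _; rewrite fock_gram mulr_sumr.
apply: eq_bigr => u _; rewrite big_map mulr_sumr; apply: eq_bigr => v _ /=.
ring.
Qed.

End FockPositivity.

End PositiveKernels.

(** * Positive functionals on polynomials over the unit interval *)

Local Open Scope classical_set_scope.
Local Open Scope ring_scope.

Section PositiveFunctionals.
Variable R : realType.
Implicit Types (L : {poly R} -> R) (p q : {poly R}).

Definition linear_functional L :=
  (forall p q, L (p + q) = L p + L q) /\ (forall c p, L (c *: p) = c * L p).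

Lemma linear_functional_sum L (I : Type) (r : seq I) (P : pred I)
    (c : I -> R) (f : I -> {poly R}) : linear_functional L ->
  L (\sum_(i <- r | P i) c i *: f i) = \sum_(i <- r | P i) c i * L (f i).
Proof.
move=> [LD LZ]; apply: (big_ind2 (fun a b => L a = b)) => //.
- by rewrite -(scale0r (0 : {poly R})) LZ mul0r.
- by move=> p1 x1 p2 x2 <- <-; rewrite LD.
Qed.

Lemma linear_functionalB L p q : linear_functional L -> L (p - q) = L p - L q.
Proof. by move=> [LD LZ]; rewrite LD -scaleN1r LZ mulN1r. Qed.

(** Positivity on squares weighted by 1, X and 1 - X. *)
Definition positive01 L :=
  [/\ linear_functional L, forall q, 0 <= L (q ^+ 2),
      forall q, 0 <= L ('X * q ^+ 2) & forall q, 0 <= L ((1 - 'X) * q ^+ 2)].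

Lemma positive01_mulX L : positive01 L -> positive01 (fun p => L (p * 'X)).
Proof.
move=> [[LD LZ] L2 LX LY]; split.
- by split=> [p q|c p]; rewrite ?mulrDl ?LD // -scalerAl LZ.
- by move=> q; rewrite mulrC.
- by move=> q; have := L2 ('X * q); congr (0 <= L _); ring.
- move=> q; have := addr_ge0 (LY ('X * q)) (LX ((1 - 'X) * q)).
  by rewrite -LD; congr (0 <= L _); ring.
Qed.

Lemma positive01_mul1X L :
  positive01 L -> positive01 (fun p => L (p * (1 - 'X))).
Proof.
move=> [[LD LZ] L2 LX LY]; split.
- by split=> [p q|c p]; rewrite ?mulrDl ?LD // -scalerAl LZ.
- by move=> q; rewrite mulrC.
- move=> q; have := addr_ge0 (LY ('X * q)) (LX ((1 - 'X) * q)).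
  by rewrite -LD; congr (0 <= L _); ring.
- by move=> q; have := L2 ((1 - 'X) * q); congr (0 <= L _); ring.
Qed.

Lemma positive01_mulsqr L h :
  positive01 L -> positive01 (fun p => L (p * h ^+ 2)).
Proof.
move=> [[LD LZ] L2 LX LY]; split.
- by split=> [p q|c p]; rewrite ?mulrDl ?LD // -scalerAl LZ.
- by move=> q; rewrite -exprMn.
- by move=> q; rewrite -mulrA -exprMn.
- by move=> q; rewrite -mulrA -exprMn.
Qed.

Lemma poly_lt0_near p a : p.[a] < 0 ->
  exists2 e, 0 < e & forall x, `|x - a| < e -> p.[x] < 0.
Proof.
move=> pa; have c : p.[x] @[x --> a] --> p.[a] by apply: continuous_horner.
have /nbhs_ballP[e /= e0 h] : \forall x \near a, p.[x] < 0.
  exact: (cvgr_lt _ c).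
by exists e => // x xa; apply: h; rewrite /ball /= distrC.
Qed.

Lemma poly_ge0_right p a b : a < b ->
  (forall x, a < x < b -> 0 <= p.[x]) -> 0 <= p.[a].
Proof.
move=> ab h; rewrite leNgt; apply/negP => /poly_lt0_near[e e0 he].
pose d := Num.min (e / 2) ((b - a) / 2).
have d0 : 0 < d by rewrite lt_min; lra.
have d1 : d <= e / 2 by rewrite ge_min lexx.
have d2 : d <= (b - a) / 2 by rewrite ge_min lexx orbT.
have h1 : p.[a + d] < 0 by apply: he; rewrite addrC addKr gtr0_norm //; lra.
by have := h (a + d); rewrite leNgt h1 => H; have := H ltac:(lra).
Qed.

Lemma poly_ge0_left p a b : a < b ->
  (forall x, a < x < b -> 0 <= p.[x]) -> 0 <= p.[b].
Proof.
move=> ab h; have := @poly_ge0_right (p \Po - 'X) (- b) (- a).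
rewrite horner_comp !hornerE opprK; apply; first lra.
by move=> x xab; rewrite horner_comp !hornerE; apply: h; lra.
Qed.

Lemma ge0_mulr_gt0 (x y : R) : 0 <= x * y -> 0 < y -> 0 <= x.
Proof. by move=> xy y0; rewrite -(pmulr_lge0 _ y0). Qed.

(** Induction on the degree. Subtracting its minimum on [0, 1], attained at a,
    gives p a factor X, 1 - X or (X - a)^2 according to the position of a. The
    quotient is again nonnegative on [0, 1], and the factor is absorbed into L by
    positive01_mulX, positive01_mul1X or positive01_mulsqr. *)
Lemma positive01_ge0 L p : positive01 L ->
  (forall x, 0 <= x <= 1 -> 0 <= p.[x]) -> 0 <= L p.
Proof.
move: {2}(size p) (leqnn (size p)) => n; elim: n L p => [|n IH] L p.
  rewrite leqn0 size_poly_eq0 => /eqP -> [[_ LZ] _ _ _] _.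
  by rewrite -(scale0r (0 : {poly R})) LZ mul0r.
move=> sp PL p0; have [lL L2 _ _] := PL.
have L1 c : 0 <= c -> 0 <= L c%:P.
  by move=> c0; rewrite -[c%:P]mulr1 mul_polyC lL.2 mulr_ge0 // -(expr1n _ 2) L2.
have [sp1|sp1] := leqP (size p) 1.
  rewrite (size1_polyC sp1); apply: L1.
  by have := p0 0 ltac:(lra); rewrite horner_coef0.
have [a] : exists2 c : R, c \in `[0, 1] & forall t : R, t \in `[0, 1] -> p.[c] <= p.[t].
  apply: EVT_min; first lra.
  by apply: continuous_subspaceT => x; apply: continuous_horner.
rewrite in_itv /= => a01 amin.
have pa := p0 a a01.
have rooted : root (p - (p.[a])%:P) a by rewrite rootE !hornerE subrr.
have [q qE] := factor_theorem _ _ rooted.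
have pE : p = (p.[a])%:P + q * ('X - a%:P) by rewrite -qE addrC subrK.
have rge x : 0 <= x <= 1 -> 0 <= q.[x] * (x - a).
  move=> x01; have := amin x; rewrite in_itv /= => /(_ x01).
  rewrite {2}pE !hornerE; lra.
have q0 : q != 0.
  apply: contraTneq sp1 => q0; rewrite pE q0 mul0r addr0 -leqNgt.
  exact: size_polyC_leq1.
have sq : (size q <= n)%N.
  have : (size (q * ('X - a%:P))%R <= n.+1)%N.
    rewrite -qE; apply: leq_trans (size_polyD _ _) _; rewrite geq_max sp size_polyN.
    by apply: leq_trans (size_polyC_leq1 _) _.
  by rewrite size_Mmonic ?monicXsubC // size_XsubC addn2 /= ltnS.
rewrite pE lL.1; apply: addr_ge0; first exact: L1.
have [a0|a0] := eqVneq a 0.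
  rewrite a0 subr0; have q0x x : 0 < x <= 1 -> 0 <= q.[x].
    move=> x01; apply: (@ge0_mulr_gt0 _ (x - a)); first by apply: rge; lra.
    by rewrite a0; lra.
  apply: (IH _ q sq (positive01_mulX PL)) => x x01.
  have [->|xn0] := eqVneq x 0; last by apply: q0x; lra.
  by apply: (@poly_ge0_right _ 0 1); [lra|move=> y y01; apply: q0x; lra].
have [a1|a1] := eqVneq a 1.
  have -> : q * ('X - a%:P) = - q * (1 - 'X) by rewrite a1; ring.
  have q1x x : 0 <= x < 1 -> 0 <= (- q).[x].
    move=> x01; apply: (@ge0_mulr_gt0 _ (1 - x)); last lra.
    by have := rge x; rewrite a1 hornerN; have := x01; lra.
  apply: (IH _ (- q) _ (positive01_mul1X PL)); first by rewrite size_polyN.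
  move=> x x01; have [->|xn1] := eqVneq x 1; last by apply: q1x; lra.
  by apply: (@poly_ge0_left _ 0 1); [lra|move=> y y01; apply: q1x; lra].
have a01' : 0 < a < 1 by lra.
have qr x : a < x <= 1 -> 0 <= q.[x].
  by move=> x01; apply: (@ge0_mulr_gt0 _ (x - a)); [apply: rge|]; lra.
have ql x : 0 <= x < a -> 0 <= (- q).[x].
  move=> x01; apply: (@ge0_mulr_gt0 _ (a - x)); last lra.
  by have := rge x; rewrite hornerN; have := x01; lra.
(* At an interior minimum the quotient changes sign, so it vanishes at a. *)
have qa : root q a.
  rewrite rootE; apply/eqP/le_anti/andP; split.
    have : 0 <= (- q).[a].
      by apply: (@poly_ge0_left _ 0 a); [lra|move=> y y01; apply: ql; lra].
    by rewrite hornerN; lra.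
  by apply: (@poly_ge0_right _ a 1); [lra|move=> y y01; apply: qr; lra].
have [q' q'E] := factor_theorem _ _ qa.
rewrite q'E -mulrA -expr2.
have q'x x : 0 <= x <= 1 -> x != a -> 0 <= q'.[x].
  move=> x01 xa; apply: (@ge0_mulr_gt0 _ ((x - a) ^+ 2)).
    by have := rge x x01; rewrite q'E hornerM hornerXsubC -mulrA -expr2.
  by rewrite lt_neqAle sqr_ge0 andbT eq_sym sqrf_eq0 subr_eq0.
apply: (IH _ q' _ (positive01_mulsqr _ PL)).
  have : (size (q' * ('X - a%:P))%R <= n)%N by rewrite -q'E.
  have q'0 : q' != 0 by apply: contraNneq q0 => q'0; rewrite q'E q'0 mul0r.
  by rewrite size_Mmonic ?monicXsubC // size_XsubC addn2 /=; apply: ltnW.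
move=> x x01; have [->|xa] := eqVneq x a; last exact: q'x.
by apply: (@poly_ge0_right _ a 1); [lra|move=> y y01; apply: q'x; lra].
Qed.

Lemma positive01_le L p q : positive01 L ->
  (forall x, 0 <= x <= 1 -> p.[x] <= q.[x]) -> L p <= L q.
Proof.
move=> PL pq; have [lL _ _ _] := PL.
rewrite -subr_ge0 -linear_functionalB //; apply: positive01_ge0 => // x x01.
by rewrite !hornerE subr_ge0 pq.
Qed.

(** The polynomials (1 - y^n)^(2^n) for an affine y that maps [0, 1] into itself
    and c and d to the two sides of 1/2: by the Bernoulli inequalities they tend to 1 where
    2 y < 1 and to 0 where 2 y > 1. *)
Lemma poly_step (c d e : R) : c < d -> 0 < e -> exists q : {poly R},
  [/\ forall x, 0 <= x <= 1 -> 0 <= q.[x] <= 1,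
      forall x, 0 <= x <= 1 -> x <= c -> 1 - e <= q.[x] &
      forall x, 0 <= x <= 1 -> d <= x -> q.[x] <= e].
Proof.
move=> cd e0; pose s := (c + d) / 2; pose M := 1 + `|s|.
have M0 : 0 < M by rewrite /M; have := normr_ge0 s; lra.
pose h := (d - c) / (4 * M); have h0 : 0 < h by rewrite divr_gt0; lra.
(* M bounds the distance from s to the points of [0, 1]. *)
pose y x := 1 / 2 + (x - s) / (2 * M).
have y01 x : 0 <= x <= 1 -> 0 <= y x <= 1.
  move=> x01; rewrite /y.
  have : `|(x - s) / (2 * M)| <= 1 / 2.
    rewrite normrM normfV (gtr0_norm (_ : 0 < 2 * M)); last lra.
    rewrite ler_pdivrMr; last lra.
    have := ler_normB x s; rewrite /M (ger0_norm (_ : 0 <= x)); lra.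
  by rewrite ler_norml; lra.
have yc x : x <= c -> y x <= 1 / 2 - h.
  move=> xc; rewrite /y /h.
  have -> : 1 / 2 - (d - c) / (4 * M) = 1 / 2 + (c - s) / (2 * M).
    by rewrite /s; field; lra.
  by rewrite lerD2l ler_pM2r ?invr_gt0; lra.
have yd x : d <= x -> 1 / 2 + h <= y x.
  move=> dx; rewrite /y /h.
  have -> : 1 / 2 + (d - c) / (4 * M) = 1 / 2 + (d - s) / (2 * M).
    by rewrite /s; field; lra.
  by rewrite lerD2l ler_pM2r ?invr_gt0; lra.
have bernoulli (u : R) n : 0 <= u -> 1 + n%:R * u <= (1 + u) ^+ n.
  move=> u0; elim: n => [|n IH]; first by rewrite mul0r addr0.
  rewrite exprS -natr1; have := ler_wpM2l (_ : 0 <= 1 + u) IH.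
  move=> /(_ ltac:(lra)); have : 0 <= n%:R * u * u by rewrite !mulr_ge0.
  lra.
have bernoulli' (u : R) n : 0 <= u <= 1 -> 1 - n%:R * u <= (1 - u) ^+ n.
  move=> u0; elim: n => [|n IH]; first by rewrite mul0r subr0.
  rewrite exprS -natr1; have := ler_wpM2l (_ : 0 <= 1 - u) IH.
  move=> /(_ ltac:(lra)); have : 0 <= n%:R * u * u by rewrite !mulr_ge0 //; lra.
  lra.
have [n en] : exists n, e^-1 <= (1 + 2 * h) ^+ n.
  pose n := (Num.truncn (e^-1 / (2 * h))).+1; exists n.
  have n1 : e^-1 / (2 * h) <= n%:R by rewrite ltW // truncnS_gt.
  apply: le_trans (bernoulli _ n _); last lra.
  by move: n1; rewrite ler_pdivrMr; lra.
pose q := (1 - ((1 / 2)%:P + (2 * M)^-1 *: ('X - s%:P)) ^+ n) ^+ (2 ^ n).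
have qE x : q.[x] = (1 - y x ^+ n) ^+ (2 ^ n).
  by rewrite /q !(horner_exp, hornerE) /y div1r [(2 * M)^-1 * _]mulrC.
have yn01 x : 0 <= x <= 1 -> 0 <= y x ^+ n <= 1.
  by move=> /y01/andP[? ?]; rewrite exprn_ge0 // exprn_ile1.
exists q; split=> x x01; rewrite qE.
- by have := yn01 _ x01 => yn; rewrite exprn_ge0 ?exprn_ile1 //; lra.
- move=> xc; apply: le_trans (bernoulli' _ _ (yn01 _ x01)).
  rewrite lerD2l lerN2 natrX -exprMn.
  have yx := y01 _ x01; have := yc x xc => yxc.
  apply: (@le_trans _ _ ((1 + 2 * h) ^- n)); last first.
    by rewrite -[e]invrK lef_pV2 ?posrE ?invr_gt0 ?exprn_gt0 //; lra.
  rewrite -[leRHS]mul1r ler_pdivlMr ?exprn_gt0 //; last lra.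
  rewrite -exprMn; apply: exprn_ile1; first by rewrite !mulr_ge0 //; lra.
  have : 2 * y x * (1 + 2 * h) <= (1 - 2 * h) * (1 + 2 * h).
    by apply: ler_wpM2r; lra.
  have : 0 <= h * h by apply: mulr_ge0; lra.
  lra.
- move=> dx; have yn := yn01 _ x01; have yx := y01 _ x01.
  have N1 : (1 + 2 * h) ^+ n <= (2 ^ n)%:R * y x ^+ n.
    rewrite natrX -exprMn; apply: lerXn2r; rewrite ?nnegrE; have := yd x dx; lra.
  have N2 := bernoulli (y x ^+ n) (2 ^ n)%N ltac:(lra).
  have N3 : (1 - y x ^+ n) ^+ (2 ^ n) * (1 + y x ^+ n) ^+ (2 ^ n) <= 1.
    rewrite -exprMn; apply: exprn_ile1; first by apply: mulr_ge0; lra.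
    have : 0 <= y x ^+ n * y x ^+ n by apply: mulr_ge0; lra.
    lra.
  have N4 : 0 <= (1 - y x ^+ n) ^+ (2 ^ n) by rewrite exprn_ge0; lra.
  have N5 : e^-1 <= (1 + y x ^+ n) ^+ (2 ^ n) by lra.
  have := le_trans (ler_wpM2l N4 N5) N3.
  by rewrite ler_pdivrMr // mul1r.
Qed.

End PositiveFunctionals.

(** * Distribution function of a positive functional *)

Section PolynomialCdf.
Variable R : realType.
Implicit Types (L : {poly R} -> R) (p q : {poly R}) (t : R).

Definition majorant t q :=
  forall x, 0 <= x <= 1 -> 0 <= q.[x] /\ (x <= t -> 1 <= q.[x]).

(** The mass that a functional L gives to ]-oo, t], by outer approximation of the
    indicator function of that half-line on [0, 1]. *)
Definition poly_cdf L t := inf [set L q | q in [set q | majorant t q]].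

Lemma majorant1 t : majorant t 1.
Proof. by move=> x _; rewrite hornerC. Qed.

Section OneFunctional.
Variable L : {poly R} -> R.
Hypotheses (PL : positive01 L) (L1 : L 1 = 1).

Lemma poly_cdf_le t q : majorant t q -> poly_cdf L t <= L q.
Proof.
move=> mq; apply: ge_inf; last by exists q.
by exists 0 => _ [p mp <-]; apply: positive01_ge0 => // x /mp[].
Qed.

Lemma poly_cdf_ge t c : (forall q, majorant t q -> c <= L q) -> c <= poly_cdf L t.
Proof.
move=> h; apply: lb_le_inf; first by exists (L 1), 1 => //; apply: majorant1.
by move=> _ [q mq <-]; apply: h.
Qed.

Lemma poly_cdf_approx t e : 0 < e ->
  exists2 q, majorant t q & L q < poly_cdf L t + e.
Proof.
move=> e0; have [|_ [q mq <-] h] := @inf_adherent _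
  [set L q | q in [set q | majorant t q]] e e0; last by exists q.
split; first by exists (L 1), 1 => //; apply: majorant1.
by exists 0 => _ [p mp <-]; apply: positive01_ge0 => // x /mp[].
Qed.

Lemma poly_cdf_ge0 t : 0 <= poly_cdf L t.
Proof.
by apply: poly_cdf_ge => q mq; apply: positive01_ge0 => // x /mq[].
Qed.

Lemma poly_cdf_le1 t : poly_cdf L t <= 1.
Proof. by rewrite -L1; apply: poly_cdf_le; apply: majorant1. Qed.

Lemma poly_cdf_nondecreasing : {homo poly_cdf L : s t / s <= t}.
Proof.
move=> s t st; apply: poly_cdf_ge => q mq; apply: poly_cdf_le => x x01.
by have [? h] := mq x x01; split=> // xs; apply/h/(le_trans xs).
Qed.

Lemma poly_cdf_lt0 t : t < 0 -> poly_cdf L t = 0.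
Proof.
move=> t0; apply/le_anti; rewrite poly_cdf_ge0 andbT.
have [[_ LZ] _ _ _] := PL.
have <- : L 0 = 0 by rewrite -(scale0r (0 : {poly R})) LZ mul0r.
by apply: poly_cdf_le => x x01; rewrite horner0; split=> //; lra.
Qed.

Lemma poly_cdf_ge1 t : 1 <= t -> poly_cdf L t = 1.
Proof.
move=> t1; apply/le_anti; rewrite poly_cdf_le1 /=; apply: poly_cdf_ge => q mq.
rewrite -L1; apply: positive01_le => // x x01; rewrite hornerC.
by apply: (mq x x01).2; lra.
Qed.

(** A majorant at t whose value is nearly optimal remains one at s slightly above
    t once a small constant is added, by continuity. *)
Lemma poly_cdf_right t e : 0 < e ->
  exists2 d, 0 < d & forall s, s <= t + d -> poly_cdf L s <= poly_cdf L t + e.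
Proof.
move=> e0; have [t0|t0] := ltP t 0.
  exists (- t / 2); first lra.
  by move=> s st; rewrite (poly_cdf_lt0 (_ : s < 0)) ?addr_ge0 ?poly_cdf_ge0 //; lra.
have [t1|t1] := leP 1 t.
  by exists 1 => // s _; rewrite (poly_cdf_ge1 t1); have := poly_cdf_le1 s; lra.
have [q mq qlt] := poly_cdf_approx t (divr_gt0 e0 (ltr0n _ 2)).
have qt : 1 <= q.[t] by apply: (mq t _).2; lra.
have [d d0 dP] := @poly_lt0_near _ (1 - q - (e / 2)%:P) t ltac:(rewrite !hornerE; lra).
exists (d / 2); first lra; move=> s st.
have [lL _ _ _] := PL.
have -> : poly_cdf L t + e = poly_cdf L t + e / 2 + e / 2 by lra.
apply: le_trans (_ : L (q + (e / 2)%:P) <= _); last first.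
  by rewrite lL.1 -[(e / 2)%:P]mulr1 mul_polyC lL.2 L1; lra.
apply: poly_cdf_le => x x01; have [qx mqx] := mq x x01.
rewrite !hornerE; split=> [|xs]; first lra.
have [xt|tx] := leP x t; first by have := mqx xt; lra.
have := dP x; rewrite !hornerE gtr0_norm ?subr_gt0 // => /(_ ltac:(lra)); lra.
Qed.

End OneFunctional.

Lemma sub_expr_le (k : nat) (x y : R) : 0 <= y <= x -> x <= 1 ->
  x ^+ k - y ^+ k <= k%:R * (x - y).
Proof.
move=> yx x1; elim: k => [|k IH]; first by rewrite !expr0 mul0r subrr.
have yk : 0 <= y ^+ k <= 1 by rewrite exprn_ge0 ?exprn_ile1 //; lra.
rewrite !exprS -natr1.
have : x * (x ^+ k - y ^+ k) <= 1 * (k%:R * (x - y)).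
  apply: ler_pM => //; [lra|].
  by rewrite subr_ge0; apply: lerXn2r; rewrite ?nnegrE; lra.
have : y ^+ k * (x - y) <= 1 * (x - y) by apply: ler_wpM2r; lra.
lra.
Qed.

Section CompareFunctionals.
Variables L L' : {poly R} -> R.
Hypotheses (PL : positive01 L) (L1 : L 1 = 1).
Hypotheses (PL' : positive01 L') (L'1 : L' 1 = 1).
Hypothesis FF' : poly_cdf L =1 poly_cdf L'.

Variables (N : nat) (k : nat).
Hypothesis N0 : (0 < N)%N.
Let t (j : nat) : R := j%:R / N%:R.
Let c j := t j.+1 ^+ k - t j ^+ k.
Let F := poly_cdf L.

Let NR : 0 < N%:R :> R. Proof. by rewrite ltr0n. Qed.
Let t_ge0 j : 0 <= t j. Proof. by rewrite divr_ge0. Qed.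
Let t_le j : t j <= t j.+1.
Proof. by rewrite ler_pM2r ?invr_gt0 // ler_nat. Qed.
Let c_ge0 j : 0 <= c j.
Proof. by rewrite subr_ge0; apply: lerXn2r; rewrite ?nnegrE. Qed.
Let t0 : t 0 = 0. Proof. by rewrite /t mul0r. Qed.
Let tN : t N = 1. Proof. by rewrite /t divff // lt0r_neq0. Qed.

Let telescope (f : nat -> R) : \sum_(j < N) (f j.+1 - f j) = f N - f 0%N.
Proof. by rewrite -(big_mkord predT (fun j => f j.+1 - f j)) telescope_sumr. Qed.

(** The function 1 - x^k is the integral of the indicator functions of x <= t
    against d(t^k). The terms maxk x j.+1 - maxk x j are its parts over the steps
    of the subdivision t 0 < ... < t N. *)
Let maxk x j := Num.max (t j) x ^+ k.

Let sum_maxk x : 0 <= x <= 1 -> \sum_(j < N) (maxk x j.+1 - maxk x j) = 1 - x ^+ k.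
Proof.
move=> x01; rewrite (telescope (maxk x)) /maxk tN t0.
by rewrite max_l ?max_r ?expr1n //; lra.
Qed.

Let sum_c : \sum_(j < N) c j <= 1.
Proof. by rewrite (telescope (fun j => t j ^+ k)) tN t0 expr1n gerBl exprn_ge0. Qed.

(** Replacing each indicator function by a nearly optimal majorant. *)
Let upper e : 0 < e -> L (1 - 'X^k) <= \sum_(j < N) c j * F (t j.+1) + e.
Proof.
move=> e0; have /choice[q qP] : forall j : nat, exists q : {poly R},
    majorant (t j.+1) q /\ L q < F (t j.+1) + e.
  by move=> j; have [q mq ql] := poly_cdf_approx PL (t j.+1) e0; exists q.
apply: le_trans (_ : L (\sum_(j < N) c j *: q j) <= _).
  apply: positive01_le => // x x01.
  rewrite !hornerE horner_sum -sum_maxk //; apply: ler_sum => j _.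
  rewrite hornerZ; have [q0 q1] := (qP j).1 _ x01.
  have [xt|tx] := leP x (t j.+1).
    apply: le_trans (_ : c j * 1 <= _); last by apply: ler_wpM2l => //; apply: q1.
    rewrite mulr1 /maxk (max_l xt) /c lerD2l lerN2; apply: lerXn2r; rewrite ?nnegrE //.
      by rewrite le_max t_ge0.
    by rewrite le_max lexx.
  have tx' := le_trans (t_le j) (ltW tx).
  by rewrite /maxk (max_r (ltW tx)) (max_r tx') subrr mulr_ge0.
rewrite linear_functional_sum; last by case: PL.
apply: le_trans (_ : \sum_(j < N) (c j * F (t j.+1) + c j * e) <= _).
  by apply: ler_sum => j _; rewrite -mulrDr ler_wpM2l // ltW // (qP j).2.
rewrite big_split /= lerD2l -mulr_suml; have := ler_wpM2r (ltW e0) sum_c; lra.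
Qed.

(** Replacing each indicator function by a polynomial step between
    (j - 1) / N and j / N, a small constant being added to make it a majorant at
    (j - 1) / N. *)
Let lower e : 0 < e ->
  \sum_(j < N) c j * F ((j%:R - 1) / N%:R) <= L' (1 - 'X^k) + e.
Proof.
move=> e0; have e2 : 0 < e / 2 by lra.
have dlt (j : nat) : (j%:R - 1) / N%:R < t j :> R.
  by rewrite ltr_pM2r ?invr_gt0 //; lra.
have /choice[q qP] : forall j : nat, exists q : {poly R},
    [/\ forall x, 0 <= x <= 1 -> 0 <= q.[x] <= 1,
        forall x, 0 <= x <= 1 -> x <= (j%:R - 1) / N%:R -> 1 - e / 2 <= q.[x] &
        forall x, 0 <= x <= 1 -> t j <= x -> q.[x] <= e / 2].
  by move=> j; apply: poly_step.
have [lL _ _ _] := PL'.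
have Lc b : L' b%:P = b by rewrite -[b%:P]mulr1 mul_polyC lL.2 L'1 mulr1.
apply: le_trans (_ : L' (\sum_(j < N) c j *: (q j + (e / 2)%:P)) <= _).
  rewrite linear_functional_sum //; apply: ler_sum => j _; apply: ler_wpM2l => //.
  rewrite /F FF'; apply: poly_cdf_le => // x x01; have [h1 h2 _] := qP j.
  rewrite !hornerE; split; first by have := h1 x x01; lra.
  by move=> xj; have := h2 x x01 xj; lra.
rewrite -[X in _ <= _ + X]Lc -lL.1; apply: positive01_le => // x x01.
rewrite !hornerE horner_sum -sum_maxk //.
have ce : \sum_(j < N) c j * e <= e.
  by rewrite -mulr_suml; have := ler_wpM2r (ltW e0) sum_c; lra.
apply: le_trans (_ : \sum_(j < N) (maxk x j.+1 - maxk x j + c j * e) <= _); last first.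
  by rewrite big_split /= lerD2l.
apply: ler_sum => j _; rewrite hornerZ !hornerE; have [h1 _ h3] := qP j.
have [tx|xt] := leP (t j) x.
  have h : (q j).[x] + e / 2 <= e by have := h3 x x01 tx; lra.
  apply: le_trans (ler_wpM2l (c_ge0 j) h) _; rewrite lerDr subr_ge0.
  apply: lerXn2r; rewrite ?nnegrE ?le_max ?t_ge0 //.
  by rewrite !ge_max tx lexx orbT.
have xt' := lt_le_trans xt (t_le j).
rewrite /maxk (max_l (ltW xt)) (max_l (ltW xt')) -/(c j).
have h : (q j).[x] + e / 2 <= 1 + e by have := h1 x x01; lra.
by apply: le_trans (ler_wpM2l (c_ge0 j) h) _; rewrite mulrDr mulr1.
Qed.

(** The two Riemann sums differ by at most 2 k / N: their increments c j are at
    most k / N, and the differences of F over two steps have a telescoping sum. *)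
Lemma poly_cdf_compare e : 0 < e ->
  L (1 - 'X^k) <= L' (1 - 'X^k) + k%:R / N%:R * 2 + e.
Proof.
move=> e0; have e2 : 0 < e / 2 by lra.
have u := upper e2; have l := lower e2.
suff : \sum_(j < N) c j * F (t j.+1) <=
  \sum_(j < N) c j * F ((j%:R - 1) / N%:R) + k%:R / N%:R * 2 by lra.
rewrite -lerBlDl -sumrB.
pose G (j : nat) := F ((j%:R - 1) / N%:R).
apply: le_trans (_ : \sum_(j < N) k%:R / N%:R * (G j.+2 - G j) <= _).
  apply: ler_sum => j _; rewrite -mulrBr.
  have -> : F (t j.+1) = G j.+2 by rewrite /G /t -(natr1 j.+1) addrK.
  apply: ler_wpM2r.
    rewrite subr_ge0; apply: poly_cdf_nondecreasing => //.
    by rewrite ler_pM2r ?invr_gt0 // lerD2r ler_nat; lia.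
  have tj1 : t j.+1 <= 1.
    by rewrite ler_pdivrMr // mul1r ler_nat ltn_ord.
  apply: le_trans (sub_expr_le k _ tj1) _; first by rewrite t_ge0 t_le.
  by rewrite /t -mulrBl -natr1 addrAC subrr add0r mul1r.
rewrite -mulr_sumr; apply: ler_wpM2l; first by rewrite divr_ge0.
have -> : \sum_(j < N) (G j.+2 - G j) =
    \sum_(j < N) (G j.+2 - G j.+1) + \sum_(j < N) (G j.+1 - G j).
  by rewrite -big_split /=; apply: eq_bigr => j _; lra.
rewrite (telescope (fun j => G j.+1)) (telescope G).
have F01 x : 0 <= F x <= 1 by rewrite poly_cdf_ge0 // poly_cdf_le1.
have := F01 ((N.+1%:R - 1) / N%:R); have := F01 ((1%:R - 1) / N%:R).
have := F01 ((N%:R - 1) / N%:R); have := F01 ((0%:R - 1) / N%:R).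
rewrite /G; lra.
Qed.

End CompareFunctionals.

Lemma poly_cdf_compare_lim L L' k : positive01 L -> L 1 = 1 ->
  positive01 L' -> L' 1 = 1 -> poly_cdf L =1 poly_cdf L' ->
  L (1 - 'X^k) <= L' (1 - 'X^k).
Proof.
move=> PL L1 PL' L'1 FF'; apply/ler_addgt0Pr => e e0.
pose N := (Num.truncn (k%:R * 4 / e)).+1.
have h : k%:R * 4 / e < N%:R by rewrite truncnS_gt.
have := @poly_cdf_compare L L' PL L1 PL' L'1 FF' N k isT (e / 2) ltac:(lra).
have : k%:R / N%:R * 2 <= e / 2.
  move: h; rewrite ltr_pdivrMr // mulrAC ler_pdivrMr ?ltr0n //.
  set n := N%:R; set K := k%:R; lra.
lra.
Qed.

(** A positive functional is determined by its distribution function: the powers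
    of X are recovered from the functions 1 - X^k, the values of which are compared
    through Riemann-Stieltjes sums in poly_cdf_compare. *)
Lemma poly_cdf_inj L L' : positive01 L -> L 1 = 1 ->
  positive01 L' -> L' 1 = 1 -> poly_cdf L =1 poly_cdf L' -> L =1 L'.
Proof.
move=> PL L1 PL' L'1 FF' p.
have [lL _ _ _] := PL; have [lL' _ _ _] := PL'.
rewrite -(coefK p) poly_def !linear_functional_sum //.
apply: eq_bigr => i _; congr (_ * _).
have : L (1 - 'X^i) = L' (1 - 'X^i).
  by apply/le_anti; rewrite !poly_cdf_compare_lim // => x; rewrite FF'.
rewrite !linear_functionalB // L1 L'1; lra.
Qed.

End PolynomialCdf.

(** * Measures on an interval as functionals on polynomials *)

Section Cdf.
Variable R : realType.
Implicit Types mu nu : probability (measurableTypeR R) R.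

Definition half_line_mass mu (t : R) : R := fine (mu `]-oo, t]%classic).

Let idTR : measurableTypeR R -> R := idfun.
#[local] HB.instance Definition _ :=
  @isMeasurableFun.Build _ _ _ _ idTR (@measurable_id _ _ setT).

Lemma half_line_massE mu t : mu `]-oo, t]%classic = (half_line_mass mu t)%:E.
Proof. by rewrite /half_line_mass fineK // fin_num_measure. Qed.

Lemma half_line_mass_right mu t e : 0 < e ->
  exists2 d, 0 < d & half_line_mass mu (t + d) <= half_line_mass mu t + e.
Proof.
move=> e0; have rc : half_line_mass mu x @[x --> t^'+] --> half_line_mass mu t.
  have := @cdf_right_continuous _ _ _ mu (idTR : {RV mu >-> R}) t.
  rewrite /cdf /distribution /pushforward /= => h.
  apply: fine_cvg; rewrite -half_line_massE; exact: h.
have te : half_line_mass mu t < half_line_mass mu t + e by rewrite ltrDl.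
have [d /= d0 h] := cvgr_lt _ rc _ te.
exists (d / 2); first lra.
apply: ltW; apply: h; rewrite ?ltrDl //; last lra.
by rewrite /= opprD addNKr normrN gtr0_norm; lra.
Qed.

Lemma measure_eq_half_lines mu nu :
  (forall t, half_line_mass mu t = half_line_mass nu t) -> mu ≡μ nu.
Proof.
move=> h A mA.
apply: (@measure_unique _ R (measurableTypeR R) (@ocitv R)
  (fun n => `]- n%:R, n%:R]%classic)) => //.
- exact: ocitvI.
- by move=> n; exact: is_ocitv.
- exact: (bigcup_itvT false false).
- move=> _ [[a b] _ <-] /=.
  have [ab | ba] := leP a b; last first.
    by rewrite set_itv_ge ?measure0 // bnd_simp -leNgt ltW.
  have -> : `]a, b]%classic = `]-oo, b]%classic `\` `]-oo, a]%classic :> set R.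
    by rewrite -[RHS]setCK setCD setCitvl setUC -[LHS]setCK setCitv.
  rewrite !measureD //= ?setIidr; try exact: subset_itvl.
  + by rewrite !half_line_massE !h.
  + by rewrite half_line_massE ltry.
  + by rewrite half_line_massE ltry.
- by move=> k; rewrite (le_lt_trans (probability_le1 _ _)) ?ltry.
Qed.

End Cdf.

Section IntervalFunctional.
Variable R : realType.
Variables (mu : probability (measurableTypeR R) R) (r : R).
Hypotheses (r0 : 0 < r) (mur : mu (~` `[- r, r]%classic) = 0%E).
Implicit Types (p q : {poly R}).

(** The affine change of variable from [-r, r] to [0, 1], its inverse being the
    polynomial function from01. *)
Definition to01 (x : R) := (x + r) / (2 * r).

Definition from01 : {poly R} := (2 * r) *: 'X - r%:P.

Definition interval_functional p := \int[mu]_(x in `[- r, r]) p.[to01 x].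

Let D : set R := `[- r, r]%classic.
Let mD : measurable D. Proof. exact: measurable_itv. Qed.

Lemma to01_itv x : `[- r, r]%classic x -> 0 <= to01 x <= 1.
Proof.
rewrite /= in_itv /= /to01 => /andP[h1 h2].
by apply/andP; split; [apply: divr_ge0|rewrite ler_pdivrMr ?mulr_gt0 //]; lra.
Qed.

Lemma to01_le x y : (to01 x <= to01 y) = (x <= y).
Proof. by rewrite /to01 ler_pM2r ?lerD2r // invr_gt0 mulr_gt0. Qed.

Lemma to01_lt x y : (to01 x < to01 y) = (x < y).
Proof. by rewrite /to01 ltr_pM2r ?ltrD2r // invr_gt0 mulr_gt0. Qed.

Lemma mass_itv : mu `[- r, r]%classic = 1%E.
Proof.
by move: mur; rewrite probability_setC //; have : mu D \is a fin_num;
  [exact: fin_num_measure|rewrite -/D; case: (mu D) => // a _ [] /subr0_eq <-].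
Qed.

Lemma integrable_continuous (f : R -> R) : continuous f ->
  mu.-integrable `[- r, r]%classic (EFin \o f).
Proof.
move=> cf; apply: measurable_bounded_integrable => //.
- by rewrite (le_lt_trans (probability_le1 _ _)) ?ltry.
- by apply: measurable_funTS; apply: continuous_measurable_fun.
- have : compact (f @` D).
    by apply: continuous_compact; [exact: continuous_subspaceT|exact: segment_compact].
  move=> /compact_bounded[M [Mr MP]]; exists M; split => // x Mx y Dy.
  by apply: (MP _ Mx); exists y.
Qed.

Lemma integrable_poly p : mu.-integrable `[- r, r]%classic (EFin \o (fun x => p.[to01 x])).
Proof.
apply: integrable_continuous => x.
apply: (@continuous_comp _ _ _ to01 (horner p)); last exact: continuous_horner.
apply: cvgM; last exact: cvg_cst.
by apply: cvgD; [exact: cvg_id|exact: cvg_cst].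
Qed.

Lemma interval_functional_ge0 p : (forall x, 0 <= x <= 1 -> 0 <= p.[x]) ->
  0 <= interval_functional p.
Proof. by move=> h; apply: Rintegral_ge0 => x /to01_itv /h. Qed.

Lemma interval_functional_positive : positive01 interval_functional.
Proof.
split.
- split=> [p q|c p]; rewrite /interval_functional.
    under eq_Rintegral do rewrite hornerD.
    by rewrite RintegralD //; exact: integrable_poly.
  under eq_Rintegral do rewrite hornerZ.
  by rewrite RintegralZl //; exact: integrable_poly.
- by move=> q; apply: interval_functional_ge0 => x _; rewrite horner_exp sqr_ge0.
- move=> q; apply: interval_functional_ge0 => x /andP[x0 _].
  by rewrite hornerM hornerX horner_exp mulr_ge0 ?sqr_ge0.
- move=> q; apply: interval_functional_ge0 => x /andP[_ x1].
  rewrite hornerM horner_exp mulr_ge0 ?sqr_ge0 //.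
  by rewrite !hornerE subr_ge0.
Qed.

Lemma interval_functional1 : interval_functional 1 = 1.
Proof.
rewrite /interval_functional; under eq_Rintegral do rewrite hornerC.
by rewrite Rintegral_cst // mul1r; exact: (congr1 fine mass_itv).
Qed.

Lemma mass_interval t : fine (mu (`]-oo, t]%classic `&` `[- r, r]%classic)) = half_line_mass mu t.
Proof.
rewrite /half_line_mass; congr fine.
pose A : set R := `]-oo, t]%classic; rewrite -/A.
have mA : measurable A by exact: measurable_itv.
have mDC : measurable (~` D) by apply: measurableC.
have AE : A = (A `&` D) `|` (A `&` ~` D) by rewrite -setIUr setUv setIT.
rewrite [in RHS]AE measureU; [|exact: measurableI|exact: measurableI|]; last first.
  by rewrite setIACA setICr setI0.
rewrite [X in (_ + X)%E](_ : _ = 0%E) ?adde0 //.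
apply/eqP; rewrite eq_le measure_ge0 andbT -mur.
by apply: le_measure; rewrite ?inE //; exact: measurableI.
Qed.

(** Both sides are compared through polynomials: a majorant integrates to at least
    the mass, and a polynomial step just to the right of t integrates to little
    more, by right continuity of the distribution function. *)
Lemma interval_functional_cdf t :
  poly_cdf interval_functional (to01 t) = half_line_mass mu t.
Proof.
have PL := interval_functional_positive; have L1 := interval_functional1.
have intI s c : mu.-integrable D (EFin \o (fun x => \1_(`]-oo, s]%classic) x + c)).
  apply: measurable_bounded_integrable => //; first by rewrite (le_lt_trans (probability_le1 _ _)) ?ltry.
    by apply: measurable_funD => //; apply: measurable_indic.
  exists (1 + `|c|); split; first exact: num_real.
  move=> M cM x _; apply: le_trans (ltW cM); apply: le_trans (ler_normD _ _) _.
  by rewrite lerD2r indicE; case: (_ \in _); rewrite ?normr1 ?normr0.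
have intE s c : \int[mu]_(x in D) (\1_(`]-oo, s]%classic) x + c) = half_line_mass mu s + c.
  have h := intI s 0; rewrite RintegralD //.
  - rewrite Rintegral_cst // [X in c * X](congr1 fine mass_itv) mulr1; congr (_ + _).
    by rewrite /Rintegral integral_indic // mass_interval.
  - by move: h; congr (mu.-integrable D _); apply/funext => x /=; rewrite addr0.
  - by apply: integrable_continuous => x; exact: cvg_cst.
apply/le_anti/andP; split; last first.
  apply: poly_cdf_ge => q mq; rewrite -[leLHS]addr0 -intE.
  apply: le_Rintegral; [exact: mD|exact: intI|exact: integrable_poly|].
  move=> x /to01_itv x01; have [q0 q1] := mq _ x01; rewrite addr0 indicE.
  have [xt|_] := boolP (x \in _); last by [].
  by apply: q1; move: xt; rewrite inE /= in_itv /= to01_le.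
apply/ler_addgt0Pr => e e0.
have [d d0 hd] := half_line_mass_right mu t (divr_gt0 e0 (ltr0n _ 2)).
have tt : to01 t < to01 (t + d) by rewrite to01_lt; lra.
have e4 : 0 < e / 4 by lra.
have [q [q01 qc qd]] := poly_step tt e4.
apply: le_trans (_ : interval_functional (q + (e / 4)%:P) <= _).
  apply: poly_cdf_le => // x x01; rewrite !hornerE; split.
    by have := q01 x x01; lra.
  by move=> xt; have := qc x x01 xt; lra.
apply: le_trans (_ : half_line_mass mu (t + d) + e / 2 <= _); last lra.
rewrite -intE; apply: le_Rintegral; [exact: mD|exact: integrable_poly|exact: intI|].
move=> x /to01_itv x01; rewrite !hornerE indicE; have [_|] := boolP (x \in _).
  by have := q01 _ x01; rewrite mulr1n; lra.
rewrite notin_setE /= in_itv /= => /negP; rewrite -ltNge => h.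
by have := qd _ x01; rewrite to01_le mulr0n => /(_ (ltW h)); lra.
Qed.

Lemma integral_interval (f : R -> R) : continuous f ->
  \int[mu]_x f x = \int[mu]_(x in `[- r, r]) f x.
Proof.
move=> cf; rewrite [RHS]Rintegral_mkcond /Rintegral; congr fine.
apply: ae_eq_integral => //.
- by apply/measurable_EFinP; apply: continuous_measurable_fun.
- apply/measurable_EFinP.
  apply: (measurable_restrictT (D := D) f mD).1.
  by apply: measurable_funTS; apply: continuous_measurable_fun.
exists (~` D); split => //; first exact: measurableC.
by move=> x /=; apply: contra_not => Dx _; rewrite patchE mem_set.
Qed.

Lemma integral_moment n : \int[mu]_x (x ^+ n) =
  interval_functional (from01 ^+ n).
Proof.
rewrite integral_interval; last exact: exprn_continuous.
apply: eq_Rintegral => x _.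
rewrite horner_exp /from01 hornerD hornerN hornerZ hornerX hornerC /to01.
suff -> : 2 * r * ((x + r) / (2 * r)) - r = x by [].
by field; rewrite lt0r_neq0.
Qed.

End IntervalFunctional.

(** * Moments of compactly supported measures *)

Section MomentsOfMeasures.
Variable R : realType.
Implicit Types mu nu : Mc R.

Lemma Mc_bounded mu : exists2 M : R, 0 < M &
  forall r, M <= r -> mu (~` `[- r, r]%classic) = 0%E.
Proof.
have [K cK K0] := Mc_compact mu.
have [M [_ MP]] := compact_bounded cK.
exists (`|M| + 1) => [|r Mr]; first by rewrite ltr_wpDl.
apply/eqP; rewrite eq_le measure_ge0 andbT -K0.
have mK : measurable (K : set (measurableTypeR R)) by apply: compact_measurable.
apply: le_measure; rewrite ?inE; [exact: measurableC|exact: measurableC|].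
apply: subsetC => x Kx; rewrite /= in_itv /= -ler_norml.
apply: le_trans Mr; apply: (MP _ _ x Kx).
by rewrite (le_lt_trans (ler_norm _)) // ltrDl.
Qed.

Lemma moment_functional mu r n : 0 < r -> mu (~` `[- r, r]%classic) = 0%E ->
  moment mu n = interval_functional mu r (from01 r ^+ n).
Proof. by move=> r0 mur; rewrite /moment (integral_moment r0 mur). Qed.

Lemma from01_bounds (r x : R) : 0 < r -> 0 <= x <= 1 -> - r <= (from01 r).[x] <= r.
Proof.
move=> r0 /andP[x0 x1]; rewrite /from01 hornerD hornerN hornerZ hornerX hornerC.
have : 0 <= r * x by rewrite mulr_ge0 // ltW.
have : r * x <= r * 1 by rewrite ler_pM2l.
rewrite mulr1; lra.
Qed.

Lemma moment0 mu : moment mu 0 = 1.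
Proof.
have [M M0 /(_ M (lexx M)) mur] := Mc_bounded mu.
by rewrite (moment_functional _ M0) // expr0 interval_functional1.
Qed.

Lemma moment_bound mu : exists2 r, 0 < r & forall n, `|moment mu n| <= r ^+ n.
Proof.
have [r r0 /(_ r (lexx r)) mur] := Mc_bounded mu; exists r => // n.
rewrite (moment_functional _ r0) //.
have PL := interval_functional_positive mu r0.
have [lL _ _ _] := PL.
have Lc b : interval_functional mu r b%:P = b.
  by rewrite -[b%:P]mulr1 mul_polyC lL.2 interval_functional1 // mulr1.
have rb x : 0 <= x <= 1 -> `|(from01 r ^+ n).[x]| <= r ^+ n.
  move=> x01; rewrite horner_exp normrX; apply: lerXn2r; rewrite ?nnegrE ?(ltW r0) //.
  by rewrite ler_norml from01_bounds.
rewrite ler_norml -[- _]Lc -[X in _ <= _ <= X]Lc; apply/andP; split.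
  apply: positive01_le => // x /rb; rewrite hornerC ler_norml; by case/andP.
apply: positive01_le => // x /rb; rewrite hornerC ler_norml; by case/andP.
Qed.

Lemma psd_moment mu : psd (fun i j => moment mu (i + j)).
Proof.
have [r r0 /(_ r (lexx r)) mur] := Mc_bounded mu.
have PL := interval_functional_positive mu r0.
have [lL L2 _ _] := PL.
split=> [i j|s]; first by rewrite addnC.
pose q := \sum_(p <- s) p.1 *: from01 r ^+ p.2.
have := L2 q; congr (0 <= _).
rewrite expr2 {1}/q mulr_suml.
under eq_bigr do rewrite -scalerAl.
rewrite linear_functional_sum //; apply: eq_bigr => p _.
rewrite /q mulr_sumr; under eq_bigr do rewrite -scalerAr -exprD.
rewrite linear_functional_sum // mulr_sumr; apply: eq_bigr => p' _.
by rewrite (moment_functional _ r0) // mulrA.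
Qed.

(** The moments determine the functional interval_functional on an interval
    carrying both measures, hence the distribution functions. *)
Lemma moment_inj mu nu : moment mu =1 moment nu -> mu ≡μ nu.
Proof.
move=> mn; have [M1 M10 h1] := Mc_bounded mu; have [M2 M20 h2] := Mc_bounded nu.
pose r := Num.max M1 M2.
have r0 : 0 < r by rewrite lt_max M10.
have {h1}h1 := h1 r ltac:(by rewrite le_max lexx).
have {h2}h2 := h2 r ltac:(by rewrite le_max lexx orbT).
pose phi : {poly R} := (2 * r)^-1 *: ('X + r%:P).
have phiK p : (p \Po phi) \Po from01 r = p.
  rewrite -comp_polyA -[RHS]comp_polyXr; congr (_ \Po _).
  rewrite /phi comp_polyZ comp_polyD comp_polyX comp_polyC /from01 subrK.
  by rewrite scalerA mulVf ?scale1r // lt0r_neq0 // mulr_gt0.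
have [lL _ _ _] := interval_functional_positive mu r0.
have [lL' _ _ _] := interval_functional_positive nu r0.
have LL' : interval_functional mu r = interval_functional nu r.
  apply/funext => p; rewrite -(phiK p) comp_polyE !linear_functional_sum //.
  by apply: eq_bigr => i _; rewrite -!moment_functional // mn.
apply: measure_eq_half_lines => t.
by rewrite -!(interval_functional_cdf r0) // LL'.
Qed.

Lemma eq_moment mu nu : mu ≡μ nu -> moment mu =1 moment nu.
Proof.
move=> e n; rewrite /moment /Rintegral; congr fine.
by apply: eq_measure_integral => A mA _; apply: e.
Qed.

End MomentsOfMeasures.

(** * The moment problem on an interval *)

Section MomentProblem.
Variable R : realType.
Variables (m : nat -> R) (r : R).
Hypotheses (r0 : 0 < r) (m0 : m 0%N = 1).
Hypothesis pm : psd (fun i j => m (i + j)%N).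
Hypothesis mr : forall n, `|m n| <= r ^+ n.
Implicit Types p q : {poly R}.

Definition moment_form p := \sum_(i < size p) p`_i * m i.

Lemma moment_formw p n : (size p <= n)%N ->
  moment_form p = \sum_(i < n) p`_i * m i.
Proof.
move=> pn; rewrite /moment_form -(big_mkord predT (fun i => p`_i * m i)).
rewrite -(big_mkord predT (fun i => p`_i * m i)).
rewrite [RHS](big_cat_nat _ (n := size p)) //=.
rewrite [X in _ + X]big_nat_cond [X in _ + X]big1 ?addr0 // => i /andP[/andP[pi _] _].
by rewrite nth_default // mul0r.
Qed.

Lemma moment_form_linear : linear_functional moment_form.
Proof.
split=> [p q|c p].
  pose n := maxn (size p) (size q).
  rewrite (@moment_formw (p + q) n) ?size_polyD // (@moment_formw p n) ?leq_maxl //.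
  rewrite (@moment_formw q n) ?leq_maxr // -big_split /=.
  by apply: eq_bigr => i _; rewrite coefD mulrDl.
rewrite (@moment_formw (c *: p) (size p)) ?size_scale_leq // mulr_sumr.
by apply: eq_bigr => i _; rewrite coefZ mulrA.
Qed.
Let lin := moment_form_linear.

Lemma moment_formXn n : moment_form 'X^n = m n.
Proof.
rewrite /moment_form size_polyXn big_ord_recr /= coefXn eqxx mul1r.
rewrite big1 ?add0r // => i _; rewrite coefXn.
by rewrite (ltn_eqF (ltn_ord i)) mul0r.
Qed.

Lemma moment_form_sqr q : 0 <= moment_form (q ^+ 2).
Proof.
have := pm.2 [seq (q`_i, i) | i <- index_iota 0 (size q)].
rewrite big_map big_mkord; congr (0 <= _).
have qE : \sum_(j < size q) q`_j *: 'X^j = q by rewrite -poly_def coefK.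
have XnE n : 'X^n * q = \sum_(j < size q) q`_j *: 'X^(n + j).
  rewrite -[in LHS]qE mulr_sumr; apply: eq_bigr => j _.
  by rewrite -scalerAr -exprD.
transitivity (moment_form (\sum_(i < size q) q`_i *: ('X^i * q))).
  rewrite linear_functional_sum //; apply: eq_bigr => i _.
  rewrite XnE big_map big_mkord linear_functional_sum // mulr_sumr.
  by apply: eq_bigr => j _; rewrite moment_formXn mulrA.
congr moment_form; rewrite expr2 -[X in _ = X * _]qE mulr_suml.
by apply: eq_bigr => i _; rewrite scalerAl.
Qed.

Lemma moment_form_growth q : exists2 C, 0 <= C &
  forall k, moment_form (('X^k * q) ^+ 2) <= C * (r ^+ 2) ^+ k.
Proof.
exists (\sum_(i < size (q ^+ 2)) `|(q ^+ 2)`_i| * r ^+ i).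
  by apply: sumr_ge0 => i _; rewrite mulr_ge0 // exprn_ge0 // ltW.
move=> k; rewrite exprMn -['X^k ^+ 2]exprM; set p := q ^+ 2.
have {1}<- : \sum_(j < size p) p`_j *: 'X^j = p by rewrite -poly_def coefK.
rewrite mulr_sumr; under eq_bigr do rewrite -scalerAr -exprD.
rewrite linear_functional_sum // mulr_suml; apply: ler_sum => i _.
rewrite moment_formXn; apply: le_trans (ler_norm _) _.
rewrite normrM -mulrA; apply: ler_wpM2l => //.
apply: le_trans (mr _) _; rewrite -[(r ^+ 2) ^+ k]exprM -exprD.
by rewrite (mulnC 2) addnC.
Qed.

Lemma moment_form_cauchy p q :
  moment_form (p * q) ^+ 2 <= moment_form (p ^+ 2) * moment_form (q ^+ 2).
Proof.
have H t : 0 <= moment_form (p ^+ 2) + t * (2 * moment_form (p * q))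
    + t ^+ 2 * moment_form (q ^+ 2).
  have := moment_form_sqr (p + t *: q).
  have -> : (p + t *: q) ^+ 2 =
      p ^+ 2 + (t *: (p * q) + t *: (p * q)) + (t * t) *: q ^+ 2.
    rewrite -!mul_polyC !polyCM; ring.
  rewrite !lin.1 !lin.2; congr (0 <= _); ring.
set a := moment_form (p ^+ 2) in H *; set b := moment_form (p * q) in H *.
set c := moment_form (q ^+ 2) in H *.
have c0 : 0 <= c by exact: moment_form_sqr.
have [cz|cn] := eqVneq c 0.
  have [->|bn] := eqVneq b 0; first by rewrite cz mulr0 expr0n.
  have := H (- (a + 1) / (2 * b)); rewrite cz mulr0 addr0.
  have -> : - (a + 1) / (2 * b) * (2 * b) = - (a + 1) by field.
  lra.
have cp : 0 < c by rewrite lt_neqAle eq_sym cn.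
have := H (- b / c).
have -> : a + - b / c * (2 * b) + (- b / c) ^+ 2 * c = (a * c - b ^+ 2) / c.
  by field.
by rewrite pmulr_lge0 ?invr_gt0 // subr_ge0.
Qed.

(** The quantities s k = L ((X^k q)^2) are log-convex by Cauchy-Schwarz. If the
    first ratio exceeded r^2 they would grow faster than (r^2)^k, against the
    bound moment_form_growth given by the size of the moments. *)
Lemma moment_form_mulX q : moment_form (('X * q) ^+ 2) <= r ^+ 2 * moment_form (q ^+ 2).
Proof.
pose s k := moment_form (('X^k * q) ^+ 2).
have s0 k : 0 <= s k by exact: moment_form_sqr.
have conv k : s k.+1 ^+ 2 <= s k * s k.+2.
  have := moment_form_cauchy ('X^k * q) ('X^(k.+2) * q).
  suff -> : 'X^k * q * ('X^(k.+2) * q) = ('X^(k.+1) * q) ^+ 2 by [].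
  by rewrite !exprS; ring.
have -> : moment_form (('X * q) ^+ 2) = s 1%N by rewrite /s expr1.
have -> : moment_form (q ^+ 2) = s 0%N by rewrite /s expr0 mul1r.
have [//|lt01] := leP (s 1%N) (r ^+ 2 * s 0%N).
have r2 : 0 < r ^+ 2 by rewrite exprn_gt0.
have s00 : 0 < s 0%N.
  rewrite lt_neqAle s0 andbT; apply/eqP => e.
  have := conv 0%N; rewrite -e mul0r => h.
  have : s 1%N ^+ 2 = 0 by apply/le_anti; rewrite h sqr_ge0.
  move/eqP; rewrite sqrf_eq0 => /eqP e1.
  by move: lt01; rewrite e1 -e mulr0 ltxx.
pose l := s 1%N / s 0%N.
have lr : r ^+ 2 < l by rewrite ltr_pdivlMr.
have l0 : 0 < l by exact: lt_trans lr.
have step k : 0 < s k /\ l * s k <= s k.+1.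
  elim: k => [|k [sk lk]]; first by rewrite /l divfK ?lt0r_neq0.
  have sk1 : 0 < s k.+1 by apply: lt_le_trans lk; rewrite mulr_gt0.
  split=> //; rewrite -(ler_pM2l sk); apply: le_trans (conv k).
  by rewrite mulrCA mulrA expr2 ler_pM2r.
have grow k : l ^+ k * s 0%N <= s k.
  elim: k => [|k IH]; first by rewrite expr0 mul1r.
  rewrite exprS -mulrA; apply: le_trans (step k).2.
  by rewrite ler_pM2l.
have [C C0 CP] := moment_form_growth q.
pose u := l / r ^+ 2 - 1.
have u0 : 0 < u by rewrite subr_gt0 ltr_pdivlMr // mul1r.
have bern k : 1 + k%:R * u <= (l / r ^+ 2) ^+ k.
  have -> : l / r ^+ 2 = 1 + u by rewrite /u; lra.
  elim: k => [|k IH]; first by rewrite mul0r addr0.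
  rewrite exprS -natr1; have u1 : 0 <= 1 + u by lra.
  have := ler_wpM2l u1 IH; have : 0 <= k%:R * u * u by rewrite !mulr_ge0 // ltW.
  lra.
have bound k : (l / r ^+ 2) ^+ k <= C / s 0%N.
  rewrite ler_pdivlMr // expr_div_n mulrAC ler_pdivrMr ?exprn_gt0 //.
  exact: le_trans (grow k) (CP k).
(* 1 + k u, the Bernoulli lower bound for (l / r^2)^k, exceeds C / s 0. *)
pose k := (Num.truncn (C / s 0%N / u)).+1.
have : C / s 0%N / u < k%:R by rewrite truncnS_gt.
rewrite ltr_pdivrMr // => h.
have := le_trans (bern k) (bound k); lra.
Qed.

Let phi : {poly R} := (2 * r)^-1 *: ('X + r%:P).

Lemma comp_poly_expr p q n : (p ^+ n) \Po q = (p \Po q) ^+ n.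
Proof. exact: (rmorphXn (comp_poly q)). Qed.

Definition moment_form01 p := moment_form (p \Po phi).

(** From 2 r (r + e X) q^2 = ((r + e X) q)^2 + (r^2 - X^2) q^2 for e = 1 or -1. *)
Lemma moment_form_pm (e : bool) q :
  0 <= moment_form ((r%:P + (-1) ^+ e *: 'X) * q ^+ 2).
Proof.
set l := r%:P + _.
have -> : l * q ^+ 2 = (2 * r)^-1 *: ((l * q) ^+ 2
    + ((r ^+ 2) *: q ^+ 2 - ('X * q) ^+ 2)).
  have -> : (l * q) ^+ 2 + ((r ^+ 2) *: q ^+ 2 - ('X * q) ^+ 2) =
    (2 * r) *: (l * q ^+ 2).
    have e2 : ((-1) ^+ e *: 'X : {poly R}) ^+ 2 = 'X^2.
      by rewrite exprZn sqrr_sign scale1r.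
    rewrite -!mul_polyC expr2 !polyCM /l; move: e2.
    set x := _ *: 'X => e2.
    have -> : ('X * q) ^+ 2 = x ^+ 2 * q ^+ 2 by rewrite exprMn e2.
    by ring.
  by rewrite scalerA mulVf ?scale1r // mulf_neq0 // lt0r_neq0.
rewrite lin.2 mulr_ge0 ?invr_ge0 ?mulr_ge0 ?(ltW r0) //.
rewrite lin.1 linear_functionalB // lin.2 addr_ge0 ?moment_form_sqr //.
by rewrite subr_ge0 moment_form_mulX.
Qed.

Lemma moment_form01_positive : positive01 moment_form01.
Proof.
have i0 : 0 <= (2 * r)^-1 by rewrite invr_ge0 mulr_ge0 // ltW.
split.
- by split=> [p q|c p]; rewrite /moment_form01 ?comp_polyD ?comp_polyZ ?lin.1 ?lin.2.
- by move=> q; rewrite /moment_form01 comp_poly_expr moment_form_sqr.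
- move=> q; rewrite /moment_form01 comp_polyM comp_poly_expr comp_polyX.
  set Q := q \Po phi; rewrite /phi -scalerAl lin.2 mulr_ge0 // ['X + _]addrC.
  by have := moment_form_pm false Q; rewrite expr0 scale1r.
- move=> q; rewrite /moment_form01 comp_polyM comp_poly_expr comp_polyB comp_polyX.
  rewrite comp_polyC; set Q := q \Po phi; rewrite /phi.
  have -> : 1%:P - (2 * r)^-1 *: ('X + r%:P) = (2 * r)^-1 *: (r%:P - 'X).
    rewrite -!mul_polyC polyC1.
    have -> : (1 : {poly R}) = ((2 * r)^-1)%:P * (2 * r)%:P.
      by rewrite -polyCM mulVf // mulf_neq0 // lt0r_neq0.
    by rewrite polyCM; ring.
  rewrite -scalerAl lin.2 mulr_ge0 //.
  by have := moment_form_pm true Q; rewrite expr1 scaleN1r.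
Qed.

Lemma moment_form01_1 : moment_form01 1 = 1.
Proof. by rewrite /moment_form01 comp_polyC polyC1 -(expr0 ('X : {poly R})) moment_formXn. Qed.

Let PL := moment_form01_positive.
Let L1 := moment_form01_1.

Definition moment_cdf (t : R) := poly_cdf moment_form01 (to01 r t).

Lemma moment_cdf_nd : nondecreasing moment_cdf.
Proof. by move=> s t st; apply: poly_cdf_nondecreasing => //; rewrite to01_le. Qed.

Lemma moment_cdf_rc : right_continuous moment_cdf.
Proof.
move=> t; apply/cvgrPdist_le => e e0.
have [d d0 dP] := poly_cdf_right PL L1 (to01 r t) e0.
have d2 : 0 < d * (2 * r) by rewrite !mulr_gt0.
exists (d * (2 * r)) => //= s st ts.
have le1 := moment_cdf_nd (ltW ts).
have : moment_cdf s <= moment_cdf t + e.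
  apply: dP; rewrite /to01 -lerBlDl -mulrBl ler_pdivrMr ?mulr_gt0 //.
  have : `|t - s| < d * (2 * r) := st.
  by rewrite ltr0_norm ?subr_lt0 //; lra.
by rewrite ler0_norm ?subr_le0 //; lra.
Qed.

HB.instance Definition _ :=
  isCumulative.Build R _ R moment_cdf moment_cdf_nd moment_cdf_rc.

Lemma moment_cdf_lt t : t < - r -> moment_cdf t = 0.
Proof.
move=> tr; apply: poly_cdf_lt0 => //; rewrite /to01 ltr_pdivrMr ?mulr_gt0 //; lra.
Qed.

Lemma moment_cdf_ge t : r <= t -> moment_cdf t = 1.
Proof.
move=> tr; apply: poly_cdf_ge1 => //; rewrite /to01 ler_pdivlMr ?mulr_gt0 //; lra.
Qed.

Lemma moment_cdf_Ny : moment_cdf @ -oo --> (0 : R).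
Proof.
apply: cvg_near_cst; exists (- r); split; first exact: num_real.
by move=> x xr; rewrite moment_cdf_lt.
Qed.

Lemma moment_cdf_y : moment_cdf @ +oo --> (1 : R).
Proof.
apply: cvg_near_cst; exists r; split; first exact: num_real.
by move=> x xr; rewrite moment_cdf_ge // ltW.
Qed.

HB.instance Definition _ :=
  isCumulativeBounded.Build R 0 1 moment_cdf moment_cdf_Ny moment_cdf_y.

Let P : probability (measurableTypeR R) R := lebesgue_stieltjes_measure moment_cdf.

Let Pcdf t : half_line_mass P t = moment_cdf t.
Proof.
have := cdf_lebesgue_stieltjes_id moment_cdf t.
by rewrite /half_line_mass => /(congr1 fine) /= <-.
Qed.

Let P_itv : P (~` `[- r, r]%classic) = 0%E.
Proof.
have sub : ~` `[- r, r]%classic `<=`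
    (\bigcup_n `]-oo, - r - n.+1%:R^-1]%classic) `|` ~` `]-oo, r]%classic.
  move=> x /=; rewrite !in_itv /= => h.
  have [xr|xr] := leP x r; last by right; move: xr; rewrite /= ?in_itv /= ltNge => /negP.
  left; have {h}xr' : x < - r.
    by rewrite ltNge; apply/negP => h'; apply: h; rewrite h'.
  pose n := Num.truncn ((- r - x)^-1); exists n => //=; rewrite in_itv /=.
  have d0 : 0 < - r - x by lra.
  have h1 : (- r - x)^-1 < n.+1%:R by rewrite truncnS_gt.
  have h2 : n.+1%:R^-1 < - r - x by rewrite invf_plt // posrE.
  by apply: ltW; rewrite ltrBrDr -ltrBrDl.
have mU : measurable (\bigcup_n `]-oo, - r - n.+1%:R^-1]%classic : set (measurableTypeR R)).
  by apply: bigcup_measurable => n _; exact: measurable_itv.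
have mV : measurable (~` `]-oo, r]%classic : set (measurableTypeR R)).
  by apply: measurableC; exact: measurable_itv.
apply/eqP; rewrite eq_le measure_ge0 andbT.
apply: (@le_trans _ _ (P ((\bigcup_n `]-oo, - r - n.+1%:R^-1]%classic) `|` ~` `]-oo, r]%classic))).
  by apply: le_measure => //; rewrite inE; [apply: measurableC|apply: measurableU].
have e1 : P (~` `]-oo, r]%classic) = 0%E.
  by rewrite probability_setC // half_line_massE Pcdf moment_cdf_ge // subee.
have e2 : P (\bigcup_n `]-oo, - r - n.+1%:R^-1]%classic) = 0%E.
  apply: measure_negligible => //; apply: negligible_bigcup => n.
  apply/negligibleP; first exact: measurable_itv.
  apply: etrans (half_line_massE P _) _.
  by rewrite Pcdf moment_cdf_lt // ltrBlDr ltrDl invr_gt0.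
apply: le_trans (measureU2 P mU mV) _.
by rewrite [X in (X + _ <= _)%E]e2 [X in (_ + X <= _)%E]e1 adde0.
Qed.

(** The distribution function of the functional defines a Lebesgue-Stieltjes
    measure; the functionals of that measure and of m have the same distribution
    function, hence are equal by poly_cdf_inj. *)
Theorem moment_problem : exists mu : Mc R, moment mu =1 m.
Proof.
have Pc : compactly_supported P.
  by exists `[- r, r]%classic; [exact: segment_compact|exact: P_itv].
exists (MkMc Pc) => n; rewrite (moment_functional _ r0) //=.
have PL' := interval_functional_positive P r0.
have L'1 := interval_functional1 P_itv.
rewrite (poly_cdf_inj PL' L'1 PL L1) => [|x].
  rewrite /moment_form01 comp_poly_expr.
  suff -> : from01 r \Po phi = 'X by rewrite moment_formXn.
  rewrite /from01 comp_polyB comp_polyZ comp_polyX comp_polyC /phi scalerA.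
  by rewrite mulfV ?mulf_neq0 ?lt0r_neq0 // scale1r addrK.
have -> : x = to01 r (2 * r * x - r).
  by rewrite /to01; field; rewrite lt0r_neq0.
by rewrite interval_functional_cdf // Pcdf.
Qed.

End MomentProblem.

(** * Freeness determines the moments of a sum *)

Section FreeDetermines.
Variable K : comNzRingType.

Section Elements.
Variables (A : algType K) (phi : {scalar A}) (a b : A).

Definition elt (u : bool * {poly K}) : A := horner_alg (if u.1 then a else b) u.2.

Definition color_alternating (s : seq (bool * {poly K})) :=
  sorted (fun u v => u.1 != v.1) s.

(** Freeness of the subalgebras generated by a and b, as in free_independent, but
    for a linear functional on an algebra over an arbitrary ring. *)
Definition alg_free :=
  forall s, s != [::] -> color_alternating s ->
    (forall u, u \in s -> phi (elt u) = 0) -> phi (\prod_(u <- s) elt u) = 0.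

Lemma state_elt u : phi (elt u) =
  \sum_(i < size u.2) u.2`_i * phi ((if u.1 then a else b) ^+ i).
Proof.
rewrite /elt -{1}(coefK u.2) poly_def !linear_sum; apply: eq_bigr => i _ /=.
rewrite -mul_polyC rmorphM /= horner_algC mulr_algl linearZ /=.
by rewrite rmorphXn /= horner_algX.
Qed.

Lemma elt_merge s1 (c : bool) p q s2 :
  \prod_(u <- s1 ++ (c, p) :: (c, q) :: s2) elt u =
  \prod_(u <- s1 ++ (c, p * q) :: s2) elt u.
Proof. by rewrite !big_cat !big_cons /= [elt (c, p * q)]rmorphM /= !mulrA. Qed.

Lemma elt_center s1 (c : bool) p x s2 :
  \prod_(u <- s1 ++ (c, p) :: s2) elt u =
  \prod_(u <- s1 ++ (c, p - x%:P) :: s2) elt u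
  + x *: \prod_(u <- s1 ++ s2) elt u.
Proof.
have -> : \prod_(u <- s1 ++ (c, p) :: s2) elt u =
    (\prod_(u <- s1) elt u) * (elt (c, p - x%:P) + x%:A) * \prod_(u <- s2) elt u.
  rewrite big_cat big_cons /= mulrA /elt /= rmorphB /=.
  by rewrite horner_algC subrK.
by rewrite !big_cat big_cons /= mulrDr mulrDl !mulrA -scalerAr mulr1 -scalerAl.
Qed.

End Elements.

Variables (A A' : algType K) (phi : {scalar A}) (phi' : {scalar A'}).
Variables (a b : A) (a' b' : A').
Hypotheses (phi1 : phi 1 = 1) (phi'1 : phi' 1 = 1).
Hypotheses (free : alg_free phi a b) (free' : alg_free phi' a' b').
Hypothesis law_a : forall n, phi (a ^+ n) = phi' (a' ^+ n).
Hypothesis law_b : forall n, phi (b ^+ n) = phi' (b' ^+ n).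

Lemma not_sorted_split (T : Type) (e : rel T) s : ~~ sorted e s ->
  exists s1 u v s2, s = s1 ++ u :: v :: s2 /\ ~~ e u v.
Proof.
elim: s => [//|u [//|v s] IH] /=; rewrite negb_and => /orP[euv|es].
  by exists [::], u, v, s.
by have [s1 [x [y [s2 [-> ?]]]]] := IH es; exists (u :: s1), x, y, s2.
Qed.

(** Induction on the number of factors. Two neighbours from the same subalgebra
    are merged; otherwise the factors are centred one at a time from the left,
    each step producing a shorter product, until freeness applies. *)
Lemma free_determines s :
  phi (\prod_(u <- s) elt a b u) = phi' (\prod_(u <- s) elt a' b' u).
Proof.
have eltE u : phi (elt a b u) = phi' (elt a' b' u).
  by rewrite !state_elt; apply: eq_bigr => i _; case: u.1; rewrite ?law_a ?law_b.
move: {2}(size s) (leqnn (size s)) => n; elim: n s => [|n IH] s.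
  by rewrite leqn0 => /nilP ->; rewrite !big_nil phi1 phi'1.
move=> sn; have [alt|] := boolP (color_alternating s); last first.
  move=> /not_sorted_split[s1 [[c p] [[d q] [s2 [sE /negPn /= /eqP cd]]]]].
  move: sn; rewrite sE -cd !elt_merge => sn; apply: IH.
  by move: sn; rewrite !size_cat /=; lia.
suff H s2 s1 : color_alternating (s1 ++ s2) -> (size (s1 ++ s2) <= n.+1)%N ->
    (forall u, u \in s1 -> phi (elt a b u) = 0) ->
    phi (\prod_(u <- s1 ++ s2) elt a b u) = phi' (\prod_(u <- s1 ++ s2) elt a' b' u).
  by apply: (H s [::]).
elim: s2 s1 => [|[c p] s2 IHs] s1.
  rewrite cats0 => alt1 _ cent; have [->|s10] := eqVneq s1 [::].
    by rewrite !big_nil phi1 phi'1.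
  by rewrite free // free' // => u us; rewrite -eltE cent.
move=> alt2 sz cent; set x := phi (elt a b (c, p)).
rewrite (elt_center a b _ _ _ x) (elt_center a' b' _ _ _ x) !linearD !linearZ /=.
congr (_ + _ * _); last by apply: IH; move: sz; rewrite !size_cat /=; lia.
rewrite -cat_rcons; apply: IHs.
- have altE t : color_alternating t = sorted (fun x y : bool => x != y) (map fst t).
    by rewrite sorted_map.
  by move: alt2; rewrite cat_rcons !altE !map_cat.
- by rewrite cat_rcons; move: sz; rewrite !size_cat.
- move=> u; rewrite mem_rcons inE => /orP[/eqP ->|/cent //].
  rewrite /elt /= rmorphB /= horner_algC linearB linearZ /= phi1.
  by rewrite [X in X * 1](_ : x = phi (elt a b (c, p))) // /elt /= mulr1 subrr.
Qed.

(** A power of a + b is expanded letter by letter, the word read so far being kept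
    as a product to the left of the remaining power. *)
Lemma free_determines_sum n : phi ((a + b) ^+ n) = phi' ((a' + b') ^+ n).
Proof.
suff H s : phi ((\prod_(u <- s) elt a b u) * (a + b) ^+ n) =
           phi' ((\prod_(u <- s) elt a' b' u) * (a' + b') ^+ n).
  by have := H [::]; rewrite !big_nil !mul1r.
elim: n s => [|n IH] s; first by rewrite !mulr1 free_determines.
have eA (B : algType K) (x y : B) : elt x y (true, 'X) = x by rewrite /elt horner_algX.
have eB (B : algType K) (x y : B) : elt x y (false, 'X) = y by rewrite /elt horner_algX.
rewrite !exprS !mulrA !mulrDr !mulrDl !linearD /=.
have := IH (rcons s (true, 'X)); have := IH (rcons s (false, 'X)).
by rewrite !big_rcons /= !eA !eB => -> ->.
Qed.

End FreeDetermines.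

(** * The Fock state on the free algebra *)

Section FreeAlgebra.
Variable K : comNzRingType.

(** The monoid algebra of the free monoid on two letters, under its own name
    because the algebra structure below is attached to it. *)
Definition freealg := malg (fmonom bool) K.
HB.instance Definition _ := GRing.Lalgebra.on freealg.
Implicit Types (P Q : freealg) (w : fmonom bool).

Definition word w : freealg := mkmalgU w 1.

Lemma scale_word c w : c *: word w = mkmalgU w c.
Proof. by apply/malgP => v; rewrite mcoeffZ !mcoeffU mulrnAr mulr1. Qed.

Lemma freealgE P : P = \sum_(w <- finmap.enum_fset (msupp P)) mcoeff w P *: word w.
Proof. by rewrite {1}(monalgE P); apply: eq_bigr => w _; rewrite scale_word. Qed.

Lemma word_mul v w : word v * word w = word (FMonom (v ++ w)).
Proof. by rewrite /word malgM_def fgmulUU mulr1 /= /mmul /= fmmulE. Qed.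

Lemma word_nil : word (FMonom [::]) = 1.
Proof. by rewrite -fmoneE. Qed.

Lemma freealg_scaleAr (c : K) P Q : c *: (P * Q) = P * (c *: Q).
Proof.
have wZ v w y : word v * (y *: word w) = y *: word (FMonom (v ++ w)).
  by rewrite !scale_word malgM_def fgmulUU mul1r /= /mmul /= fmmulE.
have wQ v : c *: (word v * Q) = word v * (c *: Q).
  rewrite (freealgE Q) mulr_sumr !scaler_sumr mulr_sumr; apply: eq_bigr => w _.
  by rewrite scalerA !wZ scalerA.
rewrite (freealgE P) !mulr_suml scaler_sumr; apply: eq_bigr => v _.
by rewrite -!scalerAl -wQ !scalerA mulrC.
Qed.

HB.instance Definition _ := GRing.Lalgebra_isAlgebra.Build K freealg freealg_scaleAr.

(** The linear extension of h, a function on words. *)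
Definition extend (V : lmodType K) (h : seq bool -> V) P : V :=
  \sum_(w <- finmap.enum_fset (msupp P)) mcoeff w P *: h w.

(** Any finite set containing the support can be summed over, so that two elements
    can be expanded over a common set. *)
Lemma extendw (V : lmodType K) (h : seq bool -> V) (d : finmap.finset_of (Phant (fmonom bool))) P :
  finmap.fsubset (msupp P) d ->
  extend h P = \sum_(w <- finmap.enum_fset d) mcoeff w P *: h w.
Proof.
move=> le; rewrite /extend (finmap.big_fset_incl _ le) // => x xd /mcoeff_outdom ->.
by rewrite scale0r.
Qed.

Lemma extendD (V : lmodType K) (h : seq bool -> V) P Q :
  extend h (P + Q) = extend h P + extend h Q.
Proof.
pose d := finmap.fsetU (msupp P) (msupp Q).
rewrite (@extendw _ h d P) ?finmap.fsubsetUl // (@extendw _ h d Q) ?finmap.fsubsetUr //.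
rewrite (@extendw _ h d) ?msuppD_le // -big_split; apply: eq_bigr => w _ /=.
by rewrite mcoeffD scalerDl.
Qed.

Lemma extendZ (V : lmodType K) (h : seq bool -> V) c P :
  extend h (c *: P) = c *: extend h P.
Proof.
rewrite (@extendw _ h (msupp P)) ?msuppZ_le // scaler_sumr.
by apply: eq_bigr => w _; rewrite mcoeffZ scalerA.
Qed.

Lemma extend_word (V : lmodType K) (h : seq bool -> V) w : extend h (word w) = h w.
Proof.
rewrite (@extendw _ _ (finmap.fset1 w)) ?msuppU_le //.
by rewrite finmap.big_seq_fset1 mcoeffUU scale1r.
Qed.

End FreeAlgebra.

Section FockState.
Variables (K : comNzRingType) (k : bool -> nat -> K).
Implicit Types (g : stack -> K) (P Q : freealg K) (st : stack).

Lemma words_act_sum (x : seq bool) (I : Type) (r : seq I) (f : I -> K)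
    (g : I -> stack -> K) st :
  words_act k (fun st => \sum_(i <- r) f i * g i st) x st
  = \sum_(i <- r) f i * words_act k (g i) x st.
Proof.
elim: x g => //= b x IH g; rewrite -IH; apply: eq_words_act => st'.
exact: act_sum.
Qed.

(** The functional g o P(X_true, X_false), evaluated at a stack. *)
Definition alg_act g P st : K := extend (fun x => words_act k g x st : K^o) P.

Lemma alg_actD g P Q st : alg_act g (P + Q) st = alg_act g P st + alg_act g Q st.
Proof. exact: (extendD (V := K^o)). Qed.

Lemma alg_actZ g c P st : alg_act g (c *: P) st = c * alg_act g P st.
Proof. exact: (extendZ (V := K^o)). Qed.

Lemma alg_act_sum g (I : Type) (r : seq I) (f : I -> K) (P : I -> freealg K) st :
  alg_act g (\sum_(i <- r) f i *: P i) st = \sum_(i <- r) f i * alg_act g (P i) st.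
Proof.
apply: (big_ind2 (fun P x => alg_act g P st = x)) => [|P1 x1 P2 x2 <- <-|i _].
- by rewrite -(scale0r (0 : freealg K)) alg_actZ mul0r.
- by rewrite alg_actD.
- by rewrite alg_actZ.
Qed.

Lemma alg_act_word g w st : alg_act g (word K w) st = words_act k g w st.
Proof. exact: (extend_word (V := K^o)). Qed.

Lemma alg_act1 g st : alg_act g 1 st = g st.
Proof. by rewrite -word_nil alg_act_word. Qed.

Lemma alg_actM g P Q st : alg_act g (P * Q) st = alg_act (alg_act g P) Q st.
Proof.
rewrite (freealgE Q) mulr_sumr; under eq_bigr do rewrite -scalerAr.
rewrite !alg_act_sum; apply: eq_bigr => w _; congr (_ * _).
rewrite alg_act_word words_act_sum {1}(freealgE P) mulr_suml.
under eq_bigr do rewrite -scalerAl.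
rewrite alg_act_sum; apply: eq_bigr => v _; congr (_ * _).
by rewrite word_mul alg_act_word /words_act foldl_cat.
Qed.

Definition fock_state P := alg_act (@vac K) P [::].

Lemma fock_state_is_linear : linear_for *%R fock_state.
Proof. by move=> c P Q; rewrite /fock_state alg_actD alg_actZ. Qed.

HB.instance Definition _ :=
  GRing.isLinear.Build K (freealg K) K *%R fock_state fock_state_is_linear.

Lemma fock_state1 : fock_state 1 = 1.
Proof. by rewrite /fock_state alg_act1. Qed.

(** The two generators, which play the role of the operators X_b. *)
Definition gen b : freealg K := word K (FMonom [:: b]).

Lemma alg_act_gen g b st : alg_act g (gen b) st = act k b g st.
Proof. by rewrite alg_act_word. Qed.

Lemma alg_act_exp (op : (stack -> K) -> stack -> K) P g n st :
  (forall g st, alg_act g P st = op g st) ->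
  (forall g g', g =1 g' -> op g =1 op g') ->
  alg_act g (P ^+ n) st = iter n op g st.
Proof.
move=> PE opE; elim: n st => [|n IH] st; first by rewrite alg_act1.
by rewrite exprSr alg_actM PE /=; apply: opE => st'; exact: IH.
Qed.

Lemma acts1 b g st : acts k (pred1 b) g st = act k b g st.
Proof. by rewrite /acts big_pred1_eq. Qed.

Lemma alg_act_genX b g n st :
  alg_act g (gen b ^+ n) st = iter n (acts k (pred1 b)) g st.
Proof.
apply: alg_act_exp => [g' st'|]; last exact: eq_acts.
by rewrite alg_act_gen acts1.
Qed.

Lemma alg_act_sumX g n st :
  alg_act g ((gen true + gen false) ^+ n) st = iter n (acts k predT) g st.
Proof.
apply: alg_act_exp => [g' st'|]; last exact: eq_acts.
by rewrite alg_actD !alg_act_gen /acts big_bool.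
Qed.

Lemma alg_act_elt g u st : alg_act g (elt (gen true) (gen false) u) st =
  \sum_(i < size u.2) u.2`_i * iter i (acts k (pred1 u.1)) g st.
Proof.
case: u => b p; rewrite /elt /=; have -> : (if b then gen true else gen false) = gen b.
  by case: b.
rewrite -{1}(coefK p) poly_def rmorph_sum /=.
under eq_bigr do rewrite -mul_polyC rmorphM /= horner_algC mulr_algl rmorphXn /= horner_algX.
by rewrite alg_act_sum; apply: eq_bigr => i _; rewrite alg_act_genX.
Qed.

(** Operators of colour b started at a stack v of colour b only produce such
    stacks, and among these h is supported by the empty one. *)
Lemma iter_acts_top b (h : stack -> K) n v :
  (forall i st, h ((b, i) :: st) = 0) -> all (fun x => x.1 == b) v ->
  iter n (acts k (pred1 b)) h v = h [::] * iter n (acts k (pred1 b)) (@vac K) v.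
Proof.
move=> h0; elim: n v => [|n IH] v vb /=.
  case: v vb => [|[c i] v] /=; first by rewrite /vac mulr1.
  by move=> /andP[/eqP -> _]; rewrite h0 /vac mulr0.
rewrite !acts1 /act !IH /= ?eqxx //.
case: v vb => [|[c i] v] /=; first by rewrite !addr0 => _; ring.
by move=> /andP[/eqP -> vb]; rewrite eqxx !IH /= ?eqxx //; ring.
Qed.

Definition headed b st := if st is (c, _) :: _ then c == b else false.

(** Operators of colour b can neither enter w, whose top has the other colour, nor
    contribute through a functional vanishing on stacks headed by b: they act as
    on the vacuum. *)
Lemma iter_acts_unheaded b g n w :
  (forall i st, g ((b, i) :: st) = 0) -> ~~ headed b w ->
  iter n (acts k (pred1 b)) g w =
  g w * iter n (acts k (pred1 b)) (@vac K) [::].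
Proof.
move=> g0 wb; rewrite -[w in LHS]cat0s iter_acts_cat [X in _ + X]big1 => [|i _].
  by rewrite addr0 (@iter_acts_top b (fun v => g (v ++ w))) //= => j st; apply: g0.
rewrite /pops big_pred1_eq /pop; case: w wb => [|[c j] w] /= wb; rewrite ?mul0r //.
by rewrite (negPf wb) mul0r.
Qed.

(** Read from the right, a centred polynomial in X_b applied to a stack not headed
    by b only leaves stacks headed by b. In terms of functionals: if g vanishes on
    the stacks headed by b, then g o p(X_b) vanishes on those that are not, and
    the next factor has the other colour. *)
Lemma fock_free : alg_free fock_state (gen true) (gen false).
Proof.
suff H s b p g : color_alternating ((b, p) :: s) ->
    (forall u, u \in (b, p) :: s -> fock_state (elt (gen true) (gen false) u) = 0) ->
    (forall i st, g ((b, i) :: st) = 0) ->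
    alg_act g (\prod_(u <- (b, p) :: s) elt (gen true) (gen false) u) [::] = 0.
  by case=> [//|[b p] s] _ alt cent; apply: H.
elim: s b p g => [|[c q] s IH] b p g alt cent g0.
all: have g'0 w : ~~ headed b w -> alg_act g (elt (gen true) (gen false) (b, p)) w = 0.
- move=> wb; rewrite alg_act_elt /=.
  under eq_bigr => i _ do rewrite iter_acts_unheaded // mulrCA.
  rewrite -mulr_sumr; have := cent (b, p) (mem_head _ _).
  by rewrite /fock_state alg_act_elt /= => ->; rewrite mulr0.
- by rewrite big_seq1 g'0.
- move=> wb; rewrite alg_act_elt /=.
  under eq_bigr => i _ do rewrite iter_acts_unheaded // mulrCA.
  rewrite -mulr_sumr; have := cent (b, p) (mem_head _ _).
  by rewrite /fock_state alg_act_elt /= => ->; rewrite mulr0.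
rewrite big_cons alg_actM; move: alt => /= /andP[bc alt].
apply: IH => // [u us|i st]; first by apply: cent; rewrite inE us orbT.
by apply: g'0 => /=; rewrite eq_sym.
Qed.

Lemma fock_state_gen b n : fock_state (gen b ^+ n) = fock_moment k (pred1 b) n.
Proof. exact: alg_act_genX. Qed.

Lemma fock_state_sum n :
  fock_state ((gen true + gen false) ^+ n) = fock_moment k predT n.
Proof. exact: alg_act_sumX. Qed.

End FockState.

(** * The Fock state as a star-probability space *)

Local Open Scope complex_scope.
Local Open Scope ring_scope.

Section Complexification.
Variables (R : realType) (k : bool -> nat -> R).

Definition complex_cumulants b n : R[i] := (k b n)%:C.
Local Notation kC := complex_cumulants.

Lemma act_complex b (g : stack -> R) st :
  act kC b (fun st => (g st)%:C) st = (act k b g st)%:C.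
Proof.
rewrite /act /kC !(rmorphD, rmorphM) /=; congr (_ + _).
by case: st => [|[c i] t] /=; [|case: ifP => _]; rewrite ?(rmorphD, rmorphM, rmorph0).
Qed.

Lemma vac_complex st : @vac R[i] st = (@vac R st)%:C.
Proof. by rewrite /vac rmorph_nat. Qed.

Lemma words_act_complex (x : seq bool) (g : stack -> R) st :
  words_act kC (fun st => (g st)%:C) x st = (words_act k g x st)%:C.
Proof.
elim: x g st => //= b x IH g st; rewrite -IH; apply: eq_words_act => st'.
exact: act_complex.
Qed.

Lemma iter_acts_complex B n (g : stack -> R) st :
  iter n (acts kC B) (fun st => (g st)%:C) st = (iter n (acts k B) g st)%:C.
Proof.
elim: n st => //= n IH st; rewrite (eq_acts _ _ IH) /acts rmorph_sum.
by apply: eq_bigr => b _; rewrite act_complex.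
Qed.

Lemma fock_moment_complex B n : fock_moment kC B n = (fock_moment k B n)%:C.
Proof.
rewrite /fock_moment -iter_acts_complex; apply: eq_iter_acts => st.
exact: vac_complex.
Qed.

End Complexification.

(** A real symmetric positive kernel remains positive for complex coefficients: the
    cross terms between real and imaginary parts are antisymmetric and cancel. *)
Lemma psd_complex (R : realType) (T : Type) (G : T -> T -> R) (s : seq (R[i] * T)) :
  psd G -> 0 <= \sum_(p <- s) \sum_(q <- s) p.1^* * q.1 * (G p.2 q.2)%:C.
Proof.
move=> pG; pose re (z : R[i]) := complex.Re z; pose im (z : R[i]) := complex.Im z.
have E (x y : R[i]) (c : R) : x^* * y * c%:C =
    ((re x * re y + im x * im y) * c)%:C + 'i * ((re x * im y - im x * re y) * c)%:C.
  case: x y => [a b] [a' b']; rewrite /re /im /=; simpc.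
  by congr (_ +i* _); ring.
have anti : \sum_(p <- s) \sum_(q <- s)
    (re p.1 * im q.1 - im p.1 * re q.1) * G p.2 q.2 = 0.
  set S := \sum_(p <- s) _; suff : S = - S by lra.
  rewrite {1}/S exchange_big /= -sumrN; apply: eq_bigr => p _.
  rewrite -sumrN; apply: eq_bigr => q _; rewrite (pG.1 q.2); ring.
have pos : 0 <= \sum_(p <- s) \sum_(q <- s)
    (re p.1 * re q.1 + im p.1 * im q.1) * G p.2 q.2.
  have h1 := pG.2 [seq (re p.1, p.2) | p <- s].
  have h2 := pG.2 [seq (im p.1, p.2) | p <- s].
  have := addr_ge0 h1 h2; rewrite !big_map -big_split /=; congr (0 <= _).
  apply: eq_bigr => p _; rewrite !big_map -big_split /=; apply: eq_bigr => q _.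
  by ring.
rewrite (_ : \sum_(p <- s) _ = (\sum_(p <- s) \sum_(q <- s)
    (re p.1 * re q.1 + im p.1 * im q.1) * G p.2 q.2)%:C + 'i *
   (\sum_(p <- s) \sum_(q <- s) (re p.1 * im q.1 - im p.1 * re q.1) * G p.2 q.2)%:C).
  by rewrite anti rmorph0 mulr0 addr0 ler0c.
rewrite !rmorph_sum mulr_sumr -big_split; apply: eq_bigr => p _ /=.
rewrite !rmorph_sum mulr_sumr -big_split; apply: eq_bigr => q _ /=.
exact: E.
Qed.

Section StarAlgebra.
Variable R : realType.
Local Notation A := (freealg R[i]).
Implicit Types P Q : A.

(** Words are reversed and coefficients conjugated: the generators are
    self-adjoint. *)
Definition adjoint P : A :=
  \sum_(w <- finmap.enum_fset (msupp P)) (mcoeff w P)^* *: word R[i] (FMonom (rev w)).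

Lemma adjointw (d : finmap.finset_of (Phant (fmonom bool))) P :
  finmap.fsubset (msupp P) d -> adjoint P =
  \sum_(w <- finmap.enum_fset d) (mcoeff w P)^* *: word R[i] (FMonom (rev w)).
Proof.
move=> le; rewrite /adjoint (finmap.big_fset_incl _ le) // => x xd /mcoeff_outdom ->.
by rewrite conjC0 scale0r.
Qed.

Lemma adjointD P Q : adjoint (P + Q) = adjoint P + adjoint Q.
Proof.
pose d := finmap.fsetU (msupp P) (msupp Q).
rewrite (@adjointw d P) ?finmap.fsubsetUl // (@adjointw d Q) ?finmap.fsubsetUr //.
rewrite (@adjointw d) ?msuppD_le // -big_split; apply: eq_bigr => w _ /=.
by rewrite mcoeffD rmorphD scalerDl.
Qed.

Lemma adjointZ (c : R[i]) P : adjoint (c *: P) = c^* *: adjoint P.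
Proof.
rewrite (@adjointw (msupp P)) ?msuppZ_le // scaler_sumr.
by apply: eq_bigr => w _; rewrite mcoeffZ rmorphM scalerA.
Qed.

Lemma adjoint_word w : adjoint (word R[i] w) = word R[i] (FMonom (rev w)).
Proof.
rewrite (@adjointw (finmap.fset1 w)) ?msuppU_le //.
by rewrite finmap.big_seq_fset1 mcoeffUU conjC1 scale1r.
Qed.

Lemma adjoint_sum (I : Type) (r : seq I) (c : I -> R[i]) (P : I -> A) :
  adjoint (\sum_(i <- r) c i *: P i) = \sum_(i <- r) (c i)^* *: adjoint (P i).
Proof.
apply: (big_ind2 (fun P Q => adjoint P = Q)) => [|P1 x1 P2 x2 <- <-|i _].
- by rewrite -(scale0r (0 : A)) adjointZ conjC0 !scale0r.
- by rewrite adjointD.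
- by rewrite adjointZ.
Qed.

Lemma adjointK : involutive adjoint.
Proof.
move=> P; rewrite [adjoint P]/adjoint adjoint_sum [RHS]freealgE.
by apply: eq_bigr => w _; rewrite conjCK adjoint_word /= revK fmK.
Qed.

Lemma adjointM P Q : adjoint (P * Q) = adjoint Q * adjoint P.
Proof.
rewrite [adjoint P]/adjoint [adjoint Q]/adjoint mulr_suml.
rewrite {1}(freealgE P) {1}(freealgE Q) mulr_suml.
under eq_bigr do rewrite mulr_sumr.
rewrite exchange_big /=.
transitivity (adjoint (\sum_(w <- finmap.enum_fset (msupp Q)) 1 *:
   \sum_(v <- finmap.enum_fset (msupp P))
     (mcoeff v P * mcoeff w Q) *: word R[i] (FMonom (v ++ w)))).
  congr adjoint; apply: eq_bigr => w _; rewrite scale1r; apply: eq_bigr => v _.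
  by rewrite -scalerAl -scalerAr scalerA word_mul.
rewrite adjoint_sum; apply: eq_bigr => w _; rewrite conjC1 scale1r adjoint_sum.
rewrite mulr_sumr; apply: eq_bigr => v _.
by rewrite adjoint_word rmorphM -scalerAl -scalerAr scalerA word_mul rev_cat mulrC.
Qed.

Section State.
Variable k : bool -> nat -> R.
Hypothesis kP : forall b, psd (cumulant_kernel (k b)).
Local Notation kC := (complex_cumulants k).

(** The state of P^* P is a hermitian square for the kernel of psd_fock. *)
Lemma fock_state_ge0 P : 0 <= fock_state kC (adjoint P * P).
Proof.
pose s := [seq (mcoeff w P, fmonom_val w) | w <- finmap.enum_fset (msupp P)].
have := psd_complex s (psd_fock kP).
rewrite /s big_map; congr (0 <= _).
rewrite [adjoint P]/adjoint mulr_suml linear_sum; apply: eq_bigr => v _ /=.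
rewrite big_map [X in fock_state _ (_ * X)]freealgE mulr_sumr linear_sum; apply: eq_bigr => w _ /=.
rewrite -[in RHS]scalerAr -[in RHS]scalerAl word_mul linearZ /= linearZ /= -mulrA mulrCA.
congr (_ * _); rewrite /fock_state alg_act_word /=.
by rewrite (eq_words_act _ _ (@vac_complex R)) words_act_complex.
Qed.

Definition fock_space : star_probability_space R :=
  @StarProbabilitySpace R A adjoint (fock_state kC) adjointK adjointD adjointZ
    adjointM (fock_state1 kC) fock_state_ge0.

Lemma gen_selfadjoint b : selfadjoint (S := fock_space) (gen _ b).
Proof. exact: adjoint_word. Qed.

End State.
End StarAlgebra.

(** * Free cumulants of measures *)

Section Cumulants.
Variable R : realType.
Implicit Types (mu nu rho : Mc R) (k : nat -> R).

(** The Fock space moments built on the free cumulants of m solve the recursion and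
    satisfy the same moment-cumulant formula as m. *)
Lemma cumulant_system (m : nat -> R) : m 0%N = 1 ->
  exists T, moment_system m (free_cumulant_of m) T.
Proof.
move=> m0; set k := free_cumulant_of m.
have sys := fock_moment_system (fun=> k) (pred1 true).
set fm := fock_moment _ _ in sys.
have mE : m =1 fm.
  move=> [|n]; first by rewrite m0; case: sys.
  rewrite moment_cumulant // -(nc_sum_moment sys).
  apply: eq_bigr => P _; apply: eq_bigr => V _.
  by rewrite /fock_cumulant big_pred1_eq.
exists (fock_tail (fun=> k) (pred1 true)).
case: sys => s0 sS sT; split=> [||n s s0']; rewrite ?mE //.
  by move=> n; rewrite mE.
rewrite sT // /fock_cumulant big_pred1_eq; congr (_ + _).
by apply: eq_bigr => i _; rewrite mE.
Qed.

Lemma measure_system mu : exists T, moment_system (moment mu) (free_cumulant mu) T.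
Proof. exact/cumulant_system/moment0. Qed.

Lemma cumulants_of_system mu k T : moment_system (moment mu) k T ->
  forall n, (0 < n)%N -> free_cumulant mu n = k n.
Proof.
have [T' S'] := measure_system mu => S.
exact: (moment_system_determines_cumulants (fun=> erefl) S' S).
Qed.

Lemma moments_of_cumulants mu k T (m : nat -> R) : moment_system m k T ->
  (forall n, (0 < n)%N -> free_cumulant mu n = k n) -> moment mu =1 m.
Proof.
have [T' S'] := measure_system mu => S e.
exact: (moment_system_determines_moments e S' S).
Qed.

Lemma cumulant_inj mu nu :
  (forall n, (0 < n)%N -> free_cumulant mu n = free_cumulant nu n) -> mu ≡μ nu.
Proof.
move=> e; apply: moment_inj; have [T S] := measure_system nu.
exact: moments_of_cumulants S e.
Qed.

Lemma eq_cumulant mu nu : mu ≡μ nu -> free_cumulant mu = free_cumulant nu.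
Proof.
by move=> /eq_moment e; rewrite /free_cumulant (_ : moment mu = moment nu) //; apply/funext.
Qed.

Lemma fock_moment_cumulant mu (k : bool -> nat -> R) B :
  (forall n, (0 < n)%N -> free_cumulant mu n = fock_cumulant k B n) ->
  forall n, fock_moment k B n = moment mu n.
Proof.
move=> e n; apply/esym; apply: moments_of_cumulants e n.
exact: fock_moment_system.
Qed.

Definition cumulant_pair mu nu (b : bool) := if b then free_cumulant mu else free_cumulant nu.

Lemma fock_cumulant1 (k : bool -> nat -> R) b n : fock_cumulant k (pred1 b) n = k b n.
Proof. exact: big_pred1_eq. Qed.

Lemma fock_cumulant2 (k : bool -> nat -> R) n :
  fock_cumulant k predT n = k true n + k false n.
Proof. by rewrite /fock_cumulant big_bool. Qed.

(** Freeness determines the moments of a + b from those of a and b, so they are the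
    moments of the sum of the Fock operators built on the cumulants of mu and nu,
    which are free with the same laws. These have cumulants kappa(mu) + kappa(nu). *)
Lemma boxplus_cumulant mu nu rho : boxplus mu nu rho -> forall n, (0 < n)%N ->
  free_cumulant rho n = free_cumulant mu n + free_cumulant nu n.
Proof.
move=> [S [a [b [_ [fab la lb lab]]]]].
pose k := cumulant_pair mu nu; pose kC := complex_cumulants k.
have law (c : bool) n : fock_state kC (gen _ c ^+ n) = (moment (if c then mu else nu) n)%:C.
  rewrite fock_state_gen fock_moment_complex; congr (_%:C).
  by apply: fock_moment_cumulant => s _; rewrite fock_cumulant1; case: c.
have lawT n : state S (a ^+ n) = fock_state kC (gen _ true ^+ n) by rewrite la law.
have lawF n : state S (b ^+ n) = fock_state kC (gen _ false ^+ n) by rewrite lb law.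
have sum n : state S ((a + b) ^+ n) = fock_state kC ((gen _ true + gen _ false) ^+ n).
  exact: (free_determines_sum (state1 S) (fock_state1 kC) fab (@fock_free _ kC) lawT lawF).
have mE n : moment rho n = fock_moment k predT n.
  have := sum n. rewrite lab fock_state_sum fock_moment_complex.
  by move=> /complexI.
have [s0 sS sT] := fock_moment_system k predT.
have sys : moment_system (moment rho) (fock_cumulant k predT) (fock_tail k predT).
  split=> [|n|n s s0']; rewrite ?mE // sT //; congr (_ + _).
  by apply: eq_bigr => i _; rewrite mE.
by move=> n n0; rewrite (cumulants_of_system sys) // fock_cumulant2.
Qed.

(** The Fock space realises free variables with the prescribed laws; positivity of
    the cumulant kernels is what makes its state positive. *)
Lemma boxplus_of_cumulants mu nu rho :
  psd (cumulant_kernel (free_cumulant mu)) -> psd (cumulant_kernel (free_cumulant nu)) ->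
  (forall n, (0 < n)%N -> free_cumulant rho n = free_cumulant mu n + free_cumulant nu n) ->
  boxplus mu nu rho.
Proof.
move=> pmu pnu e; pose k := cumulant_pair mu nu.
have kP b : psd (cumulant_kernel (k b)) by case: b.
exists (fock_space kP), (gen _ true), (gen _ false).
split; first by split; apply: gen_selfadjoint.
have law (c : bool) (rho' : Mc R) B P :
    (forall n, fock_state (complex_cumulants k) (P ^+ n) = fock_moment (complex_cumulants k) B n) ->
    (forall n, (0 < n)%N -> free_cumulant rho' n = fock_cumulant k B n) ->
    has_law (S := fock_space kP) P rho'.
  move=> PE cE n; rewrite /= PE fock_moment_complex; congr (_%:C).
  exact: fock_moment_cumulant.
split; first exact: fock_free.
- apply: (law true mu (pred1 true)) => n; first exact: fock_state_gen.
  by rewrite fock_cumulant1.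
- apply: (law true nu (pred1 false)) => n; first exact: fock_state_gen.
  by rewrite fock_cumulant1.
- apply: (law true rho predT) => n; first exact: fock_state_sum.
  by move=> n0; rewrite fock_cumulant2 e.
Qed.

(** The sequences that are free cumulants of a measure in Minf: positivity of the
    kernel expresses infinite divisibility and the growth bound compactness of the
    support. *)
Definition levy_cumulants k := psd (cumulant_kernel k) /\
  exists2 D, 0 <= D & forall n, (0 < n)%N -> `|k n| <= D ^+ n.

Lemma eq_levy_cumulants k k' : (forall n, (0 < n)%N -> k n = k' n) ->
  levy_cumulants k -> levy_cumulants k'.
Proof.
move=> e [pk [D D0 kD]]; split; last by exists D => // n n0; rewrite -e ?kD.
by apply: eq_psd pk => i j; rewrite /cumulant_kernel e // addn2.
Qed.

Lemma levy_cumulants0 : levy_cumulants (fun=> 0).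
Proof.
split; last by exists 0 => // n _; rewrite normr0 exprn_ge0.
split=> // s; rewrite big1 // => p _; rewrite big1 // => q _.
by rewrite /cumulant_kernel mulr0.
Qed.

Lemma levy_cumulants1 : levy_cumulants (fun=> 1).
Proof. by split; [exact: psd1|exists 1 => // n _; rewrite normr1 expr1n]. Qed.

Lemma levy_cumulantsD k k' : levy_cumulants k -> levy_cumulants k' ->
  levy_cumulants (fun n => k n + k' n).
Proof.
move=> [pk [D D0 kD]] [pk' [D' D'0 kD']]; split; first exact: psdD.
(* The factor 2 absorbs the number of terms, as 2 <= 2^n for n > 0. *)
exists (2 * (D + D')) => [|n n0]; first by rewrite mulr_ge0 // addr_ge0.
apply: le_trans (ler_normD _ _) _; have h1 := kD n n0; have h2 := kD' n n0.
have e1 : D ^+ n <= (D + D') ^+ n by apply: lerXn2r; rewrite ?nnegrE ?addr_ge0 //; lra.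
have e2 : D' ^+ n <= (D + D') ^+ n by apply: lerXn2r; rewrite ?nnegrE ?addr_ge0 //; lra.
have h0 : 0 <= (D + D') ^+ n by rewrite exprn_ge0 ?addr_ge0.
rewrite exprMn; have : 2 * (D + D') ^+ n <= 2 ^+ n * (D + D') ^+ n; last lra.
by apply: ler_wpM2r => //; rewrite -[leLHS]expr1 ler_eXn2l // ltr1n.
Qed.

Lemma levy_cumulantsM k k' : levy_cumulants k -> levy_cumulants k' ->
  levy_cumulants (fun n => k n * k' n).
Proof.
move=> [pk [D D0 kD]] [pk' [D' D'0 kD']]; split; first exact: psd_schur.
exists (D * D') => [|n n0]; first exact: mulr_ge0.
by rewrite normrM exprMn; apply: ler_pM; rewrite ?kD ?kD'.
Qed.

Lemma levy_cumulantsZ c k : 0 <= c -> levy_cumulants k ->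
  levy_cumulants (fun n => c * k n).
Proof.
move=> c0 [pk [D D0 kD]]; split.
  split=> [i j|s]; first by rewrite /cumulant_kernel (addnC i).
  have := mulr_ge0 c0 (pk.2 s); rewrite mulr_sumr; congr (0 <= _).
  apply: eq_bigr => p _; rewrite mulr_sumr; apply: eq_bigr => q _.
  by rewrite /cumulant_kernel; ring.
exists ((1 + c) * D) => [|n n0]; first by rewrite mulr_ge0 // addr_ge0.
rewrite normrM exprMn; apply: ler_pM => //; last exact: kD.
rewrite ger0_norm //; apply: (@le_trans _ _ (1 + c)); first lra.
by rewrite -[leLHS]expr1; apply: ler_weXn2l => //; lra.
Qed.

(** The Fock space moments built on k are a positive sequence, because they are
    vacuum moments of a symmetric operator, and grow geometrically; a measure with
    these moments exists by moment_problem. *)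
Lemma measure_of_levy_cumulants k : levy_cumulants k ->
  exists mu : Mc R, forall n, (0 < n)%N -> free_cumulant mu n = k n.
Proof.
move=> [pk [D D0 kD]]; pose m := fock_moment (fun=> k) (pred1 true).
have sys := fock_moment_system (fun=> k) (pred1 true).
have mE n : m n = iter n (act (fun=> k) true) (@vac R) [::].
  rewrite /m /fock_moment; elim: n [::] => //= n IH st.
  by rewrite acts1; apply: eq_act.
have pm : psd (fun i j => m (i + j)%N).
  have := psd_weight (fun=> 1) (fun n => nseq n true) (@psd_fock R (fun=> k) (fun=> pk)).
  apply: eq_psd => i j; rewrite !mul1r mE rev_nseq cat_nseq -[ncons _ _ _]cat_nseq -nseqD.
  by elim: (i + j)%N (@vac R) => //= n IH g; rewrite IH -iterSr.
have r0 : 0 < 4 * D + 1 by lra.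
have mr n : `|m n| <= (4 * D + 1) ^+ n.
  rewrite mE; apply: le_trans (fock_moment_bound D0 kD n) _.
  by apply: lerXn2r; rewrite ?nnegrE; lra.
have m0 : m 0%N = 1 by case: sys.
have [mu muE] := moment_problem r0 m0 pm mr; exists mu => n n0.
rewrite -(fock_cumulant1 (fun=> k) true).
have [T S] := measure_system mu.
exact: (moment_system_determines_cumulants muE S sys).
Qed.

Lemma boxpower_cumulant mu n rho : boxpower mu n rho ->
  forall s, (0 < s)%N -> free_cumulant rho s = n%:R * free_cumulant mu s.
Proof.
elim=> [s _|m sigma rho' _ IH bp s s0]; first by rewrite mul1r.
by rewrite (boxplus_cumulant bp) // IH // -natr1 mulrDl mul1r.
Qed.

(** The sequences (j / n) kappa also are cumulants of measures; the one for j = 1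
    is the n-th root, and boxplus_of_cumulants adds them up. *)
Lemma levy_infinitely_divisible mu :
  levy_cumulants (free_cumulant mu) -> infinitely_divisible mu.
Proof.
move=> lmu n n0; have nR : n%:R != 0 :> R by rewrite pnatr_eq0 -lt0n.
pose k (j : nat) s := j%:R / n%:R * free_cumulant mu s.
have lk j : levy_cumulants (k j) by apply: levy_cumulantsZ => //; rewrite divr_ge0.
have /choice[nu nuE] : forall j, exists nu : Mc R,
    forall s, (0 < s)%N -> free_cumulant nu s = k j s.
  by move=> j; apply: measure_of_levy_cumulants.
have pnu j : psd (cumulant_kernel (free_cumulant (nu j))).
  by apply: (eq_levy_cumulants _ (lk j)).1 => s s0; rewrite nuE.
have step j (rho : Mc R) : (forall s, (0 < s)%N -> free_cumulant rho s = k j.+1 s) ->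
    boxplus (nu j) (nu 1%N) rho.
  move=> e; apply: boxplus_of_cumulants => // s s0.
  by rewrite e // !nuE // /k -natr1; ring.
have pow j : boxpower (nu 1%N) j.+1 (nu j.+1).
  elim: j => [|j IH]; first exact: boxpower1.
  by apply: boxpowerS IH (step _ _ _) => s s0; rewrite nuE.
have [n1|n1] := eqVneq n 1%N; first by exists mu; rewrite n1; apply: boxpower1.
have nE : n = n.-2.+2 by lia.
exists (nu 1%N); rewrite nE; apply: boxpowerS (pow n.-2) (step _ _ _) => s s0.
by rewrite /k -nE divff // mul1r.
Qed.

Section DivisibleCumulants.
Variable mu : Mc R.
Local Notation kappa := (free_cumulant mu).

(** If mu is the N-th free convolution power of nu, then kappa(nu) = kappa(mu) / N
    and the moment-cumulant formula reads N m_n(nu) = sum over P of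
    N^(1 - #blocks) prod kappa(mu): a polynomial in 1 / N whose value at 0 is the
    term of the one-block partition. *)
Definition scaled_moment_poly n : {poly R} :=
  \sum_(P in NC n) (\prod_(V in P) kappa #|V|) *: 'X^(#|P|.-1).

Lemma NC_card n (P : {set {set 'I_n}}) : (0 < n)%N -> P \in NC n -> (0 < #|P|)%N.
Proof.
move=> n0; rewrite finset.inE => /andP[/and3P[/eqP cP _ _] _].
rewrite card_gt0; apply: contraTneq n0 => P0.
by rewrite -leqNgt -[n]card_ord -finset.cardsT -cP P0 /finset.cover big_set0 cards0.
Qed.

Lemma scaled_moment_polyE nu N n : (0 < N)%N -> (0 < n)%N ->
  (forall s, (0 < s)%N -> kappa s = N%:R * free_cumulant nu s) ->
  moment nu n = N%:R^-1 * (scaled_moment_poly n).[N%:R^-1].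
Proof.
move=> N0 n0 e; have NR : N%:R != 0 :> R by rewrite pnatr_eq0 -lt0n.
rewrite moment_cumulant // horner_sum mulr_sumr; apply: eq_bigr => P PNC.
rewrite hornerZ hornerXn mulrCA -exprS prednK ?(NC_card n0) //.
have -> : (N%:R^-1) ^+ #|P| = \prod_(V in P) (N%:R^-1 : R) by rewrite prodr_const.
rewrite -big_split; apply: eq_bigr => V VP /=.
rewrite e; first by rewrite mulrAC mulfV // mul1r.
move: PNC; rewrite finset.inE => /andP[/and3P[_ _ P0] _].
by rewrite card_gt0; apply: contraNneq P0 => <-.
Qed.

Lemma scaled_moment_poly0 n : (0 < n)%N -> (scaled_moment_poly n).[0] = kappa n.
Proof.
move=> n0.
have full : [set [set: 'I_n]]%SET \in NC n.
  rewrite inE; apply/andP; split.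
    rewrite /finset.partition finset.cover1 eqxx finset.trivIset1 finset.in_set1.
    by rewrite eqtype.eq_sym -card_gt0 finset.cardsT card_ord.
  apply/forall_inP => V /finset.set1P ->; apply/forall_inP => W /finset.set1P ->.
  by do 4![apply/forall_inP => ? _]; rewrite eqxx implybT.
rewrite horner_sum (bigD1 [set [set: 'I_n]]%SET) //= big_set1 finset.cards1.
rewrite hornerZ hornerXn expr0 mulr1 finset.cardsT card_ord big1 ?addr0 //.
move=> P /andP[PNC Pn1]; rewrite hornerZ hornerXn expr0n.
case: eqP => [P1|_]; last by rewrite mulr0.
have /cards1P[V PV] : #|P| == 1%N by rewrite -(prednK (NC_card n0 PNC)) P1.
case/eqP: Pn1; rewrite PV; congr [set _]%SET.
move: PNC; rewrite finset.inE => /andP[/and3P[/eqP <- _ _] _].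
by rewrite PV finset.cover1.
Qed.

(** The kernel N m_(i+j+2)(nu_N) is positive for each N, nu_N being the N-th root
    of mu, and tends to kappa_(i+j+2)(mu) as N grows. Were the quadratic form of
    the limit negative at a test vector, it would already be so for some N, as a
    polynomial in 1 / N is continuous at 0. *)
Lemma infinitely_divisible_levy : infinitely_divisible mu -> levy_cumulants kappa.
Proof.
move=> div; split; last first.
  have [r r0 mr] := moment_bound mu; have [T S] := measure_system mu.
  exists (16 * r); first by rewrite mulr_ge0 // ltW.
  by move=> n n0; apply: moment_system_cumulant_bound S n n0.
split=> [i j|s]; first by rewrite /cumulant_kernel (addnC i).
pose Z : {poly R} := \sum_(p <- s) \sum_(q <- s)
  (p.1 * q.1) *: scaled_moment_poly (p.2 + q.2 + 2).
have Z0 : Z.[0] = \sum_(p <- s) \sum_(q <- s) p.1 * q.1 * cumulant_kernel kappa p.2 q.2.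
  rewrite /Z horner_sum; apply: eq_bigr => p _; rewrite horner_sum; apply: eq_bigr => q _.
  by rewrite hornerZ scaled_moment_poly0 // addn2.
rewrite -Z0 leNgt; apply/negP => /poly_lt0_near[e e0 Ze].
pose N := (Num.truncn (e^-1)).+1.
have eN : N%:R^-1 < e :> R by rewrite invf_plt ?posrE // truncnS_gt.
have [nu /boxpower_cumulant nuE] := div N isT.
have : Z.[N%:R^-1] < 0 by apply: Ze; rewrite subr0 gtr0_norm ?invr_gt0.
rewrite ltNge => /negP; apply.
have := (psd_weight (fun=> 1) succn (psd_moment nu)).2 s.
rewrite -(pmulr_rge0 _ (_ : 0 < N%:R)) // mulr_sumr /Z horner_sum; congr (0 <= _).
apply: eq_bigr => p _; rewrite horner_sum mulr_sumr; apply: eq_bigr => q _.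
rewrite hornerZ !mul1r addSn addnS -addn2 (@scaled_moment_polyE nu N) ?addn2 //.
by rewrite mulrCA mulVKf ?pnatr_eq0 //.
Qed.

End DivisibleCumulants.

Lemma Minf_levy (mu : Minf R) : levy_cumulants (free_cumulant mu).
Proof. exact/infinitely_divisible_levy/Minf_divisible. Qed.

Lemma Minf_of_levy_cumulants k : levy_cumulants k ->
  exists mu : Minf R, forall n, (0 < n)%N -> free_cumulant mu n = k n.
Proof.
move=> lk; have [mu muE] := measure_of_levy_cumulants lk.
have dmu : infinitely_divisible mu.
  apply: levy_infinitely_divisible; apply: eq_levy_cumulants lk => n n0.
  by rewrite muE.
by exists (MkMinf dmu).
Qed.

End Cumulants.

(** * The semi-ring *)

Lemma dirac_compactly_supported (R : realType) (a : R) :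
  compactly_supported (\d_(a : measurableTypeR R)).
Proof.
exists [set a]; first exact: compact_set1.
have e : @dirac _ (measurableTypeR R) a R (~` [set a]) = 0%E.
  by rewrite diracE memNset // => /(_ erefl).
exact: e.
Qed.

Lemma dirac0_cumulant (R : realType) n : (0 < n)%N ->
  free_cumulant (MkMc (dirac_compactly_supported (0 : R))) n = 0.
Proof.
move=> n0; set mu := MkMc _.
have mE s : moment mu s = 0 ^+ s.
  rewrite /moment /Rintegral; apply: etrans (congr1 fine (integral_dirac _ _ _)) _ => //.
    by apply/measurable_EFinP; exact: exprn_measurable.
  by rewrite diracT mul1e.
apply: (@cumulants_of_system _ mu (fun=> 0) (fun _ _ => 0)) => //.
split=> [|s|s t _]; rewrite ?mE ?expr0 ?expr0n //.
by rewrite mul0r big1 ?addr0 // => i _; rewrite mulr0.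
Qed.

Lemma boxplusP (R : realType) (mu nu : Minf R) (rho : Mc R) :
  boxplus mu nu rho <-> forall n, (0 < n)%N ->
    free_cumulant rho n = free_cumulant mu n + free_cumulant nu n.
Proof.
split; first exact: boxplus_cumulant.
exact: boxplus_of_cumulants (Minf_levy mu).1 (Minf_levy nu).1.
Qed.

Lemma RtransformP (R : realType) (rho : Mc R) f :
  Rtransform rho = f <-> forall n, (0 < n)%N -> free_cumulant rho n = f n.-1.
Proof.
split=> [<- [//|n] _ //|e]; apply/funext => n.
by rewrite /Rtransform e.
Qed.

Lemma cumulantP (R : realType) (mu nu : Mc R) (k : nat -> R) :
  (forall n, (0 < n)%N -> free_cumulant nu n = k n) ->
  (forall n, (0 < n)%N -> free_cumulant mu n = k n) <-> mu ≡μ nu.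
Proof.
move=> e; split=> [e'|/eq_cumulant -> //].
by apply: cumulant_inj => n n0; rewrite e ?e'.
Qed.

Theorem theorem4p9 (R : realType) :
  exists (add mul : Minf R -> Minf R -> Minf R) (zero one : Minf R),
    [/\ (forall (mu nu : Minf R) (rho : Mc R),
           boxplus mu nu rho <-> rho ≡μ add mu nu),
        (forall (mu nu : Minf R) (rho : Mc R),
           boxdot mu nu rho <-> rho ≡μ mul mu nu),
        zero ≡μ \d_(0 : measurableTypeR R),
        (forall rho : Mc R, free_poisson rho <-> rho ≡μ one)
      & comm_semiring (@Minf_eq R) add mul zero one].
Proof.
have /choice[add addE] (p : Minf R * Minf R) := Minf_of_levy_cumulants
  (levy_cumulantsD (Minf_levy p.1) (Minf_levy p.2)).
have /choice[mul mulE] (p : Minf R * Minf R) := Minf_of_levy_cumulants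
  (levy_cumulantsM (Minf_levy p.1) (Minf_levy p.2)).
have [zero zeroE] := Minf_of_levy_cumulants (levy_cumulants0 R).
have [one oneE] := Minf_of_levy_cumulants (levy_cumulants1 R).
exists (fun mu nu => add (mu, nu)), (fun mu nu => mul (mu, nu)), zero, one.
split=> [mu nu rho|mu nu rho||rho|].
- by rewrite -(cumulantP _ (addE (mu, nu))); exact: boxplusP.
- rewrite -(cumulantP _ (mulE (mu, nu))) /boxdot RtransformP.
  by split=> e [//|n] n0; rewrite e.
- apply: (@cumulant_inj _ zero (MkMc (dirac_compactly_supported (0 : R)))) => n n0.
  by rewrite zeroE // dirac0_cumulant.
- by rewrite -(cumulantP _ oneE) /free_poisson RtransformP.
(* Both sides of a semi-ring law have the same cumulants, by the laws of R. *)
split; try by move=> *; apply: cumulant_inj => n n0;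
  rewrite ?(addE, mulE, zeroE, oneE) //=; rewrite ?(addE, mulE, zeroE, oneE) //=; ring.
- by move=> mu nu e A mA; rewrite e.
- by move=> mu nu rho e e' A mA; rewrite e // e'.
- move=> x x' y y' ex ey; apply: cumulant_inj => n n0.
  by rewrite !addE //= (eq_cumulant ex) (eq_cumulant ey).
- move=> x x' y y' ex ey; apply: cumulant_inj => n n0.
  by rewrite !mulE //= (eq_cumulant ex) (eq_cumulant ey).
Qed.
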